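(* Let $I^{\mathrm{alg}}_{\mathrm{CF}}\subset\mathcal{S}(\mathbb{Q}\langle\mathcal{B}\rangle^{0})$ and $I_{\mathrm{CF}}\subset\mathbb{Q}\langle\mathcal{B}\rangle^{0}$ be the spaces of confluence relations. Let $Z^{\mathrm{SZ}}\colon\mathbb{Q}\langle\mathcal{B}\rangle^{0}\to\mathbb{Q}[[q]]$ be the $\mathbb{Q}$-linear map sending $b_{k_1}\cdots b_{k_d}$ to the formal power series $$\sum_{0<m_1<\cdots<m_d}\prod_{j=1}^{d}\left(\frac{q^{m_j}}{1-q^{m_j}}\right)^{k_j}$$ (and the empty word to $1$), and let $\widetilde{Z}^{\mathrm{SZ}}\colon\mathcal{S}(\mathbb{Q}\langle\mathcal{B}\rangle^{0})\to\mathbb{Q}[[q]]$ be the unique $\mathbb{Q}$-algebra homomorphism extending $Z^{\mathrm{SZ}}$. Then $$I^{\mathrm{alg}}_{\mathrm{CF}}\subset\ker\widetilde{Z}^{\mathrm{SZ}}\qquad\text{and}\qquad I_{\mathrm{CF}}\subset\ker Z^{\mathrm{SZ}}.$$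
   Context: **Words.** $\mathbb{Q}\langle\mathcal{B}\rangle$ is the free noncommutative $\mathbb{Q}$-algebra on $\mathcal{B}=\{b_0,b_1,b_2,\dots\}$ with empty word $1$; $\mathbb{Q}\langle\mathcal{B}\rangle^{0}$ is the subspace spanned by $1$ and all words not ending with $b_0$. The stuffle product $*$ on $\mathbb{Q}\langle\mathcal{B}\rangle$ is the $\mathbb{Q}$-bilinear map with $1*u=u*1=u$ and $(b_iu)*(b_jv)=b_i(u*b_jv)+b_j(b_iu*v)+b_{i+j}(u*v)$ for $i,j\ge0$. Every $u\in\mathbb{Q}\langle\mathcal{B}\rangle$ is uniquely $u=u_0+u_1*b_0+\cdots+u_k*b_0^{*k}$ with $u_j\in\mathbb{Q}\langle\mathcal{B}\rangle^{0}$; put $\operatorname{reg}_*(u)=u_0$. **Formal $q$MPLs.** For $X\subset\mathbb{Z}$, $q^X=\{q^n: n\in X\}$ ($q$ is not a root of unity, so that the monomials $z^hq^m$ are pairwise distinct). $\hat{\mathcal{F}}$ is the set of formal symbols $\mathbb{L}_{k_1,\dots,k_d}(x_1,\dots,x_d)$ with $d\ge0$, $k_i\in\mathbb{Z}_{\ge1}$, $x_i\in\{z^hq^m: h\in\{0,\pm1\},\,m\in\mathbb{Z}\}$ and $x_i\cdots x_d\in zq^{\mathbb{Z}}\cup q^{\mathbb{Z}_{>0}}$ for $1\le i\le d$; the case $d=0$ is written $\mathbb{L}(\emptyset)$. Weight: $k_1+\cdots+k_d$. For $\mathcal{X}\subset\hat{\mathcal{F}}$, $\mathbb{Q}\mathcal{X}$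 is the $\mathbb{Q}$-vector space with basis $\mathcal{X}$. Let $\Omega=\bigoplus_{b\in\{0\}\cup q^{\mathbb{Z}}}\mathbb{Q}e_b$, with formal symbols $e_b$. **Single-position difference $D$.** $\mathbb{L}_{k_1,\dots,k_d}(x_1,\dots,x_d)$ and $\mathbb{L}_{k_1,\dots,k_d}(x'_1,\dots,x'_d)$ in $\hat{\mathcal{F}}$ are adjacent if for some $j$: $x_i=x_i'$ for $i\ne j$, $x_j\in zq^{\mathbb{Z}}\cup z^{-1}q^{\mathbb{Z}}$, $x_j/x_j'\in\{q^{\pm1}\}$. For adjacent $u=\mathbb{L}_{k_1,\dots,k_d}(x_1,\dots,x_d)$ and $v=\mathbb{L}_{k_1,\dots,k_d}(x_1,\dots,qx_j,\dots,x_d)$ put - if $k_j>1$: $D(u,v)=\mathbb{L}_{k_1,\dots,k_j-1,\dots,k_d}(x_1,\dots,x_d)\otimes e_0$; - if $k_j=1$, $x_j=q^mz$: $D(u,v)=-A\otimes e_{q^{-m}}+B\otimes(e_{q^{-m}}-e_0)$; - if $k_j=1$, $x_j=q^{-m}z^{-1}$: $D(u,v)=A\otimes(e_{q^{-m}}-e_0)-B\otimes e_{q^{-m}}$; where $A=\mathbb{L}_{k_1,\dots,\widehat{k_j},\dots,k_d}(x_1,\dots,x_{j-1}x_j,\dots,x_d)$ (read as $\mathbb{L}_{k_2,\dots,k_d}(x_2,\dots,x_d)$ if $j=1$) and $B=\mathbb{L}_{k_1,\dots,\widehat{k_j},\dots,k_d}(x_1,\dots,x_jx_{j+1},\dots,x_d)$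 (read as $0$ if $j=d$). If instead $v$ is obtained from $u$ by $x_j\mapsto q^{-1}x_j$, put $D(u,v)=-D(v,u)$. **$\mathcal{F}^n$, $\mathcal{F}$, standard path.** For $n\in\mathbb{Z}$, $\mathcal{F}^n$ is the set of $\mathbb{L}_{k_1,\dots,k_d}(x_1,\dots,x_d)\in\hat{\mathcal{F}}$ with $x_i\in\{vq^s: v\in\{1,zq^n,(zq^n)^{-1}\},\,0\le s\le k_i\}$ for all $i$; $\mathcal{F}=\bigcup_n\mathcal{F}^n$. For $u=\mathbb{L}_{k_1,\dots,k_d}(x_1(z),\dots,x_d(z))\in\mathcal{F}$, the level of a $z$-dependent position $i$ is the unique integer $r$ with $x_i=zq^r$ or $x_i=z^{-1}q^{1-r}$. Levels are computed from $u$ and remain fixed. Starting from $u$, replace the $z$-dependent entries one at a time by $x_i(z)\mapsto x_i(zq)$, in increasing order of level, entries of equal level from right to left. The resulting sequence $\operatorname{Std}(u)=(u_0,\dots,u_l)$, $u_0=u(z)$, $u_l=u(zq)$, is the standard path; it consists of elements of $\hat{\mathcal{F}}$ with consecutive ones adjacent. **$\partial$, $S$, $\varphi$.** $\partial\colon\mathbb{Q}\mathcal{F}\to\mathbb{Q}\mathcal{F}\otimes\Omega$ is $\mathbb{Q}$-linear with $\partial(u)=\sum_{i=1}^lD(u_{i-1},u_i)$ for $u\in\mathcal{F}$, $\operatorname{Std}(u)=(u_0,\dots,u_l)$; it lowers weight by one. $\mathcal{C}$ is the set of $z$-independent elements of $\mathcal{F}$. $\hat{\mathcal{C}}_z=\{\mathbb{L}_{k_1,\dots,k_d}(q^{n_1},\dots,q^{n_{d-1}},zq^{n_d}):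 d\ge1,n_i\in\mathbb{Z}\}\cup\{\mathbb{L}(\emptyset)\}$ and $\mathcal{C}^n_z=\{\mathbb{L}_{k_1,\dots,k_d}(q^{n_1},\dots,q^{n_{d-1}},zq^{n+n_d}): d\ge1,\,0\le n_i\le k_i\}\cup\{\mathbb{L}(\emptyset)\}$. $S\colon\mathbb{Q}\hat{\mathcal{C}}_z\otimes\Omega\to\mathbb{Q}\hat{\mathcal{C}}_z$ is $\mathbb{Q}$-linear with, for $d\ge1$, $S(\mathbb{L}_{k_1,\dots,k_d}(q^{n_1},\dots,zq^{n_d})\otimes e_0)=\mathbb{L}_{k_1,\dots,k_{d-1},k_d+1}(q^{n_1},\dots,zq^{n_d})$, $S(\mathbb{L}_{k_1,\dots,k_d}(q^{n_1},\dots,zq^{n_d})\otimes e_{q^{-r}})=-\mathbb{L}_{k_1,\dots,k_d,1}(q^{n_1},\dots,q^{n_{d-1}},q^{n_d-r},zq^r)$, $S(\mathbb{L}(\emptyset)\otimes e_{q^{-r}})=-\mathbb{L}_1(zq^r)$, $S(\mathbb{L}(\emptyset)\otimes e_0)=0$. The $\mathbb{Q}$-linear map $\varphi\colon\mathbb{Q}\mathcal{F}\to\mathbb{Q}\mathcal{C}\otimes\mathbb{Q}\hat{\mathcal{C}}_z$ is defined recursively on weight by $\varphi=(\mathrm{id}_{\mathbb{Q}\mathcal{C}}\otimes S)\circ(\varphi\otimes\mathrm{id}_\Omega)\circ\partial+\mathrm{Const}$, where for $u\in\mathcal{F}$, $\mathrm{Const}(u)=u\otimes\mathbb{L}(\emptyset)$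 if $u\in\mathcal{C}$ and $0$ otherwise. One has $\varphi(\mathbb{Q}\mathcal{F}^n)\subset\mathbb{Q}\mathcal{C}\otimes\mathbb{Q}\mathcal{C}^n_z$. **$\pi$, $\pi_z$, $\varphi^\pi$.** For integers $0\le n_i\le k_i$ put $$F(k_1,\dots,k_d;n_1,\dots,n_d)=\sum_{s_1=0}^{k_1-n_1}\cdots\sum_{s_d=0}^{k_d-n_d}\left(\prod_{i=1}^d\binom{k_i-n_i}{s_i}\right)b_{k_1-s_1}\cdots b_{k_d-s_d}.$$ The $\mathbb{Q}$-linear maps $\pi\colon\mathbb{Q}\mathcal{C}\to\mathbb{Q}\langle\mathcal{B}\rangle^0$ and $\pi_z\colon\mathbb{Q}\mathcal{C}^0_z\to\mathbb{Q}\langle\mathcal{B}\rangle$ are $\pi(\mathbb{L}_{k_1,\dots,k_d}(q^{n_1},\dots,q^{n_d}))=\pi_z(\mathbb{L}_{k_1,\dots,k_d}(q^{n_1},\dots,q^{n_{d-1}},zq^{n_d}))=F(k_1,\dots,k_d;n_1,\dots,n_d)$ and $\pi(\mathbb{L}(\emptyset))=\pi_z(\mathbb{L}(\emptyset))=1$. Put $\varphi^\pi=(\pi\otimes\pi_z)\circ\varphi\colon\mathbb{Q}\mathcal{F}^0\to\mathbb{Q}\langle\mathcal{B}\rangle^0\otimes\mathbb{Q}\langle\mathcal{B}\rangle$. **Confluence relations.** $\mathcal{G}=\{\mathbb{L}_{k_1,\dots,k_d}(x_1,\dots,x_d)\in\mathcal{F}^0: d=0\text{ or }x_d\ne z\}$;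 for $u\in\mathbb{Q}\mathcal{G}$, $u|_{z=1}\in\mathbb{Q}\mathcal{C}$ is obtained by setting $z=1$ in all arguments. $\mathcal{S}(\mathbb{Q}\langle\mathcal{B}\rangle^0)$ is the symmetric algebra over $\mathbb{Q}$, with product $\odot$ and unit $1_{\mathcal{S}}$; $1_{\mathbb{Q}\langle\mathcal{B}\rangle^0}$ is the empty word viewed in degree one; $m_\odot(u\otimes v)=u\odot v$. $I^{\mathrm{alg}}_{\mathrm{CF}}$ is the ideal of $\mathcal{S}(\mathbb{Q}\langle\mathcal{B}\rangle^0)$ generated by $1_{\mathbb{Q}\langle\mathcal{B}\rangle^0}-1_{\mathcal{S}}$ and all $m_\odot\circ(\mathrm{id}\otimes\operatorname{reg}_* )\circ\varphi^\pi(u)-\pi(u|_{z=1})$, $u\in\mathbb{Q}\mathcal{G}$; and $I_{\mathrm{CF}}=I^{\mathrm{alg}}_{\mathrm{CF}}\cap\mathbb{Q}\langle\mathcal{B}\rangle^0$. *)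

(* Defs.v *)
From HB Require Import structures.
From mathcomp Require Import all_boot all_order all_algebra.
From mathcomp Require Import finmap.
From mathcomp Require Import boolp classical_sets.
From mathcomp.multinomials Require Import monalg.

Set Implicit Arguments.
Unset Strict Implicit.
Unset Printing Implicit Defensive.

Import Order.TTheory GRing.Theory Num.Theory.

Local Open Scope classical_set_scope.
Local Open Scope ring_scope.

(* The free [rat]-module on [K] is [{malg rat[K]}], and the tensor product of
   the free modules on [A] and [B] is the free module on [A * B], the basis
   vector [<< (a, b) >>] being [<< a >> (x) << b >>]. *)

Section LinearExtension.
Context {K : choiceType} {V : lmodType rat} (f : K -> V).

Definition linext (x : {malg rat[K]}) : V :=
  \sum_(k <- msupp x) x@_k *: f k.

Lemma linextEw (d : {fset K}) x : (msupp x `<=` d)%fset ->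
  linext x = \sum_(k <- d) x@_k *: f k.
Proof.
move=> le; rewrite /linext (big_fset_incl _ le) //.
by move=> k _ /mcoeff_outdom ->; rewrite scale0r.
Qed.

Lemma linext_is_linear : linear linext.
Proof.
move=> a x y; pose d := (msupp x `|` msupp y)%fset.
have lx : (msupp x `<=` d)%fset by apply: fsubsetUl.
have ly : (msupp y `<=` d)%fset by apply: fsubsetUr.
have lxy : (msupp (a *: x + y) `<=` d)%fset.
  apply: (fsubset_trans (msuppD_le _ _)).
  by apply: fsetUSS => //; apply: msuppZ_le.
rewrite (linextEw lx) (linextEw ly) (linextEw lxy) scaler_sumr -big_split /=.
by apply: eq_bigr => k _; rewrite mcoeffD mcoeffZ scalerDl scalerA.
Qed.

HB.instance Definition _ :=
  GRing.isLinear.Build rat {malg rat[K]} V *:%R linext linext_is_linear.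

Lemma linextU k : linext << k >> = f k.
Proof.
rewrite (linextEw (d := [fset k]%fset)) ?msuppU_le // big_seq_fset1.
by rewrite mcoeffUU scale1r.
Qed.

End LinearExtension.

Lemma linext_unique (K : choiceType) (V : lmodType rat)
    (g : {linear {malg rat[K]} -> V}) x :
  g x = linext (fun k => g << k >>) x.
Proof.
rewrite {1}[x]monalgE linear_sum /=; apply: eq_bigr => k _.
rewrite -linearZ; congr (g _); apply/malgP => k'.
by rewrite mcoeffZ !mcoeffU mulrnAr mulr1.
Qed.

Lemma eq_in_linext (K : choiceType) (V : lmodType rat) (f g : K -> V) x :
  (forall k, k \in msupp x -> f k = g k) -> linext f x = linext g x.
Proof. by move=> fg; apply: eq_big_seq => k /fg ->. Qed.

Notation tensor A B := {malg rat[(A * B)%type]}.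

Definition tens {A B : choiceType} (x : {malg rat[A]}) (y : {malg rat[B]}) :
    tensor A B :=
  linext (fun a => linext (fun b => << (a, b) >>) y) x.

Definition tmap {A B A' B' : choiceType}
    (f : {malg rat[A]} -> {malg rat[A']}) (g : {malg rat[B]} -> {malg rat[B']}) :
    tensor A B -> tensor A' B' :=
  linext (fun p => tens (f << p.1 >>) (g << p.2 >>)).

Definition tensA {A B C : choiceType} :
    tensor (A * B)%type C -> tensor A (B * C)%type :=
  linext (fun p => << (p.1.1, (p.1.2, p.2)) >>).

Definition QB := {malg rat[{fmonom nat}]}.

Definition b_ (i : nat) : QB := << fmu i >>.

Fixpoint stuffle_word (u v : seq nat) {struct u} : QB :=
  let fix stuffle_u (v : seq nat) : QB :=
    match u, v with
    | [::], _ => << FMonom v >>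
    | _ :: _, [::] => << FMonom u >>
    | i :: u', j :: v' =>
        b_ i * stuffle_word u' v + b_ j * stuffle_u v'
        + b_ (i + j) * stuffle_word u' v'
    end in
  stuffle_u v.

Lemma stuffle_word0l v : stuffle_word [::] v = << FMonom v >>.
Proof. by case: v. Qed.

Lemma stuffle_word0r u : stuffle_word u [::] = << FMonom u >>.
Proof. by case: u. Qed.

Lemma stuffle_word_cons i u j v :
  stuffle_word (i :: u) (j :: v) =
    b_ i * stuffle_word u (j :: v) + b_ j * stuffle_word (i :: u) v
    + b_ (i + j) * stuffle_word u v.
Proof. by []. Qed.

Definition stuffle (x y : QB) : QB :=
  linext (fun u : {fmonom nat} =>
    linext (fun v : {fmonom nat} => stuffle_word u v) y) x.

Definition stuffle_exp (x : QB) (k : nat) : QB := iter k (stuffle x) 1.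

Definition admissible (w : {fmonom nat}) : bool := last 1%N w != 0%N.

Definition word0 := {w : {fmonom nat} | admissible w}.

(* The subspace spanned by the empty word and the words not ending with [b_ 0],
   presented as the free module on these words. *)
Definition QB0 := {malg rat[word0]}.

Definition incl : QB0 -> QB := linext (fun w : word0 => << val w >>).

(* The left inverse of [incl] that kills the non-admissible words. *)
Definition proj0 : QB -> QB0 :=
  linext (fun w => if insub w is Some w0 then << w0 >> else 0).

Lemma admissible1 : admissible mone.
Proof. by rewrite /admissible fm1. Qed.

Definition one_QB0 : QB0 := << exist _ mone admissible1 >>.

Definition is_reg (x : QB) (x0 : QB0) : Prop :=
  exists c : seq QB0,
    x = \sum_(j < size c) stuffle (incl c`_j) (stuffle_exp (b_ 0) j)
    /\ x0 = c`_0.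

Definition reg (x : QB) : QB0 := xget 0 [set x0 | is_reg x x0].

(* [(h, m)] stands for [z^h q^m]; the product of monomials is [+]. *)
Definition mono := (int * int)%type.

(* The list of the pairs [(k_i, x_i)]. The defining conditions of the various
   sets of symbols are the predicates below, and the linear maps are defined on
   all symbols, their values outside of their domain being irrelevant. *)
Definition symbol := seq (nat * mono).

Definition sym0 : nat * mono := (0%N, 0).

Definition weight (u : symbol) : nat := (\sum_(p <- u) p.1)%N.

Definition in_Fhat (u : symbol) : bool :=
  all (fun p => (0 < p.1)%N && (p.2.1 \in [:: 0; 1; -1])) u &&
  [forall i : 'I_(size u),
     let x := \sum_(p <- drop i u) p.2 in
     (x.1 == 1) || (x.1 == 0) && (0 < x.2)].

Definition in_Fn (n : int) (u : symbol) : bool :=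
  in_Fhat u &&
  all (fun p => [exists s : 'I_p.1.+1,
         p.2 \in [:: (0, s%:Z); (1, n + s%:Z); (-1, - n + s%:Z)]]) u.

Definition in_F (u : symbol) : bool := `[< exists n : int, in_Fn n u >].

Definition z_indep (u : symbol) : bool := all (fun p => p.2.1 == 0) u.

Definition in_C (u : symbol) : bool := in_F u && z_indep u.

(* [None] is the index of [e_0] and [Some m] the index of [e_(q^m)]. *)
Definition Omega := {malg rat[option int]}.
Definition e_0 : Omega := << None >>.
Definition e_q (m : int) : Omega := << Some m >>.

(* Multiplication of the argument in position [j] by [q^a]; positions are
   numbered from 0. *)
Definition qshift (j : nat) (a : int) (u : symbol) : symbol :=
  let p := nth sym0 u j in set_nth sym0 u j (p.1, p.2 + (0, a)).

Definition merge_left (u : symbol) (j : nat) : {malg rat[symbol]} :=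
  let x := (nth sym0 u j).2 in
  if j is i.+1 then
    let p := nth sym0 u i in
    << take i u ++ (p.1, p.2 + x) :: drop j.+1 u >>
  else << behead u >>.

Definition merge_right (u : symbol) (j : nat) : {malg rat[symbol]} :=
  let x := (nth sym0 u j).2 in
  if (j.+1 < size u)%N then
    let p := nth sym0 u j.+1 in
    << take j u ++ (p.1, x + p.2) :: drop j.+2 u >>
  else 0.

(* [D(u, v)] when [v] is obtained from [u] by [x_j |-> q x_j]. *)
Definition Dq (u : symbol) (j : nat) : tensor symbol (option int) :=
  let: (k, (h, m)) := nth sym0 u j in
  let A := merge_left u j in
  let B := merge_right u j in
  if h == 0 then 0
  else if (1 < k)%N then tens << set_nth sym0 u j (k.-1, (h, m)) >> e_0
  else if h == 1 then - tens A (e_q (- m)) + tens B (e_q (- m) - e_0)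
  else tens A (e_q m - e_0) - tens B (e_q m).

Definition D (u v : symbol) : tensor symbol (option int) :=
  let j := find (fun p => p.1 != p.2) (zip u v) in
  if v == qshift j 1 u then Dq u j
  else if u == qshift j 1 v then - Dq v j
  else 0.

Definition level (x : mono) : int := if x.1 == 1 then x.2 else 1 - x.2.

Definition Std_order (u : symbol) : seq nat :=
  let lev i := level (nth sym0 u i).2 in
  sort (fun i j => (lev i < lev j) || (lev i == lev j) && (j <= i)%N)
    [seq i <- iota 0 (size u) | (nth sym0 u i).2.1 != 0].

(* [z^h q^m |-> (zq)^h q^m] is multiplication by [q^h]. *)
Definition Std (u : symbol) : seq symbol :=
  u :: scanl (fun v i => qshift i (nth sym0 v i).2.1 v) u (Std_order u).

Definition partial_sym (u : symbol) : tensor symbol (option int) :=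
  \sum_(p <- zip (Std u) (behead (Std u))) D p.1 p.2.

Definition partial : {malg rat[symbol]} -> tensor symbol (option int) :=
  linext partial_sym.

(* [Some m] is [e_(q^(-r))] for [r = - m]. *)
Definition Smap_sym (p : symbol * option int) : {malg rat[symbol]} :=
  match p with
  | ([::], None) => 0
  | ([::], Some m) => - << [:: (1%N, (1, - m))] >>
  | (x :: s, None) =>
      let l := last x s in << rcons (belast x s) (l.1.+1, l.2) >>
  | (x :: s, Some m) =>
      let l := last x s in
      - << belast x s ++ [:: (l.1, (0, l.2.2 + m)); (1%N, (1, - m))] >>
  end.

Definition Smap : tensor symbol (option int) -> {malg rat[symbol]} :=
  linext Smap_sym.

Definition Const_sym (u : symbol) : tensor symbol symbol :=
  if in_C u then tens << u >> << [::] >> else 0.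

Definition phi_step (f : symbol -> tensor symbol symbol) (u : symbol) :
    tensor symbol symbol :=
  tmap id Smap (tensA (tmap (linext f) id (partial << u >>))) + Const_sym u.

(* Recursion on the weight; see [phiE]. *)
Fixpoint phi_rec (n : nat) : symbol -> tensor symbol symbol :=
  if n is n'.+1 then phi_step (phi_rec n') else Const_sym.

Definition phi : {malg rat[symbol]} -> tensor symbol symbol :=
  linext (fun u => phi_rec (weight u) u).

Section PhiE.

Let lowers (n : nat) (x : tensor symbol (option int)) :=
  forall p, x@_p != 0 -> (weight p.1).+1 = n.

Let lowers0 n : lowers n 0.
Proof. by move=> p; rewrite mcoeff0 eqxx. Qed.

Let lowersD n x y : lowers n x -> lowers n y -> lowers n (x + y).
Proof.
move=> nx ny p; rewrite mcoeffD; have [->|/nx //] := eqVneq x@_p 0.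
by rewrite add0r => /ny.
Qed.

Let lowersN n x : lowers n x -> lowers n (- x).
Proof. by move=> nx p; rewrite mcoeffN oppr_eq0 => /nx. Qed.

Let lowers_tens n (s : symbol) (y : Omega) :
  (weight s).+1 = n -> lowers n (tens << s >> y).
Proof.
move=> sn p; rewrite /tens linextU /linext raddf_sum /=.
apply: contraNeq => pn; apply/eqP; apply: big1 => i _.
rewrite mcoeffZ mcoeffU; case: eqP => [ep|_]; last by rewrite mulr0.
by rewrite -ep /= sn eqxx in pn.
Qed.

Let weight_cat (s t : symbol) : weight (s ++ t) = (weight s + weight t)%N.
Proof. by rewrite /weight big_cat. Qed.

Let weight_cons p (s : symbol) : weight (p :: s) = (p.1 + weight s)%N.
Proof. by rewrite /weight big_cons. Qed.

Let weight_split (u : symbol) j : (j < size u)%N ->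
  weight u = (weight (take j u) + ((nth sym0 u j).1 + weight (drop j.+1 u)))%N.
Proof.
move=> ju; rewrite -{1}(cat_take_drop j u) weight_cat.
by rewrite (drop_nth sym0) // weight_cons.
Qed.

Let lowers_left n (u : symbol) j (y : Omega) : (j < size u)%N ->
  (nth sym0 u j).1 = 1%N -> weight u = n -> lowers n (tens (merge_left u j) y).
Proof.
move=> ju k1 <-; case: j ju k1 => [|i] ju k1 /=; apply: lowers_tens.
  by case: u ju k1 => //= p u _ /= p1; rewrite weight_cons p1.
rewrite (weight_split ju) k1 (take_nth sym0) ?(ltnW ju) //.
rewrite -cats1 !weight_cat !weight_cons [weight [::]]big_nil /=.
by rewrite addn0 addnA add1n addnS.
Qed.

Let lowers_right n (u : symbol) j (y : Omega) : (j < size u)%N ->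
  (nth sym0 u j).1 = 1%N -> weight u = n -> lowers n (tens (merge_right u j) y).
Proof.
move=> ju k1 <-; rewrite /merge_right; case: ifP => ju1; last first.
  by rewrite /tens linear0; apply: lowers0.
apply: lowers_tens; rewrite (weight_split ju) k1 (drop_nth sym0 ju1).
by rewrite weight_cat !weight_cons /= add1n addnS.
Qed.

Let positive (u : symbol) := all (fun p => 0 < p.1)%N u.

Let lowers_Dq u j : positive u -> lowers (weight u) (Dq u j).
Proof.
rewrite /Dq; case Ej: (nth sym0 u j) => [k [h m]] /allP pu.
case: eqP => [_|h0]; first exact: lowers0.
have ju : (j < size u)%N.
  by rewrite ltnNge; apply/negP => /(nth_default sym0); rewrite Ej => -[_ /h0].
have k0 : (0 < k)%N by have := pu _ (mem_nth sym0 ju); rewrite Ej.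
case: ltnP => k1.
  apply: lowers_tens; rewrite set_nthE ju (weight_split ju) Ej.
  by rewrite weight_cat weight_cons /= -addnS -addSn (prednK k0).
have {k0 k1} k1 : (nth sym0 u j).1 = 1%N.
  by rewrite Ej; apply/eqP; rewrite eqn_leq k1.
case: eqP => _; apply: lowersD.
- by apply: lowersN; apply: lowers_left.
- exact: lowers_right.
- exact: lowers_left.
- by apply: lowersN; apply: lowers_right.
Qed.

Let same_k (u v : symbol) := map fst u = map fst v.

Let same_k_weight u v : same_k u v -> weight u = weight v.
Proof. by move=> uv; rewrite /weight -!(big_map fst xpredT id) uv. Qed.

Let same_k_positive u v : same_k u v -> positive u -> positive v.
Proof.
by move=> uv; rewrite /positive -!(all_map fst (fun k => 0 < k)%N) uv.
Qed.

Let lowers_D u v : same_k u v -> positive u -> lowers (weight u) (D u v).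
Proof.
move=> uv pu; rewrite /D; case: eqP => _; first exact: lowers_Dq.
case: eqP => _; last exact: lowers0; apply: lowersN.
by rewrite (same_k_weight uv); apply: lowers_Dq; apply: same_k_positive pu.
Qed.

Let same_k_qshift j a u : (j < size u)%N -> same_k u (qshift j a u).
Proof.
move=> ju; rewrite /same_k /qshift set_nthE ju map_cat /=.
by rewrite -{1}(cat_take_drop j u) map_cat (drop_nth sym0 ju).
Qed.

Let lowers_path u s v : positive u -> same_k u v ->
    all (fun j => j < size u)%N s ->
  let p := scanl (fun v i => qshift i (nth sym0 v i).2.1 v) v s in
  lowers (weight u) (\sum_(e <- zip (v :: p) p) D e.1 e.2).
Proof.
move=> pu; elim: s v => [|j s IHs] v uv /=.
  by rewrite big_nil => _; apply: lowers0.
case/andP=> ju js; rewrite big_cons /=.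
have sz : size v = size u by have := congr1 size uv; rewrite !size_map.
have vw : same_k v (qshift j (nth sym0 v j).2.1 v).
  by apply: same_k_qshift; rewrite sz.
apply: lowersD; last by apply: IHs => //; apply: etrans vw.
by rewrite (same_k_weight uv); apply: lowers_D => //; apply: same_k_positive pu.
Qed.

Let lowers_partial u : positive u -> lowers (weight u) (partial_sym u).
Proof.
move=> pu; apply: lowers_path => //.
rewrite /Std_order all_sort; apply/allP => j.
by rewrite mem_filter mem_iota add0n => /and3P[].
Qed.

Lemma phiE (u : symbol) : in_F u ->
  phi << u >> =
    tmap id Smap (tensA (tmap phi id (partial << u >>))) + Const_sym u.
Proof.
case/asboolP => n /andP[/andP[/allP pu _] _].
have {}pu : positive u by apply/allP => p /pu /andP[].
rewrite {1}/phi linextU /partial linextU; case Eu: (weight u) => [|k] /=.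
  have -> : u = [::].
    case: u pu Eu => // p u /= /andP[p0 _]; rewrite weight_cons => /eqP.
    by rewrite addn_eq0 eqn0Ngt p0.
  rewrite (_ : partial_sym [::] = 0) /tmap /tensA ?linear0 ?add0r //.
  by rewrite /partial_sym /= big_nil.
have phiU v : weight v = k -> linext (phi_rec k) << v >> = phi << v >>.
  by move=> <-; rewrite /phi linextU [RHS]linextU.
have phiEu : tmap (linext (phi_rec k)) id (partial_sym u)
    = tmap phi id (partial_sym u).
  apply: eq_in_linext => p; rewrite -mcoeff_neq0 => /(lowers_partial pu).
  by rewrite Eu => -[/phiU ->].
rewrite -phiEu /phi_step /partial.
have -> // : linext partial_sym << u >> = partial_sym u by exact: linextU.
Qed.

End PhiE.

(* The expansion of this product in the free algebra is the multiple sum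
   [F(k_1, ..., k_d; n_1, ..., n_d)]. *)
Definition Fsum (kn : seq (nat * nat)) : QB :=
  \prod_(p <- kn)
    \sum_(s < (p.1 - p.2).+1) 'C(p.1 - p.2, s)%:R *: b_ (p.1 - s).

(* The exponents [n_i] of [q] are nonnegative on the domains of [pi] and [pi_z]. *)
Definition exponents (u : symbol) : seq (nat * nat) :=
  [seq (p.1, `|p.2.2|%N) | p <- u].

Definition pi : {malg rat[symbol]} -> QB0 :=
  linext (fun u => proj0 (Fsum (exponents u))).

Definition pi_z : {malg rat[symbol]} -> QB :=
  linext (fun u => Fsum (exponents u)).

Definition phi_pi (x : {malg rat[symbol]}) : tensor word0 {fmonom nat} :=
  tmap pi pi_z (phi x).

Definition in_G (u : symbol) : bool :=
  in_Fn 0 u && ((u == [::]) || ((last sym0 u).2 != (1, 0))).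

Definition QG : set {malg rat[symbol]} :=
  [set x | forall u, u \in msupp x -> in_G u].

Definition at_z1 : {malg rat[symbol]} -> {malg rat[symbol]} :=
  linext (fun u : symbol => << [seq (p.1, (0, p.2.2)) | p <- u] : symbol >>).

(* The symmetric algebra of the free module [QB0]: polynomials in the basis
   vectors of [QB0]. *)
Definition SymQB0 := {malg rat[{cmonom word0}]}.

Definition iota1 : QB0 -> SymQB0 := linext (fun w => << ucm w >>).

Definition m_odot : tensor word0 word0 -> SymQB0 :=
  linext (fun p => iota1 << p.1 >> * iota1 << p.2 >>).

Definition ideal_gen (R : comNzRingType) (G : set R) : set R :=
  [set x | exists s : seq (R * R),
     (forall p, p \in s -> G p.2) /\ x = \sum_(p <- s) p.1 * p.2].

Definition CF_gens : set SymQB0 :=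
  [set iota1 one_QB0 - 1] `|`
  [set m_odot (tmap id reg (phi_pi u)) - iota1 (pi (at_z1 u)) | u in QG].

Definition I_CF_alg : set SymQB0 := ideal_gen CF_gens.

Definition I_CF : set QB0 := [set x | I_CF_alg (iota1 x)].

Record fps := FPS { fcoef : nat -> rat }.

HB.instance Definition _ := gen_eqMixin fps.
HB.instance Definition _ := gen_choiceMixin fps.

Lemma fpsP (f g : fps) : (forall n, fcoef f n = fcoef g n) <-> f = g.
Proof.
split=> [|-> //]; case: f g => [f] [g] /= fg.
by congr FPS; apply/funext.
Qed.

Section FpsRing.
Implicit Types f g h : fps.

Definition fps_add f g := FPS (fun n => fcoef f n + fcoef g n).
Definition fps_opp f := FPS (fun n => - fcoef f n).

Fact fps_addA : associative fps_add.
Proof. by move=> f g h; apply/fpsP => n; rewrite /= addrA. Qed.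
Fact fps_addC : commutative fps_add.
Proof. by move=> f g; apply/fpsP => n; rewrite /= addrC. Qed.
Fact fps_add0 : left_id (FPS (fun=> 0)) fps_add.
Proof. by move=> f; apply/fpsP => n; rewrite /= add0r. Qed.
Fact fps_addN : left_inverse (FPS (fun=> 0)) fps_opp fps_add.
Proof. by move=> f; apply/fpsP => n; rewrite /= addNr. Qed.

HB.instance Definition _ :=
  GRing.isZmodule.Build fps fps_addA fps_addC fps_add0 fps_addN.

Definition fps_mul f g :=
  FPS (fun n => \sum_(i < n.+1) fcoef f i * fcoef g (n - i)).
Definition fps_one := FPS (fun n => (n == 0)%:R).

Definition fps_trunc (N : nat) f : {poly rat} := \poly_(i < N) fcoef f i.

Lemma fcoef_mul f g N n : (n < N)%N ->
  fcoef (fps_mul f g) n = (fps_trunc N f * fps_trunc N g)`_n.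
Proof.
move=> nN; rewrite coefM /=; apply: eq_bigr => i _.
have iN : (i < N)%N by apply: leq_trans nN; apply: ltn_ord.
have niN : (n - i < N)%N by apply: leq_ltn_trans nN; apply: leq_subr.
by rewrite !coef_poly iN niN.
Qed.

Fact fps_mulC : commutative fps_mul.
Proof.
by move=> f g; apply/fpsP => n; rewrite !(fcoef_mul _ _ (ltnSn n)) mulrC.
Qed.

Fact fps_mulA : associative fps_mul.
Proof.
have key f g h n :
    fcoef (fps_mul f (fps_mul g h)) n =
    (fps_trunc n.+1 f * (fps_trunc n.+1 g * fps_trunc n.+1 h))`_n.
  rewrite (fcoef_mul _ _ (ltnSn n)) !coefM; apply: eq_bigr => i _.
  rewrite [X in _ * X]coef_poly ltnS leq_subr -(@fcoef_mul _ _ n.+1) //.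
  by rewrite ltnS leq_subr.
move=> f g h; apply/fpsP => n; rewrite key.
rewrite [fps_mul (fps_mul f g) h]fps_mulC key.
by rewrite (mulrC (fps_trunc n.+1 h)) mulrA.
Qed.

Fact fps_mul1 : left_id fps_one fps_mul.
Proof.
move=> f; apply/fpsP => n /=; rewrite big_ord_recl /= mul1r subn0 big1 ?addr0 //.
by move=> i _; rewrite mul0r.
Qed.

Fact fps_mulDl : left_distributive fps_mul fps_add.
Proof.
move=> f g h; apply/fpsP => n /=; rewrite -big_split /=.
by apply: eq_bigr => i _; rewrite mulrDl.
Qed.

Fact fps_one_neq0 : fps_one != 0.
Proof.
apply/eqP => /fpsP /(_ 0%N) /= /eqP.
by rewrite oner_eq0.
Qed.

HB.instance Definition _ :=
  GRing.Zmodule_isComNzRing.Build fps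
    fps_mulA fps_mulC fps_mul1 fps_mulDl fps_one_neq0.

Definition fps_scale (c : rat) f := FPS (fun n => c * fcoef f n).

Fact fps_scaleA a c f : fps_scale a (fps_scale c f) = fps_scale (a * c) f.
Proof. by apply/fpsP => n; rewrite /= mulrA. Qed.
Fact fps_scale1 : left_id 1 fps_scale.
Proof. by move=> f; apply/fpsP => n; rewrite /= mul1r. Qed.
Fact fps_scaleDr : right_distributive fps_scale +%R.
Proof. by move=> c f g; apply/fpsP => n; rewrite /= mulrDr. Qed.
Fact fps_scaleDl f : {morph fps_scale^~ f : a c / a + c}.
Proof. by move=> a c; apply/fpsP => n; rewrite /= mulrDl. Qed.

HB.instance Definition _ :=
  GRing.Zmodule_isLmodule.Build rat fps
    fps_scaleA fps_scale1 fps_scaleDr fps_scaleDl.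

Fact fps_scaleAl (c : rat) f g : c *: (f * g) = c *: f * g.
Proof.
apply/fpsP => n /=; rewrite mulr_sumr.
by apply: eq_bigr => i _; rewrite mulrA.
Qed.

HB.instance Definition _ := GRing.Lmodule_isLalgebra.Build rat fps fps_scaleAl.
HB.instance Definition _ := GRing.Lalgebra_isComAlgebra.Build rat fps.

Definition fps_unit f : bool := `[< exists g, g * f = 1 >].
Definition fps_inv f := xget f [set g | g * f = 1].

Fact fps_mulVr : {in fps_unit, left_inverse 1 fps_inv *%R}.
Proof. by move=> f /asboolP fV; exact: (xgetPex f fV). Qed.
Fact fps_unitP f g : g * f = 1 -> fps_unit f.
Proof. by move=> gf; apply/asboolP; exists g. Qed.
Fact fps_invr_out : {in [predC fps_unit], fps_inv =1 id}.
Proof.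
move=> f /asboolP fV; rewrite /fps_inv; case: xgetP => // g _ gf.
by case: fV; exists g.
Qed.

HB.instance Definition _ :=
  GRing.ComNzRing_hasMulInverse.Build fps fps_mulVr fps_unitP fps_invr_out.

End FpsRing.

(* Coefficientwise limit of an eventually coefficientwise constant sequence. *)
Definition fps_lim (f : nat -> fps) : fps :=
  FPS (fun n => xget 0
    [set c | exists N0, forall N, (N0 <= N)%N -> fcoef (f N) n = c]).

Lemma fps_limE (f : nat -> fps) (n N0 : nat) :
  (forall N, (N0 <= N)%N -> fcoef (f N) n = fcoef (f N0) n) ->
  fcoef (fps_lim f) n = fcoef (f N0) n.
Proof.
move=> fN /=; case: xgetP => [c _ [N1 cN1]|nolim].
  by rewrite -(cN1 _ (leq_maxl N1 N0)) fN // leq_maxr.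
by case: (nolim (fcoef (f N0) n)); exists N0.
Qed.

Definition q : fps := FPS (fun n => (n == 1)%:R).

(* The sum over [0 < m_1 < ... < m_d <= N]. *)
Definition ZSZ_partial (w : seq nat) (N : nat) : fps :=
  \sum_(m : (size w).-tuple 'I_N.+1 | path ltn 0 (map val m))
    \prod_(j < size w) (q ^+ tnth m j / (1 - q ^+ tnth m j)) ^+ nth 0%N w j.

Definition ZSZ_word (w : word0) : fps := fps_lim (ZSZ_partial (val w)).

Definition ZSZ : QB0 -> fps := linext ZSZ_word.

Definition ZSZ_mon (M : {cmonom word0}) : fps :=
  \prod_(w <- finsupp M) ZSZ_word w ^+ M w.

(* The algebra homomorphism extending [ZSZ]; see [ZSZ_symK] and
   [ZSZ_sym_unique]. *)
Definition ZSZ_sym : SymQB0 -> fps := linext ZSZ_mon.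

Lemma malgUE (K : choiceType) (c : rat) (k : K) : << c *g k >> = c *: << k >>.
Proof. by apply/malgP => k'; rewrite mcoeffZ !mcoeffU mulrnAr mulr1. Qed.

Lemma ZSZ_sym_is_linear : linear ZSZ_sym.
Proof. exact: linext_is_linear. Qed.

HB.instance Definition _ :=
  GRing.isLinear.Build rat SymQB0 fps *:%R ZSZ_sym ZSZ_sym_is_linear.

Lemma ZSZ_monEw (M : {cmonom word0}) (d : {fset word0}) :
  (finsupp M `<=` d)%fset ->
  ZSZ_mon M = \prod_(w <- d) ZSZ_word w ^+ M w.
Proof.
move=> le; rewrite /ZSZ_mon (big_fset_incl _ le) //.
by move=> w _; rewrite -cmE_eq0 => /eqP ->; rewrite expr0.
Qed.

Lemma ZSZ_sym_is_monoid_morphism : monoid_morphism ZSZ_sym.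
Proof.
split=> [|x y]; first by rewrite /ZSZ_sym linextU /ZSZ_mon mdom1 big_seq_fset0.
rewrite malgME linear_sum [RHS]big_distrl /=; apply: eq_bigr => M1 _.
rewrite linear_sum [RHS]big_distrr /=; apply: eq_bigr => M2 _.
rewrite malgUE linearZ /= /ZSZ_sym linextU -scalerAl -scalerAr scalerA.
congr (_ *: _); rewrite {1}/ZSZ_mon mdomD (ZSZ_monEw (fsubsetUl _ (finsupp M2))).
rewrite (ZSZ_monEw (fsubsetUr (finsupp M1) _)) -big_split /=.
by apply: eq_bigr => w _; rewrite cmM exprD.
Qed.

HB.instance Definition _ :=
  GRing.isMonoidMorphism.Build SymQB0 fps ZSZ_sym ZSZ_sym_is_monoid_morphism.

Lemma ZSZ_symK (x : QB0) : ZSZ_sym (iota1 x) = ZSZ x.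
Proof.
rewrite /iota1 /ZSZ [X in ZSZ_sym X]/linext linear_sum; apply: eq_bigr => w _.
rewrite linearZ /= /ZSZ_sym linextU /ZSZ_mon mdomU big_seq_fset1.
by rewrite cmUU expr1.
Qed.

Lemma ZSZ_sym_unique (g : {lrmorphism SymQB0 -> fps}) :
  (forall x, g (iota1 x) = ZSZ x) -> g =1 ZSZ_sym.
Proof.
move=> gZ x; rewrite linext_unique /ZSZ_sym; congr (linext _ _).
apply/funext => M.
have -> : ZSZ_mon M = ZSZ_sym << M >> by rewrite /ZSZ_sym linextU.
have gU w : g << ucm w >> = ZSZ_sym << ucm w >>.
  by have := gZ << w >>; rewrite -ZSZ_symK /iota1 !linextU.
have malgUM (M1 M2 : {cmonom word0}) :
    << mmul M1 M2 >> = << M1 >> * << M2 >> :> SymQB0.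
  by rewrite malgM_def fgmulUU mulr1.
have [n] := ubnP (mdeg M); elim: n M => // n IHn M ltMn.
have [->|M1] := eqVneq M mone; first by rewrite (rmorph1 g) (rmorph1 ZSZ_sym).
have [w wM] : exists w, w \in finsupp M.
  apply/fset0Pn; apply: contraNneq M1 => M0; apply/cmP => w; apply/eqP.
  by rewrite cm1 cmE_eq0 M0.
have eM : M = mmul (ucm w) (divcm M (ucm w)).
  apply/eqP/cmP => v; rewrite cmM cmU divcmE cmU subnKC //.
  by case: eqP => // <-; rewrite lt0n cmE_neq0.
rewrite eM malgUM (rmorphM g) (rmorphM ZSZ_sym).
congr (_ * _); first exact: gU.
by apply: IHn; move: ltMn; rewrite {1}eM mdegM mdegU add1n.
Qed.

Lemma fcoefB (f g : fps) n : fcoef (f - g) n = fcoef f n - fcoef g n.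
Proof. by []. Qed.

Lemma fcoef_sum (I : Type) (r : seq I) (P : pred I) (F : I -> fps) n :
  fcoef (\sum_(i <- r | P i) F i) n = \sum_(i <- r | P i) fcoef (F i) n.
Proof. exact: (big_morph (fun f => fcoef f n)). Qed.

Lemma fcoef_qM (f : fps) n : fcoef (q * f) n = if n is n'.+1 then fcoef f n' else 0.
Proof.
case: n => [|n] /=; rewrite big_ord_recl mul0r add0r ?big_ord0 //.
rewrite big_ord_recl /= mul1r subSS subn0 big1 ?addr0 // => i _.
by rewrite mul0r.
Qed.

Lemma fcoef_qXM (m : nat) (f : fps) n :
  fcoef (q ^+ m * f) n = if (m <= n)%N then fcoef f (n - m) else 0.
Proof.
elim: m n => [|m IHm] n; first by rewrite mul1r subn0.
by rewrite exprS -mulrA fcoef_qM; case: n => // n; rewrite IHm.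
Qed.

Lemma q_frac_coef (m n : nat) : (0 < m)%N ->
  fcoef (q ^+ m / (1 - q ^+ m)) n = ((0 < n)%N && (m %| n)%N)%:R.
Proof.
move=> m0; pose g := FPS (fun n => (m %| n)%N%:R).
have gV : (1 - q ^+ m) * g = 1.
  apply/fpsP => k; rewrite mulrBl mul1r fcoefB fcoef_qXM /=.
  case: leqP => [mk|km]; last first.
    rewrite subr0; case: k km => [|k] km; first by rewrite dvdn0.
    by rewrite gtnNdvd.
  by rewrite dvdn_subl // subrr eqn0Ngt (leq_trans m0 mk).
have U : 1 - q ^+ m \is a GRing.unit by apply/unitrPr; exists g.
have -> : (1 - q ^+ m)^-1 = g by apply: (mulrI U); rewrite gV mulrV.
rewrite fcoef_qXM /=; case: (leqP m n) => [mn|nm].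
  by rewrite dvdn_subl // (leq_trans m0 mn).
by case: n nm => // n nm; rewrite gtnNdvd.
Qed.

Lemma q_frac_exp_small (m k : nat) (f : fps) n : (n < m)%N -> (0 < k)%N ->
  fcoef ((q ^+ m / (1 - q ^+ m)) ^+ k * f) n = 0.
Proof.
by move=> nm /prednK <-; rewrite exprS -!mulrA fcoef_qXM leqNgt nm.
Qed.

Lemma ZSZ_partial_stable (w : seq nat) (n N : nat) : last 1%N w != 0%N ->
  (n <= N)%N -> fcoef (ZSZ_partial w N) n = fcoef (ZSZ_partial w n) n.
Proof.
move=> w0 nN; rewrite /ZSZ_partial !fcoef_sum.
rewrite (bigID (fun m : (size w).-tuple 'I_N.+1 =>
  all (fun i : 'I__ => (i <= n)%N) m)) /=.
rewrite [X in _ + X]big1 ?addr0; last first.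
  move=> m /andP[m_lt /allPn /= [x xm]]; rewrite -ltnNge => nx.
  have d0 : (0 < size w)%N by rewrite -(size_tuple m); case: (tval m) xm.
  have dlt : ((size w).-1 < size w)%N by rewrite prednK.
  have k0 : (0 < nth 0 w (size w).-1)%N.
    by rewrite nth_last lt0n; clear -w0 d0; case: w w0 d0.
  pose j := Ordinal dlt; rewrite (bigD1 j) //.
  apply: q_frac_exp_small; last exact: k0.
  apply: leq_trans nx _.
  have -> : (tnth m j : nat) = last 0 (map val m).
    rewrite -nth_last size_map size_tuple (nth_map ord0) ?size_tuple //.
    by rewrite (tnth_nth ord0).
  have : val x \in map val m by apply: map_f.
  move: (map val m) (0%N) m_lt => s z; rewrite (path_sortedE ltn_trans).
  case/andP=> _; case/lastP: s => // s y; rewrite last_rcons mem_rcons inE.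
  rewrite (sorted_pairwise ltn_trans) pairwise_rcons.
  move=> /andP[/allP sy _] /orP[/eqP-> //|/sy].
  exact: ltnW.
have le : (n.+1 <= N.+1)%N by [].
rewrite (reindex_onto (map_tuple (widen_ord le))
  (map_tuple (fun i : 'I__ => inord i))) /=; last first.
  move=> m /andP[_ /allP mn]; apply: eq_from_tnth => j; rewrite !tnth_map.
  by apply: val_inj; rewrite /= inordK // ltnS mn // mem_tnth.
apply: eq_big => m.
  rewrite -map_comp (eq_map (g := val)) // all_map.
  rewrite (_ : all _ _) ?andbT; last by apply/allP => i _ /=; rewrite -ltnS.
  rewrite (_ : map_tuple _ _ = m) ?eqxx ?andbT //.
  apply: eq_from_tnth => j; rewrite !tnth_map; apply: val_inj.
  by rewrite /= inordK.
move=> _; congr (fcoef _ n); apply: eq_bigr => j _.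
by rewrite tnth_map.
Qed.

Lemma ZSZ_wordE (w : word0) (n : nat) :
  fcoef (ZSZ_word w) n = fcoef (ZSZ_partial (val w) n) n.
Proof. by apply: fps_limE => N; apply: ZSZ_partial_stable; apply: (valP w). Qed.

(* Main.v *)
Require Import Defs.
From HB Require Import structures.
From mathcomp Require Import all_boot all_order all_algebra.
From mathcomp Require Import finmap ring zify.
From mathcomp Require Import boolp classical_sets.
From mathcomp.multinomials Require Import monalg.

Set Implicit Arguments.
Unset Strict Implicit.
Unset Printing Implicit Defensive.

Import Order.TTheory GRing.Theory Num.Theory.

Local Open Scope classical_set_scope.
Local Open Scope ring_scope.

(** Attach to the symbol with entries [(k_i, x_i)] the series [sum_(0 < m_1 <
    ... < m_d) prod_i x_i^(m_i) / (1 - q^(m_i))^(k_i)]. For a symbol of [F^n]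
    with [n >= 0], it is a power series in [z] and [q], because all tail
    products [x_i ... x_d] are of the form [z q^m] with [m >= 0], or [q^m] with
    [m > 0]. Expanding [q^(m n) / (1 - q^m)^k] in powers of [t_m = q^m / (1 -
    q^m)] turns a [z]-independent symbol into the image under [ZSZ] of its
    projection by [pi] (lemma [ev_sym_cst]).

    Shifting one argument, [x_j |-> q x_j], multiplies the general term by
    [q^(m_j)]. Hence the difference of the two series is the series with [k_j]
    lowered by one, where for [k_j = 1] the sum over [m_j] is geometric. Reading
    [e_0] as [1] and [e_b] as [z / (z - b)], this says that [D] computes
    differences ([Dq_ev]), so that [partial u] has the value [u(z) - u(q z)].
    For this the standard path of a symbol of [F^n] must be a path of convergent
    series; it stays in [F^n] up to level [n], and in [F^(n+1)] afterwards
    ([path_step]), and [partial] takes its values there ([partial_spec]).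

    Conversely [S] inverts the operator [f(z) |-> f(z) - f(q z)] on [f e_b]
    ([Smap_ev]). By induction on the weight, [u] and [phi u] have the same
    values: their difference is invariant under [z |-> q z] and vanishes at [z =
    0] ([phi_rec_spec]). The exception [S (1 (x) e_0) = 0] does no harm, as the
    total coefficient of [1 (x) e_0] is the constant term of [u(z) - u(q z)],
    which is [0]. To remain in the ring of power series in [q], the identity is
    proved for [z = q^t], for all [t > 0]; a power series in [z] is determined
    by these values ([jlow_of_values]).

    It remains to let [z] tend to [1]. Compare, on both sides, the sums of the
    coefficients of [z^i] for [i <= N], modulo a fixed power of [q]. For a
    symbol [u] of [G] this is the value of [u] at [z = 1] as soon as [N] is
    large. For a symbol [w] of [C_z^0] it is the truncation at [m_d <= N] of the
    multiple sum of the word [pi_z w] ([trunc_Cz], [phi_trunc]). Truncated sums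
    are multiplicative for the stuffle product ([Zlin_stuffle]) and send [b_0]
    to [N], so modulo a power of [q] they are, for large [N], polynomials in [N]
    whose constant term is the value of the regularized word ([regular_word]). A
    polynomial which is eventually constant is equal to its constant term
    ([regular_limit]), and this is the confluence relation ([confluence]). *)

(** * Divisibility by powers of q *)

(** [low n f] says that [q ^+ n] divides [f]. *)
Definition low (n : nat) (f : fps) : bool := [forall i : 'I_n, fcoef f i == 0].

Lemma low_coefP n f : reflect (forall i, (i < n)%N -> fcoef f i = 0) (low n f).
Proof.
apply: (iffP forallP) => [f0 i lt_in | f0 i]; last by rewrite f0.
exact/eqP/(f0 (Ordinal lt_in)).
Qed.

Lemma lowP n f : reflect (exists g, f = q ^+ n * g) (low n f).
Proof.
apply: (iffP (low_coefP n f)) => [fn | [g ->] i lt_in]; last first.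
  by rewrite fcoef_qXM leqNgt lt_in.
exists (FPS (fun i => fcoef f (i + n))); apply/fpsP => i.
by rewrite fcoef_qXM; case: leqP => [le_ni | /fn //]; rewrite /= subnK.
Qed.

Lemma low0 n : low n 0. Proof. exact/low_coefP. Qed.

Lemma lowD n f g : low n f -> low n g -> low n (f + g).
Proof.
by move=> /lowP[f' ->] /lowP[g' ->]; apply/lowP; exists (f' + g');
  rewrite mulrDr.
Qed.

Lemma lowN n f : low n f -> low n (- f).
Proof. by move=> /lowP[f' ->]; apply/lowP; exists (- f'); rewrite mulrN. Qed.

Lemma lowB n f g : low n f -> low n g -> low n (f - g).
Proof. by move=> fn gn; apply: lowD => //; apply: lowN. Qed.

Lemma low_le m n f : (m <= n)%N -> low n f -> low m f.
Proof.
move=> le_mn /low_coefP fn; apply/low_coefP => i lt_im.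
by apply: fn; apply: leq_trans le_mn.
Qed.

Lemma lowM m n f g : low m f -> low n g -> low (m + n) (f * g).
Proof.
move=> /lowP[f' ->] /lowP[g' ->]; apply/lowP; exists (f' * g').
by rewrite mulrACA exprD.
Qed.

Lemma lowMl n f g : low n f -> low n (f * g).
Proof.
by move=> fn; rewrite -(addn0 n); apply: lowM => //; apply/low_coefP.
Qed.

Lemma lowMr n f g : low n f -> low n (g * f).
Proof. by rewrite mulrC; apply: lowMl. Qed.

Lemma lowZ n c f : low n f -> low n (c *: f).
Proof. by move=> fn; rewrite -mulr_algl; apply: lowMr. Qed.

Lemma low_sum n (I : Type) (r : seq I) (P : pred I) (F : I -> fps) :
  (forall i, P i -> low n (F i)) -> low n (\sum_(i <- r | P i) F i).
Proof.
by move=> Fn; apply: (big_ind (low n)) => //; [apply: low0 | apply: lowD].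
Qed.

Lemma low_q n : low n (q ^+ n).
Proof. by apply/lowP; exists 1; rewrite mulr1. Qed.

Lemma low_qXK m n f : low (n + m) (q ^+ n * f) -> low m f.
Proof.
move/low_coefP=> fn; apply/low_coefP => i lt_im.
have := fn (i + n)%N; rewrite fcoef_qXM leq_addl addnK.
by apply; rewrite addnC ltn_add2l.
Qed.

Lemma low_eq0 f : (forall n, low n f) -> f = 0.
Proof. by move=> f0; apply/fpsP => i; exact: (low_coefP _ _ (f0 i.+1)). Qed.

Lemma low_trans n f g h : low n (f - g) -> low n (g - h) -> low n (f - h).
Proof. by move=> fg gh; rewrite -(subrKA g); apply: lowD. Qed.

Lemma lowC n f g : low n (f - g) -> low n (g - f).
Proof. by rewrite -(opprB g f) => /lowN; rewrite opprK. Qed.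

Lemma low_eq_coef n f g i : low n (f - g) -> (i < n)%N -> fcoef f i = fcoef g i.
Proof. by move/low_coefP=> fg /fg /eqP; rewrite /= subr_eq0 => /eqP. Qed.

Lemma oneBq_unit n : (0 < n)%N -> 1 - q ^+ n \is a GRing.unit.
Proof.
move=> n0; apply/unitrPr; exists (FPS (fun i => (n %| i)%N%:R)).
apply/fpsP => i; rewrite mulrBl mul1r fcoefB fcoef_qXM /=.
case: leqP => [le_ni | lt_in].
  by rewrite dvdn_subl // subrr eqn0Ngt (leq_trans n0 le_ni).
by rewrite subr0; case: i lt_in => [|i] lt_in; rewrite ?dvdn0 ?gtnNdvd.
Qed.

(** * Truncated nested sums *)

(** For [s = [:: (k_1, y_1); ...; (k_d, y_d)]], [G c r s a] is the sum over [a <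
    m_1 < ... < m_d <= a + r] of the products of the [y_i ^+ (m_i - m_(i-1)) * c
    m_i ^+ k_i], where [m_0 = a]. When [y_i = x_i ... x_d], [a = 0] and [c m = 1
    / (1 - q ^+ m)], this is the partial sum of the series of the symbol with
    entries [(k_i, x_i)]. The recursion isolates the terms with [m_1 = a.+1]. *)
Fixpoint G (R : comNzRingType) (c : nat -> R) (r : nat) (s : seq (nat * R))
    (a : nat) {struct r} : R :=
  match s with
  | [::] => 1
  | p :: s' =>
      if r is r'.+1 then
        p.2 * (G c r' s a.+1 + c a.+1 ^+ p.1 * G c r' s' a.+1)
      else 0
  end.

Lemma G_nil (R : comNzRingType) (c : nat -> R) r a : G c r [::] a = 1.
Proof. by case: r. Qed.

Lemma G_cons (R : comNzRingType) (c : nat -> R) r p s a :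
  G c r.+1 (p :: s) a
  = p.2 * (G c r (p :: s) a.+1 + c a.+1 ^+ p.1 * G c r s a.+1).
Proof. by []. Qed.

Lemma G_morph (R S : comNzRingType) (f : {rmorphism R -> S}) (c : nat -> R)
    (c' : nat -> S) r s a :
  (forall m, f (c m) = c' m) ->
  f (G c r s a) = G c' r [seq (p.1, f p.2) | p <- s] a.
Proof.
move=> fc; elim: r s a => [|r IHr] [|p s] a; rewrite ?rmorph1 ?rmorph0 //.
by rewrite G_cons rmorphM rmorphD rmorphM rmorphXn fc !IHr.
Qed.

(** The factor [1 / (1 - q ^+ m)] of the general term. *)
Definition qfrac (m : nat) : fps := (1 - q ^+ m)^-1.

Lemma qfracK m : qfrac m.+1 * (1 - q ^+ m.+1) = 1.
Proof. by rewrite mulVr // oneBq_unit. Qed.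

(** The effect on the [y_i] of a multiplication of the last argument by [q]. *)
Definition qmul (s : seq (nat * fps)) : seq (nat * fps) :=
  [seq (p.1, q * p.2) | p <- s].

(** Multiplying the [j]-th argument by [q] multiplies [y_1, ..., y_j] by [q],
    hence the general term by [q ^+ m_j]; the difference lowers [k_j]. *)
Lemma G_diff r s k y s' a :
  G qfrac r (s ++ (k.+1, y) :: s') a
    - q ^+ a * G qfrac r (qmul s ++ (k.+1, q * y) :: s') a
  = G qfrac r (s ++ (k, y) :: s') a.
Proof.
elim: r s a => [|r IHr] [|p s] a; rewrite /= ?mulr0 ?subr0 //.
  have IH := IHr [::] a.+1; rewrite /= in IH.
  have cq : qfrac a.+1 ^+ k.+1 * (1 - q ^+ a.+1) = qfrac a.+1 ^+ k.
    by rewrite exprSr -mulrA qfracK mulr1.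
  by rewrite -{}IH -{}cq (exprS q a); move: (qfrac _ ^+ k.+1) => c; ring.
have IH1 := IHr (p :: s) a.+1; rewrite /= in IH1.
have IH2 := IHr s a.+1.
by rewrite -{}IH1 -{}IH2 (exprS q a); ring.
Qed.

(** With [k_j = 0] the sum over [m_j] is geometric, of ratio [x = y_j /
    y_(j+1)]. *)
Lemma G_geom r s x y k s' a :
  (1 - x) * G qfrac r (s ++ (0%N, x * y) :: (k, y) :: s') a
  = x * G qfrac r (s ++ (k, y) :: s') a - G qfrac r (s ++ (k, x * y) :: s') a.
Proof.
elim: r s a => [|r IHr] [|p s] a; rewrite /= ?mulr0 ?subr0 //.
  have IH := IHr [::] a.+1; rewrite /= in IH.
  by rewrite expr0 mul1r [LHS]mulrCA mulrDr {}IH; ring.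
have IH1 := IHr (p :: s) a.+1; rewrite /= in IH1.
by rewrite [LHS]mulrCA mulrDr {}IH1 [_ * (_ * G _ _ (s ++ _) _)]mulrCA IHr;
  ring.
Qed.

(** The case of the inverse ratio: [x = y_(j+1) / y_j]. *)
Lemma G_geom_inv r s x y k s' a :
  (1 - x) * G qfrac r (s ++ (0%N, y) :: (k, x * y) :: s') a
  = x * G qfrac r (s ++ (k, y) :: s') a - G qfrac r (s ++ (k, x * y) :: s') a.
Proof.
elim: r s a => [|r IHr] [|p s] a; rewrite /= ?mulr0 ?subr0 //.
  have IH := IHr [::] a.+1; rewrite /= in IH.
  by rewrite expr0 mul1r [LHS]mulrCA mulrDr {}IH; ring.
have IH1 := IHr (p :: s) a.+1; rewrite /= in IH1.
by rewrite [LHS]mulrCA mulrDr {}IH1 [_ * (_ * G _ _ (s ++ _) _)]mulrCA IHr;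
  ring.
Qed.

(** In the last position the geometric sum leaves a boundary term. *)
Lemma G_geom_last r s y a : low 1 y -> (forall p, p \in s -> low 1 p.2) ->
  low r.+1 ((1 - y) * G qfrac r (s ++ [:: (0%N, y)]) a - y * G qfrac r s a).
Proof.
move=> y1; elim: r s a => [|r IHr] [|p s] a s1 /=;
  rewrite ?mulr0 ?subrr ?low0 //.
- by rewrite mulr1 sub0r lowN.
- have IH := IHr [::] a.+1 s1; rewrite /= G_nil in IH.
  rewrite expr0 mul1r G_nil; set g := G _ _ _ _ in IH *.
  rewrite (_ : _ - _ = y * ((1 - y) * g - y * 1)); last by ring.
  by rewrite -add1n; apply: lowM.
- set g := G _ _ (p :: _ ++ _) _.
  have IH1 := IHr (p :: s) a.+1 s1; rewrite -/g in IH1.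
  have IH2 := IHr s a.+1 (fun p' sp' => s1 _ (mem_behead (s := p :: s) sp')).
  set g1 := G _ _ (p :: s) _ in IH1 *; set g2 := G _ _ (s ++ _) _ in IH2 *.
  set g3 := G _ _ s _ in IH2 *; set c := qfrac _ ^+ _.
  rewrite (_ : _ - _ = p.2 * (((1 - y) * g - y * g1) + c * ((1 - y) * g2 - y *
    g3)));
    last by ring.
  rewrite -add1n; apply: lowM; first by apply: s1; rewrite mem_head.
  by apply: lowD => //; apply: lowMr.
Qed.

(** The truncated sums stabilize for any multiplicative filtration of the ring
    for which the [y_i] have positive valuation. *)
Section Stability.
Variables (R : comNzRingType) (c : nat -> R) (F : nat -> R -> Prop).
Hypotheses (F_zero : forall n, F n 0) (F_all : forall x, F 0%N x)
  (F_add : forall n x y, F n x -> F n y -> F n (x + y))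
  (F_mul : forall m n x y, F m x -> F n y -> F (m + n)%N (x * y))
  (F_le : forall m n x, (m <= n)%N -> F n x -> F m x).

Lemma G_step r s a : (forall p, p \in s -> F 1%N p.2) ->
  F r.+1 (G c r.+1 s a - G c r s a).
Proof.
elim: r s a => [|r IHr] [|p s] a s1; rewrite ?subrr // [G _ _.+1 _ _]G_cons.
  rewrite subr0 -[1%N]addn0; apply: F_mul => //.
  by apply: s1; rewrite mem_head.
have IH1 := IHr (p :: s) a.+1 s1.
have IH2 := IHr s a.+1 (fun p' sp' => s1 _ (mem_behead (s := p :: s) sp')).
rewrite [G _ r.+1 (p :: s) a]G_cons -mulrBr -add1n; apply: F_mul.
  by apply: s1; rewrite mem_head.
rewrite opprD addrACA -mulrBr; apply: F_add => //.
by rewrite -[r.+1]add0n; apply: F_mul.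
Qed.

Lemma G_stable r r' s a : (r <= r')%N -> (forall p, p \in s -> F 1%N p.2) ->
  F r.+1 (G c r' s a - G c r s a).
Proof.
move=> le_rr' s1; rewrite -(subnK le_rr'); elim: (r' - r)%N => [|n IHn].
  by rewrite subrr.
rewrite addSn -(subrKA (G c (n + r) s a)); apply: F_add => //.
by apply: (F_le _ (G_step (n + r) a s1)); rewrite ltnS leq_addl.
Qed.

End Stability.

Lemma G_stable_low r r' s a : (r <= r')%N -> (forall p, p \in s -> low 1 p.2) ->
  low r.+1 (G qfrac r' s a - G qfrac r s a).
Proof.
apply: (@G_stable _ qfrac low) => *; [exact: low0|exact/low_coefP|exact:
  lowD|exact: lowM|].
by apply: low_le; eassumption.
Qed.

(** Each [y_i] occurs with a positive exponent in every term. *)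
Lemma G_low n p r s a : p \in s -> low n p.2 -> low n (G qfrac r s a).
Proof.
elim: r s a => [|r IHr] [|p' s] a sp pn //; first exact: low0.
rewrite G_cons.
have := sp; rewrite in_cons => /predU1P[<-|sp']; first exact: lowMl.
by apply/lowMr/lowD; [|apply/lowMr]; apply: IHr.
Qed.

(** The sum over all [0 < m_1 < ... < m_d], meaningful when [q] divides the
    [y_i]: the coefficient of [q ^+ n] then comes from the terms with [m_d <=
    n]. *)
Definition Gsum (s : seq (nat * fps)) : fps :=
  FPS (fun n => fcoef (G qfrac n s 0) n).

Lemma GsumP n s : (forall p, p \in s -> low 1 p.2) ->
  low n.+1 (G qfrac n s 0 - Gsum s).
Proof.
move=> s1; apply/low_coefP => i le_in; apply/eqP; rewrite fcoefB subr_eq0.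
apply/eqP; exact: low_eq_coef (G_stable_low _ _ s1) _.
Qed.

Lemma Gsum_nil : Gsum [::] = 1.
Proof. by apply/fpsP => n; rewrite /= G_nil. Qed.

Lemma Gsum_low n p s : p \in s -> low n p.2 -> low n (Gsum s).
Proof.
move=> sp pn; apply/low_coefP => i lt_in.
exact: (low_coefP _ _ (G_low _ _ sp pn)).
Qed.

Lemma Gsum_diff s k y s' :
  Gsum (s ++ (k.+1, y) :: s') - Gsum (qmul s ++ (k.+1, q * y) :: s')
  = Gsum (s ++ (k, y) :: s').
Proof.
apply/fpsP => n; rewrite fcoefB /= -(G_diff n s k y s' 0).
by rewrite mul1r fcoefB.
Qed.

(** A linear relation between truncated sums passes to the limit. *)
Lemma Gsum_rel (x y z : fps) s s' s'' :
  (forall p, [|| p \in s, p \in s' | p \in s''] -> low 1 p.2) ->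
  (forall n, low n.+1 (x * G qfrac n s 0
                       - (y * G qfrac n s' 0 + z * G qfrac n s'' 0))) ->
  x * Gsum s = y * Gsum s' + z * Gsum s''.
Proof.
move=> s1 rel; apply/eqP; rewrite -subr_eq0; apply/eqP/low_eq0 => n.
apply: (@low_le n n.+1) => //.
have H1 : low n.+1 (Gsum s - G qfrac n s 0).
  by apply/lowC/GsumP => p sp; apply: s1; rewrite sp.
have H2 : low n.+1 (G qfrac n s' 0 - Gsum s').
  by apply/GsumP => p sp; apply: s1; rewrite sp orbT.
have H3 : low n.+1 (G qfrac n s'' 0 - Gsum s'').
  by apply/GsumP => p sp; apply: s1; rewrite sp !orbT.
move: (lowD (lowMr x H1) (lowD (rel n) (lowD (lowMr y H2) (lowMr z H3)))).
by congr low; ring.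
Qed.

Lemma Gsum_geom s x y k s' :
  (forall p, p \in s ++ [:: (0%N, x * y), (k, y) & s'] -> low 1 p.2) ->
  (1 - x) * Gsum (s ++ [:: (0%N, x * y), (k, y) & s'])
  = x * Gsum (s ++ (k, y) :: s') - Gsum (s ++ (k, x * y) :: s').
Proof.
move=> s1; rewrite -[Gsum (s ++ (k, x * y) :: s')]mul1r -mulNr.
apply: Gsum_rel => [p|n]; last by rewrite G_geom mulNr mul1r subrr low0.
have y1 : low 1 y by apply: (s1 (k, y)); rewrite mem_cat !in_cons eqxx !orbT.
move=> sp; have [/s1 //|] := boolP (p \in s ++ [:: (0%N, x * y), (k, y) & s']).
move: sp; rewrite !mem_cat !in_cons => /or3P[->//||].
  by case/or3P=> [->|->|->] //; rewrite !orbT.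
by case/or3P=> [->|/eqP-> _|->]; rewrite ?orbT ?lowMr ?y1 ?orbT.
Qed.

Lemma Gsum_geom_inv s x y k s' :
  (forall p, p \in s ++ [:: (0%N, y), (k, x * y) & s'] -> low 1 p.2) ->
  (1 - x) * Gsum (s ++ [:: (0%N, y), (k, x * y) & s'])
  = x * Gsum (s ++ (k, y) :: s') - Gsum (s ++ (k, x * y) :: s').
Proof.
move=> s1; rewrite -[Gsum (s ++ (k, x * y) :: s')]mul1r -mulNr.
apply: Gsum_rel => [p|n]; last by rewrite G_geom_inv mulNr mul1r subrr low0.
have y1 : low 1 y by apply: (s1 (0%N, y)); rewrite mem_cat !in_cons eqxx !orbT.
move=> sp; have [/s1 //|] := boolP (p \in s ++ [:: (0%N, y), (k, x * y) & s']).
move: sp; rewrite !mem_cat !in_cons => /or3P[->//||].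
  by case/or3P=> [->//|/eqP->|->] //; rewrite !orbT.
by case/or3P=> [->|/eqP-> _|->]; rewrite ?orbT ?lowMr ?y1 ?orbT.
Qed.

Lemma Gsum_geom_last s y :
  (forall p, p \in s ++ [:: (0%N, y)] -> low 1 p.2) ->
  (1 - y) * Gsum (s ++ [:: (0%N, y)]) = y * Gsum s.
Proof.
move=> s1; rewrite -[RHS]addr0 -(mul0r (Gsum s)); apply: Gsum_rel => [p|n].
  by move=> sp; apply: s1; move: sp; rewrite mem_cat => /or3P[]->.
rewrite mul0r addr0; apply: G_geom_last => [|p sp].
  by apply: (s1 (0%N, y)); rewrite mem_cat mem_head orbT.
by apply: s1; rewrite mem_cat sp.
Qed.

(** * Linear maps out of free modules *)

Lemma linext_comp (K : choiceType) (V W : lmodType rat)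
    (g : {linear V -> W}) (f : K -> V) x :
  g (linext f x) = linext (fun k => g (f k)) x.
Proof.
by rewrite /linext linear_sum; apply: eq_bigr => k _; rewrite linearZ.
Qed.

Lemma eq_linext (K : choiceType) (V : lmodType rat) (f g : K -> V) x :
  f =1 g -> linext f x = linext g x.
Proof. by move=> fg; apply: eq_in_linext => k _; apply: fg. Qed.

Lemma linextD (K : choiceType) (V : lmodType rat) (f g : K -> V) x :
  linext (fun k => f k + g k) x = linext f x + linext g x.
Proof. by rewrite -big_split; apply: eq_bigr => k _; rewrite scalerDr. Qed.

Lemma linextN (K : choiceType) (V : lmodType rat) (f : K -> V) x :
  linext (fun k => - f k) x = - linext f x.
Proof.
by rewrite /linext -sumrN; apply: eq_bigr => k _; rewrite scalerN.
Qed.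

(** Rational scalars are central in any ring containing them. *)
Lemma scaler_ratAr (A : lalgType rat) (c : rat) (x y : A) :
  c *: (x * y) = x * (c *: y).
Proof.
have d0 : (denq c)%:~R != 0 :> rat by rewrite intr_eq0 denq_neq0.
apply: (scalerI d0); rewrite scalerA [RHS]scaler_int -mulrzAr -scaler_int
  scalerA.
by rewrite mulrC -numqE !scaler_int mulrzAr.
Qed.

Lemma linextMr (K : choiceType) (A : lalgType rat) (f : K -> A) (c : A) x :
  linext (fun k => f k * c) x = linext f x * c.
Proof. by rewrite mulr_suml; apply: eq_bigr => k _; rewrite scalerAl. Qed.

Lemma linextMl (K : choiceType) (A : lalgType rat) (f : K -> A) (c : A) x :
  linext (fun k => c * f k) x = c * linext f x.
Proof. by rewrite mulr_sumr; apply: eq_bigr => k _; rewrite scaler_ratAr. Qed.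

Lemma linext_tens (K K' : choiceType) (A : lalgType rat) (f : K -> A)
    (g : K' -> A) x y :
  linext (fun p => f p.1 * g p.2) (tens x y) = linext f x * linext g y.
Proof.
rewrite /tens linext_comp -linextMr; congr (linext _ x); apply/funext => k.
rewrite linext_comp -linextMl; congr (linext _ y); apply/funext => k'.
exact: (linextU (fun p : K * K' => f p.1 * g p.2) (k, k')).
Qed.

(** [x] is a combination of basis vectors satisfying [P]. *)
Definition spanned (K : choiceType) (P : K -> Prop) (x : {malg rat[K]}) :
    Prop :=
  forall k, k \in msupp x -> P k.

Section Spanned.
Variables (K : choiceType) (P : K -> Prop).
Implicit Types x : {malg rat[K]}.

Lemma spanned0 : spanned P 0.
Proof. by move=> k; rewrite msupp0 inE. Qed.

Lemma spannedU k : P k -> spanned P << k >>.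
Proof. by move=> Pk k'; rewrite msuppU oner_eq0 inE => /eqP->. Qed.

Lemma spannedD x (y : {malg rat[K]}) :
  spanned P x -> spanned P y -> spanned P (x + y).
Proof.
move=> Px Py k /(fsubsetP (msuppD_le x y)); rewrite inE => /orP[];
  first exact: Px.
exact: Py.
Qed.

Lemma spannedN x : spanned P x -> spanned P (- x).
Proof. by move=> Px k; rewrite msuppN => /Px. Qed.

Lemma spannedB x (y : {malg rat[K]}) :
  spanned P x -> spanned P y -> spanned P (x - y).
Proof. by move=> Px Py; apply: spannedD => //; apply: spannedN. Qed.

Lemma spannedZ c x : spanned P x -> spanned P (c *: x).
Proof. by move=> Px k /(fsubsetP (msuppZ_le c x)) /Px. Qed.

Lemma spanned_linext (K' : choiceType) (Q : K' -> Prop)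
    (f : K' -> {malg rat[K]})
    (y : {malg rat[K']}) :
  spanned Q y -> (forall k, Q k -> spanned P (f k)) -> spanned P (linext f y).
Proof.
move=> Qy fP; rewrite /linext big_seq; apply: big_ind => [||k /Qy /fP].
- exact: spanned0.
- exact: spannedD.
- exact: spannedZ.
Qed.

End Spanned.

Lemma spanned_sub (K : choiceType) (P Q : K -> Prop) x :
  (forall k, P k -> Q k) -> spanned P x -> spanned Q x.
Proof. by move=> PQ Px k /Px /PQ. Qed.

Lemma eq_linext_spanned (K : choiceType) (V : lmodType rat) (P : K -> Prop)
    (f g : K -> V) x :
  spanned P x -> (forall k, P k -> f k = g k) -> linext f x = linext g x.
Proof. by move=> Px fg; apply: eq_in_linext => k /Px /fg. Qed.

Lemma spanned_tens (A B : choiceType) (P : A -> Prop) (Q : B -> Prop)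
    (R : A * B -> Prop) x y :
  (forall a b, P a -> Q b -> R (a, b)) -> spanned P x -> spanned Q y ->
  spanned R (tens x y).
Proof.
move=> PQR Px Qy; apply: (spanned_linext Px) => a Pa.
by apply: (spanned_linext Qy) => b Qb; apply: spannedU; apply: PQR.
Qed.

(** * Tail products of symbols *)

(** The product of all arguments. *)
Definition tot (u : symbol) : mono := \sum_(p <- u) p.2.

(** The pairs [(k_i, x_i ... x_d)]. *)
Fixpoint tails (u : symbol) : symbol :=
  if u is p :: u' then (p.1, p.2 + tot u') :: tails u' else [::].

(** The effect on tail products of a multiplication of the last argument by [y].
    *)
Definition mulx (y : mono) (s : symbol) : symbol :=
  [seq (p.1, p.2 + y) | p <- s].

Lemma tot_nil : tot [::] = 0. Proof. exact: big_nil. Qed.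

Lemma tot_cons p u : tot (p :: u) = p.2 + tot u.
Proof. exact: big_cons. Qed.

Lemma tot_cat u v : tot (u ++ v) = tot u + tot v.
Proof. exact: big_cat. Qed.

Lemma tails_cat u v : tails (u ++ v) = mulx (tot v) (tails u) ++ tails v.
Proof. by elim: u => //= p u ->; rewrite tot_cat addrA. Qed.

Lemma mulxD y z s : mulx y (mulx z s) = mulx (z + y) s.
Proof. by rewrite /mulx -map_comp; apply: eq_map => p /=; rewrite addrA. Qed.

Lemma size_tails u : size (tails u) = size u.
Proof. by elim: u => //= p u ->. Qed.

Lemma nth_tails i u : (i < size u)%N -> (nth sym0 (tails u) i).2 = tot (drop i
  u).
Proof.
by elim: u i => // p u IHu [|i] lt_iu /=; rewrite ?drop0 ?tot_cons // IHu.
Qed.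

(** The condition on a single entry, and on a single tail product, in the
    definition of [F^n]. *)
Definition entry_ok (n : int) (p : nat * mono) : bool :=
  [&& (0 < p.1)%N, p.2.1 \in [:: 0; 1; -1] & 0 <= p.2.2 - p.2.1 * n <= p.1%:Z].

Definition tail_ok (y : mono) : bool := (y.1 == 1) || (y.1 == 0) && (0 < y.2).

Lemma in_FnE n u :
  in_Fn n u = all (entry_ok n) u && all (fun p => tail_ok p.2) (tails u).
Proof.
have -> : all (fun p => tail_ok p.2) (tails u) =
    [forall i : 'I_(size u), tail_ok (tot (drop i u))].
  apply/(all_nthP sym0)/forallP => [ok i | ok i].
    by rewrite -nth_tails //; apply: ok; rewrite size_tails.
  by rewrite size_tails => lt_iu; rewrite nth_tails //;
    exact: (ok (Ordinal lt_iu)).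
rewrite /in_Fn /in_Fhat -andbA [X in _ && X]andbC andbA; congr andb.
rewrite -all_predI; apply: eq_all => -[k [h e]] /=; rewrite /entry_ok /= -andbA.
congr andb; apply/andP/andP => -[hi].
  case/existsP=> s; have := ltn_ord s; move: hi;
    rewrite !inE !xpair_eqE /= => hi lts.
  by case/or3P=> /andP[/eqP-> /eqP->]; split; rewrite // ?mulN1r; lia.
move=> /andP[e0 ek]; split=> //; apply/existsP.
have lts : (absz (e - h * n)%R < k.+1)%N by lia.
exists (Ordinal lts); rewrite !inE !xpair_eqE /=.
have -> : (absz (e - h * n)%R : int) = e - h * n by lia.
by move: hi; rewrite !inE => /or3P[]/eqP-> /=; lia.
Qed.

(** * Evaluation of symbols at z = q^t *)

Lemma tot_ge n u : all (entry_ok n) u -> 0 <= (tot u).2 - (tot u).1 * n.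
Proof.
elim: u => [|p u IHu] /=; first by rewrite tot_nil mul0r subr0.
case/andP=> /and3P[_ _ /andP[p0 _]] /IHu u0.
by rewrite tot_cons /= mulrDl opprD addrACA addr_ge0.
Qed.

(** The monomial [y] is [z q^m] with [m >= 0], or [q^m] with [m > 0]. *)
Definition tail_pos (y : mono) : bool :=
  (y.1 == 1) && (0 <= y.2) || (y.1 == 0) && (0 < y.2).

Lemma tails_pos n u : 0 <= n -> in_Fn n u ->
  all (fun p => tail_pos p.2) (tails u).
Proof.
move=> n0; rewrite in_FnE => /andP[]; elim: u => //= p u IHu.
case/andP=> pok uok /andP[tok sok]; rewrite IHu // andbT.
have := @tot_ge n (p :: u); rewrite /= pok uok tot_cons => /(_ isT).
move: tok; rewrite /tail_ok /tail_pos; move: (p.2 + _) => [h e] /=.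
by case/orP=> [/eqP->|/andP[/eqP-> e0]] ge; lia.
Qed.

(** The exponent of [q] in [y] at [z = q ^+ t], when it is nonnegative. *)
Definition texp (t : nat) (y : mono) : nat := absz (y.1 * t%:Z + y.2)%R.

(** Tail products at [z = q ^+ t]. *)
Definition qtails (t : nat) (s : symbol) : seq (nat * fps) :=
  [seq (p.1, q ^+ texp t p.2) | p <- s].

(** The value of the series of the symbol [u] at [z = q ^+ t]; its terms are
    power series in [q] as soon as the tail products are. *)
Definition ev_sym (t : nat) (u : symbol) : fps := Gsum (qtails t (tails u)).

Definition ev (t : nat) : {malg rat[symbol]} -> fps := linext (ev_sym t).

(** The index [Some b] stands for [e_(q^b)], whose value is [z / (z - q^b)], and
    [None] for [e_0], whose value is [1]; only [b <= 0] occurs. *)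
Definition eO (t : nat) (o : option int) : fps :=
  if o is Some b then
    let w := q ^+ absz (t%:Z - b)%R in - (w / (1 - w))
  else 1.

(** The value of [u (x) e] is the product of those of [u] and [e]. *)
Definition evO (t : nat) : tensor symbol (option int) -> fps :=
  linext (fun p => ev_sym t p.1 * eO t p.2).

Lemma evOD t x y : evO t (x + y) = evO t x + evO t y.
Proof. exact: (linearD (linext (fun p => ev_sym t p.1 * eO t p.2))). Qed.

Lemma evON t x : evO t (- x) = - evO t x.
Proof. exact: (linearN (linext (fun p => ev_sym t p.1 * eO t p.2))). Qed.

Lemma ev0 t : ev t 0 = 0.
Proof. exact: (linear0 (linext (ev_sym t))). Qed.

Lemma evU t u : ev t << u >> = ev_sym t u. Proof. exact: linextU. Qed.

Lemma evO_tens t x y : evO t (tens x y) = ev t x * linext (eO t) y.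
Proof. exact: linext_tens. Qed.

Lemma texp_gt0 t y : (0 < t)%N -> tail_pos y -> (0 < texp t y)%N.
Proof.
by move=> t0 /orP[]/andP[/eqP hy ey]; rewrite /texp hy; lia.
Qed.

Lemma texp_q t y : tail_pos y -> texp t (y + (0, 1)) = (texp t y).+1.
Proof.
by move=> /orP[]/andP[/eqP hy ey]; rewrite /texp /= hy; lia.
Qed.

Lemma qtails_cat t s s' : qtails t (s ++ s') = qtails t s ++ qtails t s'.
Proof. exact: map_cat. Qed.

Lemma low1_qtails t s : (0 < t)%N -> all (fun p => tail_pos p.2) s ->
  forall p, p \in qtails t s -> low 1 p.2.
Proof.
move=> t0 /allP spos _ /mapP[p /spos p0 ->] /=.
exact: low_le (texp_gt0 t0 p0) (low_q _).
Qed.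

Lemma qtails_mulq t s : all (fun p => tail_pos p.2) s ->
  qtails t (mulx (0, 1) s) = qmul (qtails t s).
Proof.
elim: s => //= p s IHs /andP[p0 s0].
by rewrite -IHs //= texp_q // exprS.
Qed.

(** * The difference operator *)

Lemma tot_h (u : symbol) : all (fun p => tail_ok p.2) (tails u) ->
  (tot u).1 \in [:: 0; 1].
Proof.
case: u => [|p u] /=; first by rewrite tot_nil.
rewrite tot_cons => /andP[+ _]; rewrite /tail_ok !inE => /orP[->|/andP[-> _]]
  //.
by rewrite orbT.
Qed.

Lemma qshift_cat s k h e s' a :
  qshift (size s) a (s ++ (k, (h, e)) :: s') = s ++ (k, (h, e + a)) :: s'.
Proof.
rewrite /qshift nth_cat ltnn subnn set_nthE size_cat /= addnS ltnS leq_addr.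
rewrite take_size_cat // drop_cat ltnNge leqnSn subSnn /= drop0.
by congr (_ ++ (_, _) :: _); exact: (congr2 pair (addr0 h) erefl).
Qed.

(** Merging the argument [x_j] into its left neighbour removes the [j]-th entry
    from the list of the tail products, and preserves [F^n] when [x_j] is a
    power of [z q^n]. *)
Lemma merge_left_tails s k x s' : exists v,
  [/\ merge_left (s ++ (k, x) :: s') (size s) = << v >>,
      tails v = mulx (x + tot s') (tails s) ++ tails s' &
      forall n, k = 1%N -> x.2 = x.1 * n -> in_Fn n (s ++ (k, x) :: s') ->
        in_Fn n v /\ weight (s ++ (k, x) :: s') = (weight v).+1].
Proof.
rewrite /merge_left nth_cat ltnn subnn /=.
case/lastP: s => [|s [k' x']].
  exists s'; split=> // n -> xn; rewrite !in_FnE /= => /andP[/andP[_ ->]].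
  by case/andP=> _ ->; rewrite /weight big_cons.
rewrite size_rcons nth_cat size_rcons ltnSn nth_rcons ltnn eqxx.
exists (s ++ (k', x' + x) :: s'); split.
- rewrite cat_rcons take_size_cat //.
  rewrite -[_ :: _ :: s']/([:: (k', x'); (k, x)] ++ s') catA drop_size_cat //.
  by rewrite size_cat addnC.
- rewrite -cats1 !tails_cat /= tot_nil /mulx map_cat /= -!/(mulx _ _) mulxD.
  rewrite !tot_cons /= -catA /= addr0; congr (mulx _ _ ++ (_, _) :: _).
    by rewrite tot_nil addr0 addrA.
  by rewrite addrA.
move=> n -> xn; rewrite cat_rcons !in_FnE !all_cat !tails_cat !all_cat /=.
case/andP=> /and4P[-> pok xok ->] /and4P[sok pt xt s't].
rewrite s't !andbT /= !tot_cons /= in sok pt xt *.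
rewrite !addrA in pt sok *; rewrite sok pt /=.
split; last by rewrite /weight !(big_cat, big_cons) /= add1n !addnS.
have hs' := tot_h s't; case/and3P: pok => /= k'0 hx' /andP[e0 ek].
rewrite /entry_ok /= k'0 xn /= mulrDl; apply/andP; split; last by lia.
move: pt hs'; rewrite /tail_ok /= !inE; move: (tot s').1 => g.
by case/orP=> [/eqP hg|/andP[/eqP hg _]] /orP[]/eqP hg'; lia.
Qed.

(** Merging [x_j] into its right neighbour keeps the tail product in position
    [j], and the integer [k_(j+1)]. *)
Lemma merge_right_tails s k x k2 x2 s' : exists v,
  [/\ merge_right (s ++ [:: (k, x), (k2, x2) & s']) (size s) = << v >>,
      tails v = mulx (x + (x2 + tot s')) (tails s)
                  ++ (k2, x + (x2 + tot s')) :: tails s' &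
      forall n, k = 1%N -> x.2 = x.1 * n ->
        in_Fn n (s ++ [:: (k, x), (k2, x2) & s']) ->
        in_Fn n v /\ weight (s ++ [:: (k, x), (k2, x2) & s']) = (weight v).+1].
Proof.
exists (s ++ (k2, x + x2) :: s'); split.
- rewrite /merge_right size_cat /= !addnS !ltnS leq_addr !nth_cat ltnn subnn /=.
  rewrite ltnNge leqnSn subSnn /= take_size_cat //.
  rewrite drop_cat ltnNge (leqW (leqnSn _)) /= !subSn // subnn.
  by rewrite /= drop0.
- by rewrite tails_cat tot_cons /= addrA.
move=> n -> xn; rewrite !in_FnE !all_cat !tails_cat !all_cat /=.
case/andP=> /and4P[-> xok pok ->] /and4P[sok xt pt s't].
rewrite s't !andbT /= !tot_cons /= in sok pt xt *.
rewrite !addrA in xt sok *; rewrite sok xt /=.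
split; last by rewrite /weight !(big_cat, big_cons) /= add1n !addnS.
have hs' := tot_h s't; case/and3P: pok => /= k2_0 hx2 /andP[e0 ek].
rewrite /entry_ok /= k2_0 xn /= mulrDl; apply/andP; split; last by lia.
move: xt hs'; rewrite /tail_ok /= !inE; move: (tot s').1 => g.
by case/orP=> [/eqP hg|/andP[/eqP hg _]] /orP[]/eqP hg'; lia.
Qed.

(** When [u] and its image under the multiplication of the [j]-th argument by
    [q] both belong to [F^n] and [k_j = 1], that argument is [z^h q^(h n)]. *)
Lemma adjacent_arg n s k h e s' : h != 0 ->
  in_Fn n (s ++ (k, (h, e)) :: s') ->
  in_Fn n (s ++ (k, (h, e + 1)) :: s') ->
  [/\ (0 < k)%N, h = 1 \/ h = -1,
      k = 1%N -> e = h * n &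
      (1 < k)%N -> in_Fn n (s ++ (k.-1, (h, e)) :: s')].
Proof.
move=> h0; rewrite !in_FnE !all_cat !tails_cat !all_cat /= !tot_cons /=.
case/andP=> /and3P[so /and3P[k0 h1 /andP[e0 ek]] s'o] /and3P[st xt s't].
case/andP=> /andP[_ /andP[/and3P[_ _ /andP[e0' ek']] _]] _.
rewrite /= in k0 h1 e0 ek e0' ek'.
split=> //; first by move: h0 h1; rewrite !inE; lia.
  by move=> k1; lia.
move=> k1; rewrite so s'o st xt s't /entry_ok /= h1 e0 !andbT.
by apply/andP; split; lia.
Qed.

(** The basis vectors of [F^n (x) Omega] which occur in the differences of
    symbols of [F^n] of weight [w]. *)
Definition D_target (n : int) (w : nat) (p : symbol * option int) : Prop :=
  [/\ in_Fn n p.1, (weight p.1).+1 = w & p.2 = None \/ p.2 = Some (- n)].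

Lemma Dq_spanned n u j : (j < size u)%N -> (nth sym0 u j).2.1 != 0 ->
  in_Fn n u -> in_Fn n (qshift j 1 u) ->
  spanned (D_target n (weight u)) (Dq u j).
Proof.
move=> ju; rewrite -(cat_take_drop j u) (drop_nth sym0) //.
move: (take j u) (drop j.+1 u) (size_takel (ltnW ju)).
move: (nth sym0 u j) => [k [h e]] s s' <- {ju}.
rewrite qshift_cat /Dq nth_cat ltnn subnn /= => h0 Fu Fv.
have [k0 hE eE k1F] := adjacent_arg h0 Fu Fv; rewrite (negbTE h0).
case: ifPn => k1.
  rewrite set_nthE size_cat /= addnS ltnS leq_addr take_size_cat //.
  rewrite drop_cat ltnNge leqnSn subSnn /= drop0.
  apply: (@spanned_tens _ _ (fun v => in_Fn n v /\
    (weight v).+1 = weight (s ++ (k, (h, e)) :: s')) (fun o => o = None)).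
  - by move=> v o [Fv' wv] ->; split=> //; left.
  - apply: spannedU; split; first exact: k1F.
    by rewrite /weight !(big_cat, big_cons) /= -addnS -addSn prednK.
  - exact: spannedU.
have {k0 k1} k1 : k = 1%N by lia.
have {}eE := eE k1.
pose P v := in_Fn n v /\ (weight v).+1 = weight (s ++ (k, (h, e)) :: s').
pose Q o := o = None \/ o = Some (- n).
have PQ x y : spanned P x -> spanned Q y ->
    spanned (D_target n (weight (s ++ (k, (h, e)) :: s'))) (tens x y).
  by apply: spanned_tens => v o [Fv' wv] oE; split.
have PA : spanned P (merge_left (s ++ (k, (h, e)) :: s') (size s)).
  have [v [-> _ /(_ n k1 eE Fu)[Fv' wv]]] := merge_left_tails s k (h, e) s'.
  exact: spannedU.
have PB : spanned P (merge_right (s ++ (k, (h, e)) :: s') (size s)).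
  case: s' @P Fu {Fv k1F PQ PA} => [|[k2 x2] s'] P Fu.
    by rewrite /merge_right size_cat addn1 ltnn; exact: spanned0.
  have [v [-> _ /(_ n k1 eE Fu)[Fv' wv]]] := merge_right_tails s k (h, e) k2 x2
    s'.
  exact: spannedU.
have Q0 : spanned Q e_0 by apply: spannedU; left.
have Qn b : b = - n -> spanned Q (e_q b) by move=> ->; apply: spannedU; right.
have Q1 b : b = - n -> spanned Q (e_q b - e_0) by move=> bE;
  apply: spannedB (Qn b bE) Q0.
case: eqP hE => [h1 _ | _ [//|h1]].
  have bE : - e = - n by rewrite eE h1 mul1r.
  by apply: spannedD; first apply: spannedN; apply: PQ; auto.
have bE : e = - n by rewrite eE h1 mulN1r.
by apply: spannedB; apply: PQ; auto.
Qed.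

Lemma ev_sym_qshift t s k h e s' :
  all (fun p => tail_pos p.2) (tails (s ++ (k.+1, (h, e)) :: s')) ->
  ev_sym t (s ++ (k.+1, (h, e)) :: s') - ev_sym t (s ++ (k.+1, (h, e + 1)) ::
    s')
  = Gsum (qtails t (mulx ((h, e) + tot s') (tails s)
                      ++ (k, (h, e) + tot s') :: tails s')).
Proof.
rewrite /ev_sym !tails_cat all_cat /= !tot_cons /= => /and3P[spos ypos _].
have -> : ((h, e + 1) : mono) + tot s' = (h, e) + tot s' + (0, 1).
  rewrite addrAC; congr (_ + tot s').
  by exact: (congr2 pair (esym (addr0 h)) erefl).
rewrite !qtails_cat -[mulx (_ + (0, 1)) _]mulxD qtails_mulq //= texp_q // exprS.
exact: Gsum_diff.
Qed.

(** With [w = z / q^b], the values of [e_(q^b)] and [e_(q^b) - e_0] are [- w /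
    (1 - w)] and [- 1 / (1 - w)]. *)
Section EvaluationOfD.
Variables (t : nat) (b : int).
Let w := q ^+ absz (t%:Z - b)%R.
Hypothesis w0 : (0 < absz (t%:Z - b)%R)%N.

Let wU : 1 - w \is a GRing.unit. Proof. exact: oneBq_unit. Qed.

Let eqE : linext (eO t) (e_q b) = - (w / (1 - w)).
Proof. exact: linextU. Qed.

Let eq0E : linext (eO t) (e_q b - e_0) = - (1 - w)^-1.
Proof.
have -> : linext (eO t) (e_q b - e_0)
    = linext (eO t) (e_q b) - linext (eO t) e_0 by exact: linearB.
rewrite eqE (linextU _ None) /=; apply: (mulIr wU).
by rewrite mulrBl mul1r !mulNr mulrVK // mulVr //; ring.
Qed.

Let solve (M x y : fps) : (1 - w) * M = w * x - y ->
  M = x * (w / (1 - w)) - y * (1 - w)^-1.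
Proof.
move=> MAB; apply: (mulrI wU); rewrite MAB mulrA -mulrBl mulrCA.
by rewrite mulrV // mulr1 mulrC.
Qed.

Lemma evO_plus x y M : (1 - w) * M = w * ev t x - ev t y ->
  evO t (- tens x (e_q b) + tens y (e_q b - e_0)) = M.
Proof.
move=> MAB; rewrite (solve MAB).
have aux o o' c c' : linext (eO t) o = c -> linext (eO t) o' = c' ->
    evO t (- tens x o + tens y o') = - (ev t x * c) + ev t y * c'.
  move=> <- <-; rewrite evOD evON.
  by congr (- _ + _); exact: evO_tens.
by rewrite (aux _ _ _ _ eqE eq0E) !mulrN opprK.
Qed.

Lemma evO_minus x y M : (1 - w) * M = w * ev t y - ev t x ->
  evO t (tens x (e_q b - e_0) - tens y (e_q b)) = M.
Proof.
move=> MAB; rewrite (solve MAB).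
have aux o o' c c' : linext (eO t) o = c -> linext (eO t) o' = c' ->
    evO t (tens x o' - tens y o) = ev t x * c' - ev t y * c.
  move=> <- <-; rewrite evOD evON.
  by congr (_ - _); exact: evO_tens.
by rewrite (aux _ _ _ _ eqE eq0E) !mulrN opprK addrC.
Qed.

End EvaluationOfD.

(** [D] computes the difference of the values of adjacent symbols. *)
Lemma Dq_ev n t u j : 0 <= n -> (0 < t)%N -> (j < size u)%N ->
  (nth sym0 u j).2.1 != 0 -> in_Fn n u -> in_Fn n (qshift j 1 u) ->
  evO t (Dq u j) = ev_sym t u - ev_sym t (qshift j 1 u).
Proof.
move=> n0 t0 ju; rewrite -(cat_take_drop j u) (drop_nth sym0) //.
move: (take j u) (drop j.+1 u) (size_takel (ltnW ju)).
move: (nth sym0 u j) => [k [h e]] s s' <- {ju}.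
rewrite qshift_cat /Dq nth_cat ltnn subnn /= => h0 Fu Fv.
have [k0 hE eE k1F] := adjacent_arg h0 Fu Fv; rewrite (negbTE h0).
have upos := tails_pos n0 Fu.
case: k => // k in k0 eE k1F Fu Fv upos *; rewrite ev_sym_qshift //.
case: ifPn => k1.
  rewrite set_nthE size_cat /= addnS ltnS leq_addr take_size_cat //.
  rewrite drop_cat ltnNge leqnSn subSnn /= drop0 evO_tens evU linextU mulr1.
  by rewrite /ev_sym tails_cat /= tot_cons.
have {k1 k0} k0 : k = 0%N by lia.
rewrite {}k0 {k1F} in eE Fu Fv upos *; have {}eE := eE erefl.
have [v [-> vE _]] := merge_left_tails s 1 (h, e) s'.
set M := Gsum _.
have Mlow : forall p, p \in qtails t (mulx ((h, e) + tot s') (tails s)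
                 ++ (0%N, (h, e) + tot s') :: tails s') -> low 1 p.2.
  apply: low1_qtails => //; move: upos; rewrite tails_cat !all_cat /= tot_cons
    /=.
  by case/and3P=> -> -> ->.
case: s' => [|[k2 x2] s'] in Fu Fv upos v vE M Mlow *.
  have h1 : h = 1.
    case: hE => // h1; move: Fu; rewrite in_FnE tails_cat !all_cat /= tot_nil.
    by rewrite {1}/tail_ok /= h1 addr0 /= !andbF.
  rewrite /merge_right size_cat addn1 ltnn h1 eqxx; apply: evO_plus;
    first by lia.
  rewrite ev0 subr0 evU /M /ev_sym vE !qtails_cat /=.
  rewrite [tot [::]]tot_nil !addr0 cats0 /= in Mlow *.
  have -> : absz (t%:Z - - e)%R = texp t (h, e) by rewrite /texp /= h1 mul1r
    opprK.
  by apply: Gsum_geom_last; rewrite qtails_cat in Mlow.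
have [v' [-> v'E _]] := merge_right_tails s 1 (h, e) k2 x2 s'.
rewrite /M /ev_sym !qtails_cat /= in Mlow *.
have ypos : tail_pos (x2 + tot s') /\ tail_pos ((h, e) + (x2 + tot s')).
  move: upos; rewrite tails_cat all_cat /= !tot_cons.
  by case/and4P=> _ /= -> ->.
rewrite tot_cons /= in vE Mlow *; case: ypos.
case: hE eE => hE eE; subst h; rewrite ?eqxx /= => y'pos ypos.
  apply: evO_plus; first by lia.
  rewrite 2!evU /ev_sym vE v'E !qtails_cat /=.
  have yE : q ^+ texp t ((1, e) + (x2 + tot s'))
      = q ^+ absz (t%:Z - - e)%R * q ^+ texp t (x2 + tot s').
    rewrite -exprD; congr (_ ^+ _); move: y'pos ypos.
    move: (x2 + tot s') => [g f]; rewrite /tail_pos /texp /=.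
    by case/orP=> /andP[/eqP-> f0] /orP[]/andP[/eqP h1 f1]; lia.
  by rewrite yE in Mlow *; apply: Gsum_geom.
apply: evO_minus; first by lia.
rewrite 2!evU /ev_sym vE v'E !qtails_cat /=.
have yE : q ^+ texp t (x2 + tot s')
    = q ^+ absz (t%:Z - e)%R * q ^+ texp t ((-1, e) + (x2 + tot s')).
  rewrite -exprD; congr (_ ^+ _); move: y'pos ypos.
  move: (x2 + tot s') => [g f]; rewrite /tail_pos /texp /=.
  by case/orP=> /andP[/eqP-> f0] /orP[]/andP[/eqP h1 f1]; lia.
by rewrite yE in Mlow *; apply: Gsum_geom_inv.
Qed.

(** * The standard path *)

(** The symbol [u] after the replacement of [z] by [z q] in the positions of
    [P]. *)
Definition shifted (P : seq nat) (u : symbol) : symbol :=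
  mkseq (fun i => let p := nth sym0 u i in
           (p.1, (p.2.1, p.2.2 + (if i \in P then p.2.1 else 0)))) (size u).

Lemma size_shifted P u : size (shifted P u) = size u.
Proof. exact: size_mkseq. Qed.

Lemma nth_shifted P u i : (i < size u)%N ->
  nth sym0 (shifted P u) i =
    ((nth sym0 u i).1, ((nth sym0 u i).2.1, (nth sym0 u i).2.2 +
       (if i \in P then (nth sym0 u i).2.1 else 0))).
Proof. exact: nth_mkseq. Qed.

Lemma shifted_nil u : shifted [::] u = u.
Proof.
apply: (@eq_from_nth _ sym0); rewrite size_shifted // => i lt_iu.
by rewrite nth_shifted // addr0; case: (nth _ _ _) => k [].
Qed.

Lemma size_qshift i a u : (i < size u)%N -> size (qshift i a u) = size u.
Proof. by move=> lt_iu; rewrite size_set_nth; apply/maxn_idPr. Qed.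

Lemma nth_qshift i a u j : nth sym0 (qshift i a u) j =
  if j == i then let p := nth sym0 u i in (p.1, (p.2.1, p.2.2 + a))
  else nth sym0 u j.
Proof.
rewrite nth_set_nth /=; case: eqP => // _; congr pair.
by case: (nth _ _ _).2 => h e; exact: (congr2 pair (addr0 h) erefl).
Qed.

Lemma qshift_shifted P u i : (i < size u)%N -> i \notin P ->
  qshift i (nth sym0 u i).2.1 (shifted P u) = shifted (rcons P i) u.
Proof.
move=> lt_iu iP; apply: (@eq_from_nth _ sym0).
  by rewrite size_qshift !size_shifted.
rewrite size_qshift size_shifted // => j lt_ju.
rewrite nth_qshift !nth_shifted // mem_rcons inE.
by case: eqP => //= ->; rewrite (negbTE iP) addr0.
Qed.

Lemma qshiftK i a u : (i < size u)%N -> qshift i (- a) (qshift i a u) = u.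
Proof.
move=> lt_iu; apply: (@eq_from_nth _ sym0); rewrite !size_qshift // => j lt_ju.
rewrite !nth_qshift eqxx; case: eqP => // ->; rewrite /= addrK.
by case: (nth _ _ _) => k [].
Qed.

Lemma find_zip (T : eqType) (s a b : seq T) x y : x != y ->
  find (fun p => p.1 != p.2) (zip (s ++ x :: a) (s ++ y :: b)) = size s.
Proof. by move=> xy; elim: s => [|c s /= ->]; rewrite /= ?xy ?eqxx. Qed.

Lemma find_qshift i a u : (i < size u)%N -> a != 0 ->
  find (fun p => p.1 != p.2) (zip u (qshift i a u)) = i.
Proof.
move=> lt_iu a0; rewrite -(cat_take_drop i u) (drop_nth sym0) //.
move: (take i u) (drop i.+1 u) (size_takel (ltnW lt_iu)).
move: (nth sym0 u i) => [k [h e]] s s' <- {lt_iu}.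
rewrite qshift_cat find_zip //; apply/eqP => -[] /eqP.
by rewrite -subr_eq0 opprD addNKr oppr_eq0 (negbTE a0).
Qed.

Lemma D_up u i : (i < size u)%N -> D u (qshift i 1 u) = Dq u i.
Proof. by move=> lt_iu; rewrite /D find_qshift // eqxx. Qed.

Lemma D_down u i : (i < size u)%N ->
  D u (qshift i (- 1) u) = - Dq (qshift i (- 1) u) i.
Proof.
move=> lt_iu; rewrite /D find_qshift // -{3}(opprK 1) qshiftK // eqxx.
case: eqP => // /(congr1 (nth sym0 ^~ i)).
rewrite !nth_qshift eqxx => -[] /addrI; lia.
Qed.

Lemma in_FnP n u : reflect
  ((forall i, (i < size u)%N -> entry_ok n (nth sym0 u i)) /\
   (forall i, (i < size u)%N -> tail_ok (tot (drop i u))))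
  (in_Fn n u).
Proof.
rewrite in_FnE; apply: (iffP andP) => -[ok tok]; split.
- exact/all_nthP.
- move=> i lt_iu; rewrite -nth_tails //.
  by move/all_nthP: tok; apply; rewrite size_tails.
- exact/(all_nthP sym0).
- apply/(all_nthP sym0) => i; rewrite size_tails => lt_iu.
  by rewrite nth_tails // tok.
Qed.

Lemma tot_drop u i :
  tot (drop i u) = \sum_(i <= j < size u) (nth sym0 u j).2.
Proof.
rewrite /tot (big_nth sym0) size_drop -[in RHS](add0n i) big_addn.
by apply: eq_big_nat => j _; rewrite nth_drop addnC.
Qed.

Lemma sum_fst (I : Type) (r : seq I) (P : pred I) (F : I -> mono) :
  (\sum_(i <- r | P i) F i).1 = \sum_(i <- r | P i) (F i).1.
Proof. exact: (big_morph fst). Qed.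

Lemma sum_snd (I : Type) (r : seq I) (P : pred I) (F : I -> mono) :
  (\sum_(i <- r | P i) F i).2 = \sum_(i <- r | P i) (F i).2.
Proof. exact: (big_morph snd). Qed.

(** The order in which the standard path treats the positions. *)
Definition before (u : symbol) (i j : nat) : bool :=
  let lev i := level (nth sym0 u i).2 in
  (lev i < lev j) || (lev i == lev j) && (j <= i)%N.

(** [P] is an initial segment of the positions depending on [z]. *)
Definition initial (u : symbol) (P : seq nat) : Prop :=
  forall i j, j \in P -> (i < size u)%N -> (nth sym0 u i).2.1 != 0 ->
  before u i j -> i \in P.

Section ShiftedInF.
Variables (n : int) (u : symbol) (P : seq nat).
Hypotheses (Fu : in_Fn n u) (initP : initial u P).

Let k i := (nth sym0 u i).1.
Let h i := (nth sym0 u i).2.1.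
Let e i := (nth sym0 u i).2.2.
Let H i := \sum_(i <= j < size u) h j.
Let e' i := e i + (if i \in P then h i else 0).

Let uE i : (i < size u)%N ->
  [/\ (0 < k i)%N, h i \in [:: 0; 1; -1], 0 <= e i - h i * n
    & e i - h i * n <= (k i)%:Z].
Proof.
by move=> lt_iu; case/in_FnP: Fu => /(_ i lt_iu) /and3P[? ? /andP[]].
Qed.

Let H01 i : H i = 0 \/ H i = 1.
Proof.
have [le_ui|lt_iu] := leqP (size u) i; first by left; rewrite /H big_geq.
case/in_FnP: Fu => _ /(_ i lt_iu); rewrite tot_drop /tail_ok sum_fst -/(H i).
by case/orP=> [/eqP|/andP[/eqP]]; [right|left].
Qed.

Let Hcat i j : (i <= j)%N -> (j <= size u)%N ->
  H i = \sum_(i <= l < j) h l + H j.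
Proof. by move=> ij ju; rewrite /H (big_cat_nat ij ju). Qed.

Let HS i : (i < size u)%N -> H i = h i + H i.+1.
Proof. by move=> lt_iu; rewrite (Hcat (leqnSn i)) // big_nat1. Qed.

(** The tail conditions survive as long as the shifted entries are within the
    bounds of [F^m]: otherwise all shifted exponents of the tail would be
    minimal, which the hypothesis excludes. *)
Let shifted_in_F m :
  (forall i, (i < size u)%N -> 0 <= e' i - h i * m <= (k i)%:Z) ->
  (forall i, H i = 0 ->
     (forall j, (i <= j < size u)%N -> e' j - h j * m = 0) ->
     forall j, (i <= j < size u)%N -> e j - h j * n = 0) ->
  in_Fn m (shifted P u).
Proof.
move=> bounds minimal; apply/in_FnP; rewrite size_shifted; split=> i lt_iu.
  rewrite nth_shifted // /entry_ok /=; have [-> -> _ _] := uE lt_iu.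
  exact: bounds.
case/in_FnP: Fu => _ /(_ i lt_iu); rewrite !tot_drop size_shifted /tail_ok.
rewrite !sum_fst !sum_snd -/(H i).
have -> : \sum_(i <= j < size u) (nth sym0 (shifted P u) j).2.1 = H i.
  by apply: eq_big_nat => j /andP[_ lt_ju]; rewrite nth_shifted.
have -> : \sum_(i <= j < size u) (nth sym0 (shifted P u) j).2.2
    = \sum_(i <= j < size u) e' j.
  by apply: eq_big_nat => j /andP[_ lt_ju]; rewrite nth_shifted.
case/orP=> [->//|/andP[/eqP H0 pos]]; rewrite H0 /=.
have shiftE (f : nat -> int) (a : int) :
    \sum_(i <= j < size u) f j = \sum_(i <= j < size u) (f j - h j * a).
  by rewrite sumrB -mulr_suml -/(H i) H0 mul0r subr0.
rewrite lt_def (shiftE _ m); apply/andP; split; last first.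
  rewrite big_nat; apply: sumr_ge0 => j /andP[_ /bounds /andP[]] //.
apply/eqP => sum0; move: pos; rewrite (shiftE _ n) big_nat big1 ?ltxx //.
apply: (minimal i H0) => j ij; apply/eqP.
have : (\sum_(i <= j < size u) (e' j - h j * m) == 0) by rewrite sum0.
rewrite big_nat psumr_eq0 => [|l /andP[_ /bounds /andP[]] //].
by move/allP/(_ j); rewrite mem_index_iota ij => /(_ isT).
Qed.

Let exists_pm i j (c : int) : c \in [:: 1; -1] ->
  (i <= j <= size u)%N -> \sum_(i <= l < j) h l = c ->
  exists2 l, (i <= l < j)%N & h l = c.
Proof.
move=> cE /andP[ij ju] sumE.
case: (pselect (exists2 l, (i <= l < j)%N & h l = c)) => // none; exfalso.
have : 0 <= \sum_(i <= l < j) (- (h l * c)).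
  rewrite big_nat; apply: sumr_ge0 => l /andP[il lj].
  have [_ hl _ _] := uE (leq_trans lj ju).
  have : h l != c by apply/eqP => hc; apply: none; exists l; rewrite ?il.
  by move: hl cE; rewrite !inE; move: (h l) => g; lia.
by rewrite sumrN -mulr_suml sumE; move: cE; rewrite !inE; lia.
Qed.

(** While only levels at most [n] have been treated, the path stays in [F^n]. *)
Lemma shifted_low_level :
  (forall i, i \in P -> level (nth sym0 u i).2 <= n) -> in_Fn n (shifted P u).
Proof.
move=> levP; apply: shifted_in_F => [i lt_iu | i H0 min j /andP[ij ju]].
  have [k0 hi e0 ek] := uE lt_iu; rewrite /e'; case: ifP => [/levP|_]; last lia.
  rewrite /level -/(h i) -/(e i); move: hi; rewrite !inE.
  by case/or3P=> /eqP hi; rewrite hi /= in e0 ek *; lia.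
have [k0 hj e0 ek] := uE ju.
have := min j; rewrite ij ju /e' => /(_ isT).
case: ifP => jP; [|by rewrite addr0]; move: hj; rewrite !inE.
case/or3P=> /eqP hj; rewrite hj in e0 ek *; [lia|lia|move=> ej; exfalso].
(* The tail after [j] then contains a position [l] with [x_l = z q^n], which is
   of the same level as [j], hence was treated before [j]. *)
have Hj := HS ju; rewrite hj in Hj.
have HSj : H j.+1 = 1 by have := H01 j; have := H01 j.+1; lia.
have [||l /andP[jl lu] hl] := @exists_pm j.+1 (size u) 1 _ _ HSj;
  rewrite ?inE ?ju ?leqnn //.
have [k0l _ e0l ekl] := uE lu; rewrite hl in e0l ekl.
have := min l; rewrite (leq_trans ij (ltnW jl)) lu /e' => /(_ isT).
have lP : l \in P.
  apply: (initP jP) => //; first by rewrite -/(h l) hl.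
  rewrite /before /level -/(h l) -/(h j) -/(e j) -/(e l) hl hj (ltnW jl) andbT
    /=.
  have := min l; rewrite (leq_trans ij (ltnW jl)) lu /e' hl => /(_ isT).
  by case: ifP; lia.
by rewrite lP hl; lia.
Qed.

(** Once all levels at most [n] have been treated, the path stays in [F^(n+1)].
    *)
Lemma shifted_high_level :
  (forall i, (i < size u)%N -> h i != 0 ->
     level (nth sym0 u i).2 <= n -> i \in P) ->
  in_Fn (n + 1) (shifted P u).
Proof.
move=> levP; apply: shifted_in_F => [i lt_iu | i H0 min j /andP[ij ju]].
  have [k0 hi e0 ek] := uE lt_iu; rewrite /e'; have := levP i lt_iu.
  rewrite /level -/(h i) -/(e i); move: hi; rewrite !inE.
  by case/or3P=> /eqP hi; rewrite hi /= in e0 ek *; case: ifP; lia.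
have [k0 hj e0 ek] := uE ju.
have := min j; rewrite ij ju /e' => /(_ isT).
move: hj; rewrite !inE.
case/or3P=> /eqP hj; rewrite hj in e0 ek *; [by case: ifP; lia| |by case: ifP;
  lia].
case: ifP => jP; first by lia.
(* Between [i] and [j] there is then a position [l] with [x_l = z^(-1) q^(-n)],
   which is of the same level as [j], hence is treated after [j]. *)
move=> ej; exfalso; have Hj := HS ju; rewrite hj in Hj.
have HE := Hcat ij (ltnW ju).
have sumE : \sum_(i <= l < j) h l = -1 by have := H01 j; have := H01 j.+1; lia.
have [||l /andP[il lj] hl] := @exists_pm i j (-1) _ _ sumE;
  rewrite ?inE ?ij ?(ltnW ju) //.
have lu := ltn_trans lj ju.
have [k0l _ e0l ekl] := uE lu; rewrite hl in e0l ekl.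
have := min l; rewrite il lu /e' hl => /(_ isT).
case: ifP => lP; last by lia.
move=> el; suff : j \in P by rewrite jP.
apply: (initP lP) => //; first by rewrite -/(h j) hj.
rewrite /before /level -/(h l) -/(h j) -/(e j) -/(e l) hl hj (ltnW lj) andbT /=.
lia.
Qed.

End ShiftedInF.

Lemma before_trans u : transitive (before u).
Proof.
move=> j i l; rewrite /before; move: (level _) (level _) (level _) => a b c.
case/orP=> [ba|/andP[/eqP-> ji]] /orP[ac|/andP[/eqP<- lj]].
- by rewrite (lt_trans ba ac).
- by rewrite ba.
- by rewrite ac.
- by rewrite eqxx (leq_trans lj ji) orbT.
Qed.

Lemma before_total u : total (before u).
Proof.
by move=> i j; rewrite /before; case: ltgtP => //= _; rewrite ?orbF ?leq_total.
Qed.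

Lemma before_anti u i j : before u i j -> before u j i -> i = j.
Proof.
rewrite /before; case: ltgtP => //= _ ji ij.
by apply/eqP; rewrite eqn_leq ij ji.
Qed.

Lemma Std_orderE u : Std_order u =
  sort (before u) [seq i <- iota 0 (size u) | (nth sym0 u i).2.1 != 0].
Proof. by []. Qed.

Lemma mem_Std_order u i :
  (i \in Std_order u) = (i < size u)%N && ((nth sym0 u i).2.1 != 0).
Proof. by rewrite Std_orderE mem_sort mem_filter mem_iota add0n andbC. Qed.

Lemma prefix_initial u P s : Std_order u = P ++ s -> initial u P.
Proof.
move=> OE i j jP lt_iu hi ij.
have: i \in Std_order u by rewrite mem_Std_order lt_iu.
rewrite OE mem_cat => /orP[//|si].
have : sorted (before u) (P ++ s).
  by rewrite -OE Std_orderE; apply/sort_sorted/before_total.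
rewrite sorted_pairwise; last exact: before_trans.
rewrite pairwise_cat => /and3P[/allrelP/(_ j i jP si) ji _ _].
by rewrite (before_anti ij ji).
Qed.

(** Consecutive symbols of the standard path belong to a common [F^m]. *)
Lemma path_step n u P i : in_Fn n u -> initial u P -> initial u (rcons P i) ->
  i \notin P -> (i < size u)%N -> (nth sym0 u i).2.1 != 0 ->
  exists m, [/\ m = n \/ m = n + 1, in_Fn m (shifted P u)
              & in_Fn m (shifted (rcons P i) u)].
Proof.
move=> Fu iniP inirP iP lt_iu hi.
have [le_in|lt_ni] := leP (level (nth sym0 u i).2) n.
  have levP j : j \in P -> level (nth sym0 u j).2 <= n.
    move=> jP; apply: le_trans le_in; rewrite leNgt; apply: contra iP => ij.
    by apply: (iniP _ j) => //; rewrite /before ij.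
  exists n; split; [by left|exact: shifted_low_level|].
  by apply: shifted_low_level => // j; rewrite mem_rcons inE =>
    /predU1P[->|/levP].
have levP j : (j < size u)%N -> (nth sym0 u j).2.1 != 0 ->
    level (nth sym0 u j).2 <= n -> j \in P.
  move=> lt_ju hj lev_j; have : j \in rcons P i.
    apply: (inirP _ i) => //; first by rewrite mem_rcons mem_head.
    by rewrite /before (le_lt_trans lev_j lt_ni).
  rewrite mem_rcons inE => /predU1P[jE|//].
  by rewrite jE leNgt lt_ni in lev_j.
exists (n + 1); split; [by right|exact: shifted_high_level|].
apply: shifted_high_level => // j lt_ju hj lev_j.
by rewrite mem_rcons inE levP ?orbT.
Qed.

Lemma weight_shifted P u : weight (shifted P u) = weight u.
Proof.
rewrite /weight (big_nth sym0) size_shifted [RHS](big_nth sym0).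
by apply: eq_big_nat => i /andP[_ lt_iu]; rewrite nth_shifted.
Qed.

(** The basis vectors which occur in [partial u] for [u] in [F^n] of weight [w].
    *)
Definition partial_target (n : int) (w : nat) (p : symbol * option int) :
    Prop :=
  exists2 m, m = n \/ m = n + 1 & D_target m w p.

Lemma path_D n u P i : in_Fn n u -> initial u P -> initial u (rcons P i) ->
  i \notin P -> (i < size u)%N -> (nth sym0 u i).2.1 != 0 ->
  let x := D (shifted P u) (shifted (rcons P i) u) in
  spanned (partial_target n (weight u)) x /\
  (forall t, 0 <= n -> (0 < t)%N ->
    evO t x = ev_sym t (shifted P u) - ev_sym t (shifted (rcons P i) u)).
Proof.
move=> Fu iniP inirP iP lt_iu hi x.
have [m [mE F1 F2]] := path_step Fu iniP inirP iP lt_iu hi.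
have ti p : D_target m (weight u) p -> partial_target n (weight u) p.
  by exists m.
have m0 : 0 <= n -> 0 <= m by move: mE; lia.
have [k0 h1] : (0 < (nth sym0 u i).1)%N /\ (nth sym0 u i).2.1 \in [:: 0; 1; -1].
  by case/in_FnP: Fu => /(_ i lt_iu) /and3P[].
have rPE := qshift_shifted lt_iu iP.
have siu P' : (i < size (shifted P' u))%N by rewrite size_shifted.
have hsi P' : (nth sym0 (shifted P' u) i).2.1 != 0 by rewrite nth_shifted.
move: h1 hi; rewrite !inE => /or3P[/eqP->|/eqP h1 _|/eqP h1 _];
  first by rewrite eqxx.
  have xE : x = Dq (shifted P u) i by rewrite /x -rPE h1 D_up.
  rewrite h1 in rPE; rewrite -rPE in F2.
  rewrite xE -rPE; split=> [|t n0 t0]; last exact: (Dq_ev (m0 n0)).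
  by apply: spanned_sub ti _; rewrite -(weight_shifted P u); apply: Dq_spanned.
have PE : shifted P u = qshift i 1 (shifted (rcons P i) u).
  by rewrite -rPE h1 -{1}(opprK 1) qshiftK.
have xE : x = - Dq (shifted (rcons P i) u) i by rewrite /x -rPE h1 D_down.
rewrite PE in F1; rewrite xE; split=> [|t n0 t0].
  apply: spannedN; apply: spanned_sub ti _;
    rewrite -(weight_shifted (rcons P i) u).
  exact: Dq_spanned.
by rewrite evON (Dq_ev (m0 n0)) // opprB PE.
Qed.

(** The differences along the path telescope. *)
Lemma path_sum n u s P : in_Fn n u -> Std_order u = P ++ s ->
  let p := scanl (fun v i => qshift i (nth sym0 v i).2.1 v) (shifted P u) s in
  let x := \sum_(e <- zip (shifted P u :: p) p) D e.1 e.2 in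
  spanned (partial_target n (weight u)) x /\
  (forall t, 0 <= n -> (0 < t)%N -> evO t x =
    ev_sym t (shifted P u) - ev_sym t (shifted (Std_order u) u)).
Proof.
move=> Fu; elim: s P => [|i s IHs] P OE p x.
  rewrite /x big_nil OE cats0; split=> [|t _ _]; first exact: spanned0.
  rewrite subrr; exact: (linear0 (linext (fun p => ev_sym t p.1 * eO t p.2))).
have OE' : Std_order u = rcons P i ++ s by rewrite OE cat_rcons.
have Oi : i \in Std_order u by rewrite OE mem_cat mem_head orbT.
move: (Oi); rewrite mem_Std_order => /andP[lt_iu hi].
have iP : i \notin P.
  have : uniq (Std_order u) by rewrite Std_orderE sort_uniq filter_uniq
    ?iota_uniq.
  by rewrite OE' cat_uniq rcons_uniq => /andP[/andP[]].
have [sp1 ev1] := path_D Fu (prefix_initial OE) (prefix_initial OE') iP lt_iu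
  hi.
have := IHs _ OE'; rewrite -qshift_shifted // in sp1 ev1 *.
rewrite /x /p /= nth_shifted //= big_cons /= => -[sp2 ev2].
split=> [|t n0 t0]; first exact: spannedD.
by rewrite evOD ev1 // ev2 // addrA subrK.
Qed.

Lemma tails_map_z u :
  tails [seq (p.1, (p.2.1, p.2.2 + p.2.1)) | p <- u]
  = [seq (p.1, (p.2.1, p.2.2 + p.2.1)) | p <- tails u].
Proof.
have totE v : tot [seq (p.1, (p.2.1, p.2.2 + p.2.1)) | p <- v]
    = ((tot v).1, (tot v).2 + (tot v).1) :> mono.
  elim: v => [|p v IHv]; first by rewrite /= tot_nil.
  by rewrite /= !tot_cons IHv; congr pair; rewrite /= addrACA.
elim: u => //= p u ->; rewrite totE; congr ((_, _) :: _).
by congr pair; rewrite /= addrACA.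
Qed.

Lemma ev_sym_shifted t u :
  ev_sym t (shifted (Std_order u) u) = ev_sym t.+1 u.
Proof.
have -> : shifted (Std_order u) u = [seq (p.1, (p.2.1, p.2.2 + p.2.1)) | p <-
  u].
  apply: (@eq_from_nth _ sym0); rewrite size_shifted ?size_map // => i lt_iu.
  rewrite nth_shifted // (nth_map sym0) // mem_Std_order lt_iu /=.
  by case: (eqVneq _ 0) => [->|].
rewrite /ev_sym tails_map_z /qtails -map_comp; congr Gsum.
by apply: eq_map => -[k [h e]]; rewrite /texp /=; congr (_, q ^+ _); lia.
Qed.

(** The total difference along the standard path is [u(z) - u(q z)]. *)
Lemma partial_spec n u : in_Fn n u ->
  spanned (partial_target n (weight u)) (partial_sym u) /\
  (forall t, 0 <= n -> (0 < t)%N ->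
    evO t (partial_sym u) = ev_sym t u - ev_sym t.+1 u).
Proof.
move=> Fu; have := path_sum Fu (erefl : Std_order u = [::] ++ _).
rewrite /= shifted_nil => -[sp evE]; split=> // t n0 t0.
by rewrite -ev_sym_shifted -evE.
Qed.

(** * The map phi preserves values *)

Lemma low_linext (K : choiceType) (P : K -> Prop) (f : K -> fps) n x :
  spanned P x -> (forall k, P k -> low n (f k)) -> low n (linext f x).
Proof.
move=> Px fP; rewrite /linext big_seq; apply: low_sum => k /Px Pk.
exact/lowZ/fP.
Qed.

(** A sequence that tends to [0] and has constant increments vanishes. *)
Lemma telescope_eq0 (g : nat -> fps) (c : fps) :
  (forall t, (0 < t)%N -> g t = g t.+1 + c) -> (forall t, low t (g t)) ->
  forall t, (0 < t)%N -> g t = 0.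
Proof.
move=> gS g_low; have c0 : c = 0.
  apply: low_eq0 => n; apply: (@low_le n n.+1) => //.
  have -> : c = g n.+1 - g n.+2 by rewrite (gS n.+1) // addrC addKr.
  apply: lowB (g_low _) _; exact: low_le (leqnSn _) (g_low _).
move=> t t0; apply: low_eq0 => n; have -> : g t = g (n + t)%N.
  by elim: n => // n ->; rewrite (gS (n + t)%N) ?c0 ?addr0 // ltn_addl.
exact: low_le (leq_addr _ _) (g_low _).
Qed.

Definition cst_entry (p : nat * mono) : bool :=
  (p.2.1 == 0) && (0 <= p.2.2 <= p.1%:Z).

(** The symbols of [C_z^n]; the positivity of the [k_i] plays no role. *)
Definition in_Cz (n : int) (w : symbol) : Prop :=
  w = [::] \/
  exists s k e,
    [/\ w = rcons s (k, (1, e)), all cst_entry s & 0 <= e - n <= k%:Z].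

Lemma Cz_tails n w : 0 <= n -> in_Cz n w ->
  all (fun p => (p.2.1 == 1) && (0 <= p.2.2)) (tails w).
Proof.
move=> n0 [->//|[s [k [e [-> + /andP[e0 _]]]]]].
elim: s => [|p s IHs] /=; first by rewrite tot_nil /=; lia.
move=> /andP[/andP[/eqP hp /andP[ep _]] /[dup] sok /IHs ->]; rewrite andbT hp.
suff: (tot (rcons s (k, (1, e)))).1 = 1 /\ 0 <= (tot (rcons s (k, (1, e)))).2.
  by case=> -> e'; rewrite add0r eqxx addr_ge0.
elim: s sok {IHs} => [|p' s IHs] /=; first by rewrite tot_cons tot_nil /=; lia.
case/andP=> /andP[/eqP hp' /andP[ep' _]] /IHs[h' e'].
by rewrite tot_cons /= hp' h' add0r addr_ge0.
Qed.

Lemma qtailsS t s : all (fun p => (p.2.1 == 1) && (0 <= p.2.2)) s ->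
  qtails t.+1 s = qmul (qtails t s).
Proof.
elim: s => //= -[k [h e]] s IHs /andP[/andP[/= /eqP-> e0] /IHs ->].
by congr ((_, _) :: _); rewrite -exprS /texp /=; congr (_ ^+ _); lia.
Qed.

Lemma Cz_low1 n t w : 0 <= n -> (0 < t)%N -> in_Cz n w ->
  forall p, p \in qtails t (tails w) -> low 1 p.2.
Proof.
move=> n0 t0 wC; apply: low1_qtails => //.
by apply: sub_all (Cz_tails n0 wC) => p /=; rewrite /tail_pos => ->.
Qed.

Lemma ev_sym_low t u p : p \in tails u -> p.2.1 = 1 -> 0 <= p.2.2 ->
  low t (ev_sym t u).
Proof.
case: p => [k [h e]] /= pu h1 e0; rewrite {}h1 in pu.
apply: (@Gsum_low t (k, q ^+ texp t (1, e))).
  exact: (map_f (fun p => (p.1, q ^+ texp t p.2)) pu).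
by apply: low_le (low_q _); rewrite /texp /=; lia.
Qed.

Lemma Cz_low n t w : 0 <= n -> in_Cz n w -> w <> [::] -> low t (ev_sym t w).
Proof.
move=> n0 wC; have := Cz_tails n0 wC; case: w {wC} => // p w /andP[/andP[/eqP
  hp ep] _] _.
by apply: (@ev_sym_low _ _ (p.1, p.2 + tot w)) => //; rewrite mem_head.
Qed.

Lemma Smap_None s p : Smap_sym (rcons s p, None) = << rcons s (p.1.+1, p.2) >>.
Proof. by case: s => [|p' s] //=; rewrite last_rcons belast_rcons. Qed.

Lemma Smap_Some s p m : Smap_sym (rcons s p, Some m) =
  - << rcons (rcons s (p.1, (0, p.2.2 + m))) (1%N, (1, - m)) >>.
Proof.
by case: s => [|p' s] //=; rewrite last_rcons belast_rcons -!cats1 -!catA.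
Qed.

Lemma Smap_spanned n m w o : m = n \/ m = n + 1 -> in_Cz m w ->
  o = None \/ o = Some (- m) ->
  spanned (fun w' => in_Cz n w' /\ w' <> [::]) (Smap_sym (w, o)).
Proof.
move=> mE wC oE; case: wC => [->|[s [k [e [-> sok /andP[e0 ek]]]]]];
  case: oE => ->.
- exact: spanned0.
- apply: spannedN; apply: spannedU; split=> //; right; exists [::], 1%N, m;
  split=> //.
    by rewrite opprK.
  by lia.
- rewrite Smap_None; apply: spannedU; split; last by case: s {sok}.
  by right; exists s, k.+1, e; split=> //=; lia.
rewrite Smap_Some; apply: spannedN; apply: spannedU; split;
  last by case: (rcons s _).
right; exists (rcons s (k, (0, e - m))), 1%N, m; split=> //=;
  first by rewrite opprK.
  by rewrite all_rcons sok /cst_entry /= e0 ek.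
by lia.
Qed.

(** [S] inverts the difference [f(z) - f(q z)] on [f e_b], except on [e_0]. *)
Lemma Smap_ev m w o t : 0 <= m -> (0 < t)%N -> in_Cz m w ->
  o = None \/ o = Some (- m) ->
  ev t (Smap_sym (w, o)) - ev t.+1 (Smap_sym (w, o))
  = ev_sym t w * eO t o - ((w == [::]) && (o == None))%:R.
Proof.
move=> m0 t0 wC oE.
have diffE w' s k y : tails w' = s ++ [:: (k.+1, y)] ->
    all (fun p => (p.2.1 == 1) && (0 <= p.2.2)) (tails w') ->
    ev_sym t w' - ev_sym t.+1 w' = Gsum (qtails t s ++ [:: (k, q ^+ texp t y)]).
  move=> w'E pos; rewrite /ev_sym (qtailsS _ pos) w'E qtails_cat /qmul map_cat.
  exact: Gsum_diff.
have Some_case w' : tails w' = tails w ++ [:: (1%N, (1, m))] ->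
    ev_sym t w' - ev_sym t.+1 w' = - (ev_sym t w * eO t (Some (- m))).
  move=> w'E; rewrite (diffE _ _ _ _ w'E); last first.
    by rewrite w'E all_cat (Cz_tails m0 wC) /= m0.
  have -> : texp t (1, m) = absz (t%:Z - - m)%R by rewrite /texp mul1r opprK.
  rewrite /=; set y := q ^+ _.
  have y0 : (0 < absz (t%:Z - - m)%R)%N by lia.
  apply: (mulrI (oneBq_unit y0)); rewrite Gsum_geom_last => [|p].
    by rewrite (mulrN (ev_sym _ _)) (opprK (_ * _)) [RHS]mulrCA [y / _]mulrC
      mulVKr ?oneBq_unit // mulrC.
  rewrite mem_cat inE => /orP[/(Cz_low1 m0 t0 wC)//|/eqP->].
  exact: low_le (low_q _).
have evN v : ev t (- v) - ev t.+1 (- v) = - (ev t v - ev t.+1 v).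
  have NE t' : ev t' (- v) = - ev t' v by exact: (linearN (linext (ev_sym t'))).
  by rewrite !NE opprB opprK addrC.
case: oE => ->; case: (wC) => [wE|[s [k [e [wE sok ek]]]]].
- by rewrite wE /= !ev0 subrr /ev_sym /= Gsum_nil mulr1 subrr.
- rewrite wE Smap_None !evU /=.
have -> : (rcons s (k, (1, e)) == [::]) = false by case: (s).
  rewrite subr0 mulr1.
  have tE k' : tails (rcons s (k', (1, e))) = mulx (1, e) (tails s) ++ [:: (k',
    (1, e))].
    by rewrite -cats1 tails_cat /= tot_cons tot_nil !addr0.
  rewrite (diffE _ _ _ _ (tE _)); last first.
    by have := Cz_tails m0 wC; rewrite wE !tE !all_cat.
  by rewrite /ev_sym tE qtails_cat.
- rewrite andbF subr0; set c := _ * _.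
  have -> : Smap_sym (w, Some (- m)) = - << [:: (1%N, (1, - - m))] >> by
    rewrite wE.
  rewrite evN !evU Some_case; first by rewrite (opprK c).
  by rewrite wE /= opprK tot_nil addr0.
rewrite andbF subr0; set c := _ * _.
rewrite [in LHS]wE Smap_Some evN !evU Some_case; first by rewrite (opprK c).
rewrite wE -!cats1 !tails_cat /= !tot_cons !tot_nil !addr0 !opprK.
rewrite [mulx _ (_ ++ _)]map_cat -/(mulx _ _) mulxD /=.
have -> : ((0, e - m) : mono) + (1, m) = (1, e).
  by exact: (congr2 pair (add0r 1) (subrK m e)).
by [].
Qed.

(** The basis of [QC (x) QC_z^n]. *)
Definition phi_target (n : int) (p : symbol * symbol) : Prop :=
  in_C p.1 /\ in_Cz n p.2.

(** The value of [c (x) w] is the product of those of [c] and [w]; that of [c]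
    does not depend on [z], and is taken at [z = 1]. *)
Definition ev2 (t : nat) : tensor symbol symbol -> fps :=
  linext (fun p => ev_sym 0 p.1 * ev_sym t p.2).

Lemma ev2D t x y : ev2 t (x + y) = ev2 t x + ev2 t y.
Proof. exact: (linearD (linext (fun p => ev_sym 0 p.1 * ev_sym t p.2))). Qed.

Lemma ev2_linext (K : choiceType) t (f : K -> tensor symbol symbol) x :
  ev2 t (linext f x) = linext (fun k => ev2 t (f k)) x.
Proof. exact: linext_comp. Qed.

Lemma ev2_tens t c w : ev2 t (tens << c >> w) = ev_sym 0 c * ev t w.
Proof.
rewrite /ev2 (linext_tens (ev_sym 0) (ev_sym t)); congr (_ * _); exact: linextU.
Qed.

Lemma ev_sym_nil t : ev_sym t [::] = 1.
Proof. exact: Gsum_nil. Qed.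

Lemma z_indep_tails u : z_indep u ->
  all (fun p => p.2.1 == 0) (tails u) /\ (tot u).1 = 0.
Proof.
elim: u => [|p u IHu] /=; first by rewrite tot_nil.
by case/andP=> /eqP hp /IHu[-> h0]; rewrite tot_cons /= hp h0 addr0 eqxx.
Qed.

Lemma ev_sym_indep t u : z_indep u -> ev_sym t u = ev_sym 0 u.
Proof.
case/z_indep_tails=> /allP u0 _; rewrite /ev_sym; congr Gsum.
by apply/eq_in_map => p /u0 /eqP hp; rewrite /texp hp !mul0r.
Qed.

Lemma Const_spec n u : 
  spanned (phi_target n) (Const_sym u) /\
  forall t, ev2 t (Const_sym u) = if in_C u then ev_sym t u else 0.
Proof.
rewrite /Const_sym; case: ifP => [uC|_]; last first.
  split=> [|t]; first exact: spanned0.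
  exact: (linear0 (linext (fun p => ev_sym 0 p.1 * ev_sym t p.2))).
split=> [|t]; last first.
  have /andP[_ ui] := uC.
  by rewrite ev2_tens evU ev_sym_nil mulr1 (ev_sym_indep t ui).
apply: (@spanned_tens _ _ (fun u => in_C u) (fun w => w = [::])).
- by move=> v w vC ->; split=> //; left.
- exact: spannedU.
- exact: spannedU.
Qed.

(** The image of [p (x) e] under [id (x) S], for the basis vector [e] of index
    [o]. *)
Definition ext_sym (p : symbol * symbol) (o : option int) :
    tensor symbol symbol :=
  tens << p.1 >> (Smap_sym (p.2, o)).

Lemma ev2_ext t p o :
  ev2 t (ext_sym p o) = ev_sym 0 p.1 * ev t (Smap_sym (p.2, o)).
Proof. exact: ev2_tens. Qed.

Lemma tensU (A B : choiceType) (x : {malg rat[A]}) (b : B) :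
  tens x << b >> = linext (fun a => << (a, b) >>) x.
Proof. by apply: eq_linext => a; exact: linextU. Qed.

Lemma ext_tens x o :
  tmap id Smap (tensA (tens x << o >>)) = linext (fun cw => ext_sym cw o) x.
Proof.
rewrite tensU.
have -> : tensA (linext (fun a : symbol * symbol => << (a, o) >>) x)
    = linext (fun a => << (a.1, (a.2, o)) >>) x.
  apply: etrans (linext_comp _ _ x) _; apply: eq_linext => a.
  exact: linextU.
apply: etrans (linext_comp _ _ x) _; apply: eq_linext => -[c w].
apply: etrans (linextU _ _) _.
exact: (congr1 (tens << c >>) (linextU Smap_sym (w, o))).
Qed.

Lemma phi_stepE f u : phi_step f u =
  linext (fun p => linext (fun cw => ext_sym cw p.2) (f p.1)) (partial_sym u)
  + Const_sym u.
Proof.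
rewrite /phi_step; congr (_ + _).
have -> : partial << u >> = partial_sym u by exact: linextU.
have -> : tmap (linext f) id (partial_sym u)
    = linext (fun p => tens (f p.1) << p.2 >>) (partial_sym u).
  rewrite /tmap; apply: eq_linext => p.
  exact: (congr1 (fun y => tens y << p.2 >>) (linextU f p.1)).
pose h : tensor (symbol * symbol)%type (option int) -> tensor symbol symbol :=
  tmap id Smap \o tensA.
have hE (K : choiceType) (g : K -> tensor (symbol * symbol)%type (option int))
  x :
    h (linext g x) = linext (fun k => h (g k)) x.
  by rewrite /h /=; apply: etrans (congr1 _ (linext_comp _ _ x)) (linext_comp _
    _ x).
apply: etrans (hE _ _ _) _; apply: eq_linext => p.
exact: ext_tens.
Qed.

Lemma ev_sym_low_z n t u : 0 <= n -> in_Fn n u -> ~~ z_indep u ->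
  low t (ev_sym t u).
Proof.
move=> n0 Fu; apply: contraNT => nlow.
have : all (fun p => p.2.1 == 0) (tails u).
  apply/allP => p pu; have /allP/(_ p pu) := tails_pos n0 Fu.
  case/orP=> /andP[// /eqP h1 e0].
  by rewrite (ev_sym_low t pu) in nlow.
elim: u {Fu nlow} => //= p u IHu /andP[/eqP hp uz]; rewrite IHu // andbT.
suff h0 : (tot u).1 = 0 by rewrite h0 addr0 in hp; apply/eqP.
by case: u uz {IHu hp} => [|p' u] /=; [rewrite tot_nil | rewrite tot_cons =>
  /andP[/eqP]].
Qed.

(** The map [phi] preserves values: both sides satisfy the same first order
    difference equation in [z], and the same initial condition at [z = 0]. *)
Lemma phi_rec_spec w n u : 0 <= n -> in_Fn n u -> weight u = w ->
  spanned (phi_target n) (phi_rec w u) /\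
  forall t, (0 < t)%N -> ev2 t (phi_rec w u) = ev_sym t u.
Proof.
elim: w n u => [|w IHw] n u n0 Fu wu.
  have uE : u = [::].
    case: u Fu wu => // p u /in_FnP[/(_ 0%N isT)/and3P[k0 _ _] _].
    by rewrite /weight big_cons => /eqP; rewrite addn_eq0 eqn0Ngt k0.
  have [sp evE] := Const_spec n u; split=> // t t0; rewrite /= evE.
  suff -> : in_C u by [].
  by rewrite uE /in_C andbT; apply/asboolP; exists n; rewrite -uE.
have [spX evX] := partial_spec Fu; rewrite wu in spX.
have [spC evC] := Const_spec n u.
rewrite [phi_rec _ _]phi_stepE.
set X := partial_sym u in spX evX *; set f := phi_rec w in IHw *.
set A := linext _ X.
have IH p : partial_target n w.+1 p -> exists m, [/\ m = n \/ m = n + 1, 0 <= m,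
    p.2 = None \/ p.2 = Some (- m), spanned (phi_target m) (f p.1)
    & forall t, (0 < t)%N -> ev2 t (f p.1) = ev_sym t p.1].
  case=> m mE [Fp [wp] oE]; have m0 : 0 <= m by move: mE; lia.
  by have [? ?] := IHw m p.1 m0 Fp wp; exists m.
have spA : spanned (fun p => phi_target n p /\ p.2 <> [::]) A.
  apply: (spanned_linext spX) => p /IH[m [mE m0 oE spf _]].
  apply: (spanned_linext spf) => cw [cC wC].
  apply: (@spanned_tens _ _ (fun c => in_C c) (fun w => in_Cz n w /\ w <>
    [::])).
  - by move=> a b aC [bC b0]; split.
  - exact: spannedU.
  - exact: Smap_spanned mE wC oE.
split=> [|t t0].
  apply: spannedD => //; apply: (spanned_sub _ spA) => p [] //.
rewrite ev2D evC.
(* The value of the coefficient of [1 (x) e_0], on which [S] vanishes. *)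
pose c := linext (fun p => linext (fun cw : symbol * symbol => ev_sym 0 cw.1 *
  ((cw.2 == [::]) && (p.2 == None))%:R) (f p.1)) X : fps.
have AE s : (0 < s)%N -> ev2 s A - ev2 s.+1 A = ev_sym s u - ev_sym s.+1 u - c.
  move=> s0; rewrite -evX // /A !ev2_linext -linextN -linextD.
  rewrite /evO /c -linextN -linextD; apply: (eq_linext_spanned spX).
  move=> p /IH[m [mE m0 oE spf evf]].
  rewrite !ev2_linext -linextN -linextD -evf // [ev2 s (f _)]/ev2 -linextMr
    -linextN -linextD.
  apply: (eq_linext_spanned spf) => cw [cC wC].
  by rewrite 2!ev2_ext -mulrBr (Smap_ev m0 s0 wC oE) mulrBr mulrA.
pose c0 := if in_C u then ev_sym 0 u else 0.
have c0E s : (if in_C u then ev_sym s u else 0) = c0.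
  by rewrite /c0; case: ifP => // /andP[_ /(ev_sym_indep s)].
pose g s := ev_sym s u - c0 - ev2 s A.
suff /eqP : g t = 0.
  by rewrite c0E /g subr_eq0 subr_eq => /eqP.
apply: (@telescope_eq0 g c) => // s => [s0|].
  apply/eqP; rewrite -subr_eq0 /g; have /eqP := AE s s0;
    rewrite -subr_eq0 => /eqP AE0.
  by apply/eqP; rewrite -[RHS]oppr0 -AE0; ring.
apply: lowB; last first.
  apply: (low_linext spA) => p [[pC pw] p0].
  by apply: lowMr; apply: Cz_low n0 pw p0.
rewrite -(c0E s); case: ifPn => [_|uC]; first by rewrite subrr low0.
rewrite subr0; apply: (ev_sym_low_z _ n0 Fu); apply: contra uC => ui.
by rewrite /in_C ui andbT; apply/asboolP; exists n.
Qed.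

(** * Truncated multiple sums of words *)

(** For [ts = [:: t_1; ...; t_n]], the sum over [m_1 < ... < m_d] of the
    products of the [t_(m_i) ^+ k_i], where [w = [:: k_1; ...; k_d]]. *)
Fixpoint Zw (ts : seq fps) (w : seq nat) {struct ts} : fps :=
  match w with
  | [::] => 1
  | k :: w' =>
      if ts is t :: ts' then Zw ts' w + t ^+ k * Zw ts' w' else 0
  end.

(** The linear extension of the truncated sums to all elements of [QB]. *)
Definition Zlin (ts : seq fps) : QB -> fps :=
  linext (fun w : {fmonom nat} => Zw ts w).

Lemma Zw_nil ts : Zw ts [::] = 1. Proof. by case: ts. Qed.

Lemma Zlin_word ts (w : {fmonom nat}) : Zlin ts << w >> = Zw ts w.
Proof. exact: linextU. Qed.

Lemma ZlinD ts x y : Zlin ts (x + y) = Zlin ts x + Zlin ts y.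
Proof. exact: (linearD (linext (fun w : {fmonom nat} => Zw ts w))). Qed.

Lemma b_word i (w : seq nat) : b_ i * << FMonom w >> = << FMonom (i :: w) >>.
Proof.
rewrite /b_ malgM_def fgmulUU mulr1 fmuE; congr mkmalgU.
exact: (fmmulE (FMonom [:: i]) (FMonom w)).
Qed.

Lemma b_linext i x :
  b_ i * x = linext (fun w : {fmonom nat} => << FMonom (i :: w) >>) x.
Proof.
have xE : x = linext (fun w : {fmonom nat} => << w >>) x.
  exact: (linext_unique (@idfun QB) x).
rewrite {1}xE; apply: etrans (esym (linextMl _ _ x)) _;
  apply: eq_linext => -[w].
exact: b_word.
Qed.

Lemma Zlin_b ts i x :
  Zlin ts (b_ i * x) = linext (fun w : {fmonom nat} => Zw ts (i :: w)) x.
Proof.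
rewrite b_linext /Zlin; apply: etrans (linext_comp _ _ x) _.
by apply: eq_linext => w; exact: linextU.
Qed.

Lemma Zlin_nil_b i x : Zlin [::] (b_ i * x) = 0.
Proof. by rewrite Zlin_b /linext big1 // => w _; rewrite scaler0. Qed.

Lemma Zlin_cons_b t ts i x :
  Zlin (t :: ts) (b_ i * x) = Zlin ts (b_ i * x) + t ^+ i * Zlin ts x.
Proof. by rewrite !Zlin_b /Zlin -linextMl -linextD. Qed.

Lemma Zlin_stuffle_word ts i u j v :
  Zlin ts (stuffle_word (i :: u) (j :: v)) =
    Zlin ts (b_ i * stuffle_word u (j :: v))
    + Zlin ts (b_ j * stuffle_word (i :: u) v)
    + Zlin ts (b_ (i + j) * stuffle_word u v).
Proof.
rewrite stuffle_word_cons; apply: etrans (ZlinD _ _ _) _.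
by congr (_ + _); exact: ZlinD.
Qed.

Lemma Zw_stuffle ts u v : Zlin ts (stuffle_word u v) = Zw ts u * Zw ts v.
Proof.
elim: ts u v => [|t ts IHts] u v.
  case: u v => [|i u] [|j v];
    rewrite ?stuffle_word0l ?stuffle_word0r ?Zlin_word ?mul1r ?mulr1 //.
  rewrite Zlin_stuffle_word mul0r.
  have -> : 0 = 0 + 0 + 0 :> fps by rewrite !addr0.
  by congr (_ + _ + _); exact: Zlin_nil_b.
case: u v => [|i u] [|j v];
  rewrite ?stuffle_word0l ?stuffle_word0r ?Zlin_word ?mul1r ?mulr1 //.
have xyz := IHts (i :: u) (j :: v); rewrite Zlin_stuffle_word in xyz.
have expand (x y z a b a' b' : fps) : x + y + z = a * b ->
    x + t ^+ i * (a' * b) + (y + t ^+ j * (a * b')) + (z + t ^+ (i + j) * (a' *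
      b'))
    = (a + t ^+ i * a') * (b + t ^+ j * b').
  by move=> /eqP; rewrite -subr_eq0 exprD => /eqP xyz0; apply/eqP;
     rewrite -subr_eq0 -[X in _ == X]xyz0; apply/eqP; ring.
apply: etrans (Zlin_stuffle_word _ _ _ _ _) _;
  apply: etrans (expand _ _ _ _ _ _ _ xyz).
by congr (_ + _ + _); apply: etrans (Zlin_cons_b _ _ _ _) _; rewrite IHts.
Qed.

Lemma Zlin_stuffle ts x y : Zlin ts (stuffle x y) = Zlin ts x * Zlin ts y.
Proof.
rewrite /stuffle /Zlin; apply: etrans (linext_comp _ _ x) _.
rewrite -linextMr; apply: eq_linext => u.
apply: etrans (linext_comp _ _ y) _; rewrite -linextMl; apply: eq_linext => v.
exact: Zw_stuffle.
Qed.

(** The factors [t ^+ 0] contribute [1] each. *)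
Lemma Zlin_b0 ts : Zlin ts (b_ 0) = (size ts)%:R.
Proof.
rewrite /b_ fmuE Zlin_word; elim: ts => [|t ts IHts] //=.
by rewrite IHts Zw_nil expr0 mulr1 -natr1.
Qed.

Lemma Zlin_exp_b0 ts j : Zlin ts (stuffle_exp (b_ 0) j) = (size ts)%:R ^+ j.
Proof.
elim: j => [|j IHj]; last by rewrite /= Zlin_stuffle IHj Zlin_b0 exprS.
by rewrite /= (_ : 1 = << FMonom [::] >> :> QB) ?Zlin_word ?Zw_nil // -fmoneE.
Qed.

(** The values [q ^+ m / (1 - q ^+ m)] for [a < m <= a + r]. *)
Definition tvals (a r : nat) : seq fps :=
  [seq q ^+ m / (1 - q ^+ m) | m <- iota a.+1 r].

Lemma tvalsS a r : tvals a r.+1 = q ^+ a.+1 / (1 - q ^+ a.+1) :: tvals a.+1 r.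
Proof. by []. Qed.

Lemma Zw_tvals_cons a r k w : Zw (tvals a r) (k :: w) =
  \sum_(a.+1 <= m < (a + r).+1)
     (q ^+ m / (1 - q ^+ m)) ^+ k * Zw (tvals m (a + r - m)) w.
Proof.
elim: r a => [|r IHr] a; first by rewrite addn0 big_geq.
rewrite tvalsS /= IHr [RHS]big_ltn ?addnS ?ltnS ?leq_addr // addrC.
by congr (_ * Zw (tvals _ _) _ + _); rewrite ?addSn //; lia.
Qed.

(** The recursive and the explicit description of truncated sums agree. *)
Lemma Zw_tuples (w : seq nat) N a : (a <= N)%N ->
  \sum_(m : (size w).-tuple 'I_N.+1 | path ltn a (map val m))
    \prod_(j < size w) (q ^+ tnth m j / (1 - q ^+ tnth m j)) ^+ nth 0%N w j
  = Zw (tvals a (N - a)) w.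
Proof.
elim: w a => [|k w IHw] a le_aN.
  rewrite Zw_nil (big_pred1 [tuple]); first by rewrite big_ord0.
  by move=> m; rewrite (tuple0 m); apply/esym/eqxx.
rewrite Zw_tvals_cons subnKC // big_geq_mkord /=.
rewrite (reindex (fun p : 'I_N.+1 * (size w).-tuple 'I_N.+1 =>
  cons_tuple p.1 p.2)) /=; last first.
  exists (fun m => (thead m, behead_tuple m)) => [[x m] _|m _] /=.
    by congr pair; apply: val_inj.
  by rewrite [RHS]tuple_eta; apply: val_inj.
rewrite -(pair_big_dep (fun x : 'I_N.+1 => (a < x)%N)
  (fun x (m : (size w).-tuple _) => path ltn x (map val m)) (fun x m =>
  \prod_(j < (size w).+1) (q ^+ tnth (cons_tuple x m) j
     / (1 - q ^+ tnth (cons_tuple x m) j)) ^+ nth 0%N (k :: w) j)) /=.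
apply: eq_bigr => x ax; rewrite -IHw; last by rewrite -ltnS.
rewrite big_distrr /=; apply: eq_bigr => m _; rewrite big_ord_recl /= tnth0.
by congr (_ * _); apply: eq_bigr => j _; rewrite tnthS.
Qed.

Lemma ZSZ_partialE (w : seq nat) N : ZSZ_partial w N = Zw (tvals 0 N) w.
Proof. by rewrite -[in RHS](subn0 N); exact: Zw_tuples. Qed.

(** The truncation at [m_d <= N] affects only powers of [q] larger than [N], for
    an admissible word. *)
Lemma ZSZ_word_low (w : word0) N :
  low N.+1 (Zw (tvals 0 N) (val w) - ZSZ_word w).
Proof.
apply/low_coefP => i; rewrite ltnS => le_iN.
rewrite fcoefB ZSZ_wordE -ZSZ_partialE ZSZ_partial_stable ?subrr //.
exact: (valP w).
Qed.

(** * The stuffle algebra and regularization *)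

Lemma stuffle_wordC u v : stuffle_word u v = stuffle_word v u.
Proof.
have [n] := ubnP (size u + size v).
elim: n u v => [//|n IHn] u v; case: u v => [|i u] v.
  by rewrite stuffle_word0l stuffle_word0r.
case: v => [|j v]; first by rewrite stuffle_word0l stuffle_word0r.
move=> le; rewrite /= addnS !ltnS in le; rewrite (stuffle_word_cons i)
  (stuffle_word_cons j).
rewrite (addnC j i) (IHn u (j :: v)); last by rewrite /= addnS.
rewrite (IHn (i :: u) v); last exact: le.
rewrite (IHn u v); last exact: ltnW.
have swap (a b c : QB) : a + b + c = b + a + c by rewrite (addrC a).
exact: swap.
Qed.

Lemma stuffleUl u x :
  stuffle << FMonom u >> x = linext (fun v : {fmonom nat} => stuffle_word u v)
    x.
Proof. exact: linextU. Qed.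

Lemma stuffleUr x (v : seq nat) :
  stuffle x << FMonom v >> = linext (fun u : {fmonom nat} => stuffle_word u v)
    x.
Proof. by apply: eq_linext => u; exact: linextU. Qed.

Lemma stuffle_wordsC u x : stuffle << FMonom u >> x = stuffle x << FMonom u >>.
Proof.
by rewrite stuffleUl stuffleUr; apply: eq_linext => v; exact: stuffle_wordC.
Qed.

Lemma stuffle_words u v :
  stuffle << FMonom u >> << FMonom v >> = stuffle_word u v.
Proof. exact: etrans (stuffleUl _ _) (linextU _ _). Qed.

Lemma stuffle_nilr x : stuffle x << FMonom [::] >> = x.
Proof.
rewrite stuffleUr; apply: esym.
apply: etrans (linext_unique (@idfun QB) _) _; apply: eq_linext => -[u].
by rewrite stuffle_word0r.
Qed.

Lemma stuffle_consl i x k (w : seq nat) :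
  stuffle (b_ i * x) << FMonom (k :: w) >> =
    b_ i * stuffle x << FMonom (k :: w) >> + b_ k * stuffle (b_ i * x) <<
      FMonom w >>
    + b_ (i + k) * stuffle x << FMonom w >>.
Proof.
have bE v : stuffle (b_ i * x) << FMonom v >>
    = linext (fun u : {fmonom nat} => stuffle_word (i :: u) v) x.
  rewrite stuffleUr b_linext; apply: etrans (linext_comp _ _ x) _.
  by apply: eq_linext => u; exact: linextU.
rewrite !bE !stuffleUr -!linextMl -!linextD; apply: eq_linext => u.
exact: stuffle_word_cons.
Qed.

Lemma stuffleDl x y z : stuffle (x + y) z = stuffle x z + stuffle y z.
Proof.
exact: (linearD (linext (fun u : {fmonom nat} =>
  linext (fun v : {fmonom nat} => stuffle_word u v) z))).
Qed.

Lemma stuffle_consl3 i j l x y z k (w : seq nat) :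
  stuffle (b_ i * x + b_ j * y + b_ l * z) << FMonom (k :: w) >> =
    b_ i * stuffle x << FMonom (k :: w) >> + b_ j * stuffle y << FMonom (k ::
      w) >>
    + b_ l * stuffle z << FMonom (k :: w) >>
    + b_ k * stuffle (b_ i * x + b_ j * y + b_ l * z) << FMonom w >>
    + b_ (i + k) * stuffle x << FMonom w >> + b_ (j + k) * stuffle y << FMonom
      w >>
    + b_ (l + k) * stuffle z << FMonom w >>.
Proof.
have D3 (x' y' z' c : QB) :
    stuffle (x' + y' + z') c = stuffle x' c + stuffle y' c + stuffle z' c.
  by apply: etrans (stuffleDl _ _ _) _; congr (_ + _); exact: stuffleDl.
apply: etrans (D3 _ _ _ _) _.
apply: etrans (congr2 +%R (congr2 +%R (stuffle_consl _ _ _ _)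
  (stuffle_consl _ _ _ _)) (stuffle_consl _ _ _ _)) _.
have sum9 (a1 b1 c1 a2 b2 c2 a3 b3 c3 b : QB) : b1 + b2 + b3 = b ->
    a1 + b1 + c1 + (a2 + b2 + c2) + (a3 + b3 + c3)
    = a1 + a2 + a3 + b + c1 + c2 + c3.
  by move=> <-; rewrite (AC (3*3*3) (1*4*7*(2*5*8)*3*6*9)).
have mulD3 (p x' y' z' : QB) : p * x' + p * y' + p * z' = p * (x' + y' + z').
  by rewrite !mulrDr.
apply: sum9; apply: etrans (mulD3 _ _ _ _) _.
exact: (congr1 (fun y' => b_ k * y') (esym (D3 _ _ _ _))).
Qed.

(** [u * v * w], bracketed to the left. *)
Definition stuffle3 (u v w : seq nat) : QB :=
  stuffle (stuffle_word u v) << FMonom w >>.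

Lemma stuffle3_cons i j k u v w :
  stuffle3 (i :: u) (j :: v) (k :: w) =
    b_ i * stuffle3 u (j :: v) (k :: w) + b_ j * stuffle3 (i :: u) v (k :: w)
    + b_ (i + j) * stuffle3 u v (k :: w) + b_ k * stuffle3 (i :: u) (j :: v) w
    + b_ (i + k) * stuffle3 u (j :: v) w + b_ (j + k) * stuffle3 (i :: u) v w
    + b_ (i + j + k) * stuffle3 u v w.
Proof. exact: stuffle_consl3. Qed.

(** Together with commutativity, this is associativity. *)
Lemma stuffle3_cyc u v w : stuffle3 u v w = stuffle3 v w u.
Proof.
have [n] := ubnP (size u + size v + size w).
elim: n u v w => [|n IHn] u v w le; first exact: (False_ind _ (notF le)).
case: u le => [|i u] le.
  rewrite /stuffle3 stuffle_word0l stuffle_words.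
  exact: esym (stuffle_nilr _).
case: v le => [|j v] le.
  by rewrite /stuffle3 stuffle_word0r stuffle_word0l; exact: stuffle_wordsC.
case: w le => [|k w] le.
  apply: etrans (stuffle_nilr _) _; rewrite stuffle_wordC /stuffle3
    stuffle_word0r.
  exact: esym (stuffle_words _ _).
rewrite /= !addSn !addnS !ltnS in le.
have sum7 (a b c d e f g a' b' c' d' e' f' g' : QB) :
    a = a' -> b = b' -> c = c' -> d = d' -> e = e' -> f = f' -> g = g' ->
    a + b + c + d + e + f + g = b' + d' + f' + a' + c' + e' + g'.
  by do 7!move=> <-; rewrite (AC 7 (2*4*6*1*3*5*7)).
have step l u' v' w' : (size u' + size v' + size w' < n)%N ->
    b_ l * stuffle3 u' v' w' = b_ l * stuffle3 v' w' u'.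
  by move=> lt; rewrite (IHn u' v' w' lt).
apply: etrans (stuffle3_cons _ _ _ _ _ _) _.
apply: etrans (esym (stuffle3_cons _ _ _ _ _ _)).
rewrite (addnC j i) (addnC k i) (addnC (j + k)%N i) addnA.
by apply: sum7; apply: step => /=; lia.
Qed.

Lemma stuffle_b0E x :
  stuffle (b_ 0) x = linext (fun w : {fmonom nat} => stuffle_word [:: 0%N] w) x.
Proof. by rewrite /b_ fmuE; exact: stuffleUl. Qed.

(** Stuffling by [b_0] commutes with stuffling by any other element. *)
Lemma stuffle_b0 x y :
  stuffle (b_ 0) (stuffle x y) = stuffle x (stuffle (b_ 0) y).
Proof.
apply: etrans (stuffle_b0E _) _; apply: etrans (linext_comp _ _ x) _;
  apply: eq_linext => u.
apply: etrans (linext_comp _ _ y) _.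
apply: etrans (esym (congr1 (linext (fun v : {fmonom nat} => stuffle_word u v))
  (stuffle_b0E y))).
apply: etrans (esym (linext_comp _ _ y)); apply: eq_linext => v.
apply: etrans (esym (stuffleUl _ _)) _; apply: etrans (stuffle_wordsC _ _) _.
apply: etrans (stuffleUl _ _); apply: etrans (esym (stuffle_wordsC _ _)).
by rewrite stuffle_wordC; exact: (esym (stuffle3_cyc [:: 0%N] v u)).
Qed.

(** The elements [u_0 + u_1 * b_0 + ... + u_(n-1) * b_0^(n-1)], with all [u_j]
    combinations of admissible words. *)
Definition reg_span (n : nat) (x : QB) : Prop :=
  exists c : nat -> QB0,
    x = \sum_(j < n) stuffle (incl (c j)) (stuffle_exp (b_ 0) j).

Lemma stuffle0l y : stuffle 0 y = 0.
Proof. exact: linear0 (linext _). Qed.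

Lemma reg_span0 n : reg_span n 0.
Proof.
exists (fun=> 0); rewrite big1 // => j _.
by rewrite /incl linear0 stuffle0l.
Qed.

Lemma reg_spanD n x y : reg_span n x -> reg_span n y -> reg_span n (x + y).
Proof.
move=> [c ->] [c' ->]; exists (fun j => c j + c' j); rewrite -big_split /=.
apply: eq_bigr => j _; rewrite -stuffleDl; congr (stuffle _ _).
exact: (esym (linearD (linext _) _ _)).
Qed.

Lemma reg_spanZ n a x : reg_span n x -> reg_span n (a *: x).
Proof.
move=> [c ->]; exists (fun j => a *: c j); rewrite scaler_sumr.
apply: eq_bigr => j _; apply: etrans (esym (linearZ_LR (linext _) _ _)) _.
congr (stuffle _ _); exact: (esym (linearZ_LR (linext _) _ _)).
Qed.

Lemma reg_spanS n x : reg_span n x -> reg_span n.+1 x.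
Proof.
move=> [c ->]; exists (fun j => if (j < n)%N then c j else 0).
rewrite big_ord_recr /= ltnn /incl linear0 stuffle0l addr0.
by apply: eq_bigr => j _; rewrite ltn_ord.
Qed.

Lemma reg_span_b0 n x : reg_span n x -> reg_span n.+1 (stuffle (b_ 0) x).
Proof.
move=> [c ->]; exists (fun j => if j is j'.+1 then c j' else 0).
rewrite big_ord_recl /= /incl linear0 stuffle0l add0r.
rewrite stuffle_b0E; apply: etrans (linear_sum (linext _) _ _ _) _.
apply: eq_bigr => j _; apply: etrans (esym (stuffle_b0E _)) _.
exact: stuffle_b0.
Qed.

Lemma spanned_reg_span (P : {fmonom nat} -> Prop) n x :
  spanned P x -> (forall w, P w -> reg_span n << w >>) -> reg_span n x.
Proof.
move=> Px Pr; rewrite [x](linext_unique (@idfun QB)) /linext big_seq.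
apply: big_ind => [||w /Px /Pr]; [exact: reg_span0|exact: reg_spanD|exact:
  reg_spanZ].
Qed.

(** [x] is a word [w b_0^k] with [w] admissible, and nonempty if [w'] is. *)
Definition pads (w' : seq nat) (k : nat) (x : {fmonom nat}) : Prop :=
  exists w, [/\ x = FMonom (w ++ nseq k 0%N), last 1%N w != 0%N
              & w' <> [::] -> w <> [::]].

(** The product of [b_0] and of a word with exactly [k] final letters [b_0] has
    a multiple of one word with [k.+1] final letters [b_0]; all other words have
    [k] of them. *)
Lemma insert_b0 (w : seq nat) k : last 1%N w != 0%N -> exists2 y,
  stuffle_word [:: 0%N] (w ++ nseq k 0%N) =
    k.+1%:R *: << FMonom (w ++ nseq k.+1 0%N) >> + y
  & spanned (pads w k) y.
Proof.
have insS j v : stuffle_word [:: 0%N] (j :: v) =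
    << FMonom [:: 0%N, j & v] >> + b_ j * stuffle_word [:: 0%N] v + << FMonom
      (j :: v) >>.
  by rewrite stuffle_word_cons !stuffle_word0l !b_word.
have bZ1 j (c : rat) (x : QB) : b_ j * (c *: x) = c *: (b_ j * x).
  exact: esym (scaler_ratAr _ _ _).
have bZ j (c : rat) (v : seq nat) y : b_ j * (c *: << FMonom v >> + y)
    = c *: << FMonom (j :: v) >> + b_ j * y.
  apply: etrans (mulrDr _ _ _) _; apply: (congr1 (fun z => z + _)).
  by apply: etrans (bZ1 _ _ _) _; rewrite b_word.
have collect (x y : QB) (a b : nat) :
    x + (a%:R *: x + b%:R *: y) + y = a.+1%:R *: x + b.+1%:R *: y.
  by rewrite -!natr1 !scalerDl !scale1r (AC (1*2*1) (2*1*(3*4))).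
have zeros : stuffle_word [:: 0%N] (nseq k 0%N) =
    k.+1%:R *: << FMonom (nseq k.+1 0%N) >> + k%:R *: << FMonom (nseq k 0%N) >>.
  elim: k => [|k IHk]; first by rewrite stuffle_word0r scale1r scale0r addr0.
  rewrite -[nseq k.+1 0%N]/(0%N :: nseq k 0%N) insS IHk bZ.
  apply: etrans (congr1 (fun z => _ + (_ + z) + _) (bZ1 _ _ _)) _;
    rewrite b_word.
  exact: collect.
have first_word (x y z v : QB) (a : rat) :
    x + (a *: y + z) + v = a *: y + (x + z + v).
  by rewrite (AC (1*2*1) (2*(1*3*4))).
elim: w => [_|j w IHw jw].
  exists (k%:R *: << FMonom (nseq k 0%N) >>) => //.
  by apply: spannedZ; apply: spannedU; exists [::].
have [wE|w0] := eqVneq w [::].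
  rewrite {}wE {IHw} in jw *; rewrite !cat_cons !cat0s insS zeros bZ.
  exists (<< FMonom [:: 0%N, j & nseq k 0%N] >>
    + b_ j * (k%:R *: << FMonom (nseq k 0%N) >>) + << FMonom (j :: nseq k 0%N)
      >>).
    exact: first_word.
  apply: spannedD; first apply: spannedD.
  - by apply: spannedU; exists [:: 0%N; j].
  - by rewrite (bZ1 j) b_word; apply: spannedZ; apply: spannedU; exists [:: j].
  - by apply: spannedU; exists [:: j].
have ww : last 1%N w != 0%N by case: (w) w0 jw.
have [y yE spy] := IHw ww.
exists (<< FMonom [:: 0%N, j & w ++ nseq k 0%N] >> + b_ j * y
    + << FMonom (j :: w ++ nseq k 0%N) >>).
  rewrite cat_cons insS yE bZ; exact: first_word.
apply: spannedD; first apply: spannedD.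
- by apply: spannedU; exists [:: 0%N, j & w].
- rewrite b_linext; apply: (spanned_linext spy) => x [v [-> vv v0]].
  apply: spannedU; exists (j :: v); split=> //=.
  by case: (v) (v0 (elimN eqP w0)) vv.
- by apply: spannedU; exists (j :: w).
Qed.

Lemma word_pads (w : seq nat) : exists w' k,
  w = w' ++ nseq k 0%N /\ last 1%N w' != 0%N.
Proof.
elim/last_ind: w => [|w i [w' [k [-> w'0]]]]; first by exists [::], 0%N.
have [->|i0] := eqVneq i 0%N; last first.
  by exists (rcons (w' ++ nseq k 0%N) i), 0%N; rewrite cats0 last_rcons.
by exists w', k.+1; rewrite -cats1 -catA -[[:: 0%N]]/(nseq 1 0%N) -nseqD addn1.
Qed.

(** By the preceding lemma, the number of final letters [b_0] can be lowered. *)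
Lemma reg_span_pads k (w : seq nat) : last 1%N w != 0%N ->
  reg_span k.+1 << FMonom (w ++ nseq k 0%N) >>.
Proof.
elim: k w => [|k IHk] w w0.
  have wa : admissible (FMonom w) by [].
  exists (fun=> << Sub (FMonom w) wa >>); rewrite big_ord1 cats0.
  have -> : incl << Sub (FMonom w) wa >> = << FMonom w >> by exact: linextU.
  by rewrite (_ : stuffle_exp _ _ = << FMonom [::] >>) ?stuffle_nilr //=
    -fmoneE.
have [y yE spy] := insert_b0 k w0.
have y_span : reg_span k.+2 y.
  apply: (spanned_reg_span spy) => x [v [-> v0 _]].
  by apply: reg_spanS; apply: IHk.
have w_span := reg_span_b0 (IHk w w0).
have k0 : k.+1%:R != 0 :> rat by rewrite pnatr_eq0.
have -> : << FMonom (w ++ nseq k.+1 0%N) >> = k.+1%:R^-1 *: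
    (stuffle (b_ 0) << FMonom (w ++ nseq k 0%N) >> + (-1) *: y) :> QB.
  rewrite /b_ fmuE stuffle_words yE scaleN1r addrK scalerA mulVf ?scale1r //.
by apply: reg_spanZ; apply: reg_spanD => //; apply: reg_spanZ.
Qed.

(** Every word has a regularization. *)
Lemma reg_exists (w : {fmonom nat}) : is_reg << w >> (reg << w >>).
Proof.
rewrite /reg; apply: xgetPex; case: w => w.
have [w' [k [-> w'0]]] := word_pads w.
have [c cE] := reg_span_pads k w'0.
exists (c 0%N), (mkseq c k.+1); rewrite size_mkseq; split; last by [].
rewrite cE; apply: eq_bigr => j _; congr (stuffle (incl _) _).
by rewrite (nth_mkseq 0 c (ltn_ord j)).
Qed.

(** * Truncated sums of symbols and words *)

Lemma Zlin_nil_word ts : Zlin ts 1 = 1.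
Proof. by apply: etrans (linextU _ _) _; rewrite fm1 Zw_nil. Qed.

Lemma Fsum_consE ts p kn : Zlin ts (Fsum (p :: kn)) =
  \sum_(s < (p.1 - p.2).+1) 'C(p.1 - p.2, s)%:R *: Zlin ts (b_ (p.1 - s) * Fsum
    kn).
Proof.
rewrite /Fsum big_cons mulr_suml; apply: etrans (linear_sum (linext _) _ _ _) _.
apply: eq_bigr => s _.
apply: etrans (congr1 (Zlin ts) (esym (scalerAl _ _ _))) _.
exact: (linearZ_LR (linext _)).
Qed.

Lemma Fsum_nilE ts : Zlin ts (Fsum [::]) = 1.
Proof. by rewrite /Fsum big_nil Zlin_nil_word. Qed.

(** With [t = q ^+ m / (1 - q ^+ m)], the binomial sum is [t ^+ n * (1 + t) ^+
    (k - n)], that is [q ^+ (m * n) / (1 - q ^+ m) ^+ k]. *)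
Lemma Fsum_tvals a r p kn : (p.2 <= p.1)%N ->
  Zlin (tvals a r.+1) (Fsum (p :: kn)) = Zlin (tvals a.+1 r) (Fsum (p :: kn))
    + q ^+ (a.+1 * p.2) * qfrac a.+1 ^+ p.1 * Zlin (tvals a.+1 r) (Fsum kn).
Proof.
case: p => k n /= le_nk; rewrite !Fsum_consE /= tvalsS.
have -> : q ^+ (a.+1 * n) * qfrac a.+1 ^+ k =
    \sum_(s < (k - n).+1) 'C(k - n, s)%:R *: (q ^+ a.+1 / (1 - q ^+ a.+1)) ^+
      (k - s).
  set t := q ^+ a.+1 / _; have tE : t = q ^+ a.+1 * qfrac a.+1 by [].
  have t1 : qfrac a.+1 = 1 + t.
    by rewrite tE -[X in X + _](qfracK a) [_ * (1 - _)]mulrC -mulrDl subrK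
      mul1r.
  have -> : q ^+ (a.+1 * n) * qfrac a.+1 ^+ k = t ^+ n * (1 + t) ^+ (k - n).
    by rewrite -t1 tE exprMn -exprM -mulrA -exprD subnKC.
  rewrite [1 + t]addrC exprDn mulr_sumr; apply: eq_bigr => s _.
  rewrite expr1n mulr1 mulrnAr -exprD scaler_nat; congr (_ ^+ _ *+ _).
  by have := ltn_ord s; lia.
rewrite mulr_suml -big_split; apply: eq_bigr => s _ /=.
rewrite -scalerAl -scalerDr; congr (_ *: _); exact: Zlin_cons_b.
Qed.

Lemma Fsum_tvals0 a p kn : Zlin (tvals a 0) (Fsum (p :: kn)) = 0.
Proof.
by rewrite Fsum_consE big1 // => s _; rewrite (Zlin_nil_b _ _) scaler0.
Qed.

Lemma absz_add (x y : int) : 0 <= x -> 0 <= y ->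
  absz (x + y)%R = (absz x + absz y)%N.
Proof. lia. Qed.

Lemma G_Fsum r a u : all cst_entry u ->
  q ^+ (a * absz (tot u).2) * G qfrac r (qtails 0 (tails u)) a
  = Zlin (tvals a r) (Fsum (exponents u)).
Proof.
elim: r a u => [|r IHr] a [|p u] uok.
- by rewrite tot_nil muln0 mulr1 Fsum_nilE.
- by rewrite Fsum_tvals0 mulr0.
- by rewrite tot_nil muln0 mulr1 Fsum_nilE.
have /andP[/andP[/eqP hp /andP[ep kp]] u_ok] := uok.
have [tu_h tu_e] : (tot u).1 = 0 /\ 0 <= (tot u).2.
  elim: (u) u_ok => [|p' u' IHu] /=; first by rewrite tot_nil.
  by case/andP=> /andP[/eqP h' /andP[e' _]] /IHu[h0 e0];
    rewrite tot_cons /= h' h0 addr0 addr_ge0.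
rewrite [exponents _]/= Fsum_tvals; last by rewrite -lez_nat gez0_abs.
rewrite -(IHr a.+1 (p :: u) uok) -(IHr a.+1 u u_ok).
rewrite tot_cons /= /texp /= mulr0 add0r.
rewrite (absz_add ep tu_e) !mulnDr !mulSn !exprD.
set A := G _ _ (_ :: _) _; set B := G _ _ _ _; set c := qfrac _ ^+ _.
by ring.
Qed.

(** * Expansion in powers of z *)

(** The tail products, as monomials in [z] over the power series in [q]; the
    exponents are nonnegative under [tail_pos]. *)
Definition ptails (s : symbol) : seq (nat * {poly fps}) :=
  [seq (p.1, (q ^+ absz p.2.2)%:P * 'X^(absz p.2.1)) | p <- s].

(** The truncated sum of a symbol, as a polynomial in [z]. *)
Definition PG (r : nat) (u : symbol) (a : nat) : {poly fps} :=
  G (fun m => (qfrac m)%:P) r (ptails (tails u)) a.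

Lemma PG_horner r u a x : (PG r u a).[x] =
  G qfrac r [seq (p.1, q ^+ absz p.2.2 * x ^+ absz p.2.1) | p <- tails u] a.
Proof.
rewrite -[LHS]/(horner_eval x _) /PG (G_morph (c' := qfrac)); last first.
  by move=> m; exact: hornerC.
rewrite /ptails -map_comp; congr G; apply: eq_map => p /=.
by rewrite /horner_eval hornerM hornerC hornerXn.
Qed.

Lemma PG_ev r u a t : all (fun p => tail_pos p.2) (tails u) ->
  (PG r u a).[q ^+ t] = G qfrac r (qtails t (tails u)) a.
Proof.
move/allP=> upos; rewrite PG_horner; congr G;
  apply/eq_in_map => -[k [h e]] /upos.
rewrite /tail_pos /texp /= -exprM -exprD => pos; congr (_, q ^+ _).
by case/orP: pos => /andP[/eqP-> e0]; lia.
Qed.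

Lemma PG_1 r u a : (PG r u a).[1] = G qfrac r (qtails 0 (tails u)) a.
Proof.
rewrite PG_horner; congr G; apply: eq_map => p.
by rewrite expr1n mulr1 /texp mulr0 add0r.
Qed.

(** The sum of the coefficients of degree at most [N]. *)
Definition trunc (N : nat) (p : {poly fps}) : fps := \sum_(i < N.+1) p`_i.

Lemma truncD N p p' : trunc N (p + p') = trunc N p + trunc N p'.
Proof. by rewrite -big_split; apply: eq_bigr => i _; rewrite coefD. Qed.

Lemma truncB N p p' : trunc N (p - p') = trunc N p - trunc N p'.
Proof. by rewrite -sumrB; apply: eq_bigr => i _; rewrite coefB. Qed.

Lemma truncC N c p : trunc N (c%:P * p) = c * trunc N p.
Proof. by rewrite /trunc mulr_sumr; apply: eq_bigr => i _; rewrite coefCM. Qed.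

Lemma trunc_sum (I : Type) N (r : seq I) (F : I -> {poly fps}) :
  trunc N (\sum_(i <- r) F i) = \sum_(i <- r) trunc N (F i).
Proof.
rewrite /trunc exchange_big; apply: eq_bigr => i _; exact: coef_sum.
Qed.

Lemma trunc_Xn N m p : (N < m)%N -> trunc N ('X^m * p) = 0.
Proof.
move=> Nm; rewrite /trunc big1 // => i _; rewrite coefXnM.
by rewrite (leq_trans (ltn_ord i) Nm).
Qed.

Lemma trunc_X N m : (m <= N)%N -> trunc N 'X^m = 1.
Proof.
rewrite -ltnS => mN; rewrite /trunc (bigD1 (Ordinal mN)) //= coefXn eqxx big1
  ?addr0 //.
by move=> i /negbTE im; rewrite coefXn -val_eqE /= in im *; rewrite im.
Qed.

Lemma trunc_horner N (p : {poly fps}) : (size p <= N)%N -> trunc N p = p.[1].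
Proof.
move=> le_pN; rewrite (horner_coef_wide _ (leqW le_pN)); apply: eq_bigr => i _.
by rewrite expr1n mulr1.
Qed.

(** The coefficient of [z ^+ m] in a symbol of [C_z^0] collects the terms with
    [m_d = m]. *)
Lemma trunc_Cz r N a w : in_Cz 0 w -> (a <= N <= a + r)%N ->
  trunc N ((q ^+ (a * absz (tot w).2))%:P * 'X^(a * absz (tot w).1) * PG r w a)
  = Zlin (tvals a (N - a)) (Fsum (exponents w)).
Proof.
elim: r a w => [|r IHr] a [|p w] wC /andP[aN Nar].
- by rewrite tot_nil !muln0 mul1r /PG G_nil mul1r Fsum_nilE (trunc_X (leq0n N)).
- rewrite addn0 in Nar; have -> : N = a by apply/eqP; rewrite eqn_leq Nar.
  by rewrite subnn Fsum_tvals0 /PG /= mulr0 /trunc big1 // => i _;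
    rewrite coef0.
- by rewrite tot_nil !muln0 mul1r /PG G_nil mul1r Fsum_nilE (trunc_X (leq0n N)).
have [tot_h tot_e] : (tot (p :: w)).1 = 1 /\ 0 <= (tot (p :: w)).2.
  by have /andP[/andP[/eqP + ?] _] := Cz_tails (lexx 0) wC; rewrite tot_cons.
have tailsE : ptails (tails (p :: w)) =
    (p.1, (q ^+ absz (tot (p :: w)).2)%:P * 'X^1) :: ptails (tails w).
  have -> : tails (p :: w) = (p.1, tot (p :: w)) :: tails w by rewrite tot_cons.
  by rewrite [LHS]/= tot_h.
have splitE : (q ^+ (a * absz (tot (p :: w)).2))%:P * 'X^(a * 1) * PG r.+1 (p
  :: w) a
  = (q ^+ (a.+1 * absz (tot (p :: w)).2))%:P * 'X^(a.+1 * 1) * PG r (p :: w)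
    a.+1
    + (qfrac a.+1 ^+ p.1)%:P *
      ((q ^+ (a.+1 * absz (tot (p :: w)).2))%:P * 'X^(a.+1) * PG r w a.+1).
  rewrite [PG r.+1 _ _]/PG tailsE G_cons -tailsE -!/(PG _ _ _) /= -polyC_exp.
  rewrite !muln1 !mulSn !exprD polyCM (exprS 'X a) expr1.
  move: (_%:P) (_%:P) (_%:P) (PG r (p :: w) _) (PG r w _) ('X^a) => x y z A B X.
  by ring.
rewrite tot_h splitE truncD truncC.
have [Na|aN'] := leqP N a.
  have -> : N = a by apply/eqP; rewrite eqn_leq Na.
  rewrite subnn Fsum_tvals0 -!mulrA !truncC muln1 !trunc_Xn ?mulr0 ?addr0 //.
have -> : (N - a)%N = (N - a.+1).+1 by lia.
have bounds : (a.+1 <= N <= a.+1 + r)%N by rewrite aN' /= addSnnS.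
have := IHr a.+1 _ wC bounds; rewrite tot_h => ->.
have [ep [kp restE]] : 0 <= p.2.2 /\ p.2.2 <= p.1%:Z /\
    trunc N ((q ^+ (a.+1 * absz (tot (p :: w)).2))%:P * 'X^(a.+1) * PG r w a.+1)
    = q ^+ (a.+1 * absz p.2.2) * Zlin (tvals a.+1 (N - a.+1)) (Fsum (exponents
      w)).
  case: wC => // -[s [k [e [wE sok /andP[e0 ek]]]]]; rewrite subr0 in e0 ek.
  case: s wE sok => [[-> ->] _|p' s [pE wE]] /=.
    split=> //; split=> //; rewrite tot_cons tot_nil /= addr0.
    by rewrite /PG G_nil mulr1 truncC trunc_X // Fsum_nilE.
  case/andP=> /andP[/eqP hp' /andP[ep' kp']] sok; rewrite -pE in hp' ep' kp'.
  split=> //; split=> //.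
  have w'C : in_Cz 0 w by right; exists s, k, e; rewrite subr0 e0 ek.
  have h1 : (tot w).1 = 1.
    by have := tot_h; rewrite tot_cons /= hp' add0r.
  have e1 : 0 <= (tot w).2.
    have := Cz_tails (lexx 0) w'C; case: (w) => [|p1 w1];
      first by rewrite tot_nil.
    by rewrite [tails _]/= -tot_cons => /andP[/andP[]].
  have := IHr a.+1 _ w'C bounds; rewrite h1 muln1 => <-.
  rewrite tot_cons /= (absz_add ep' e1) mulnDr exprD polyCM -!mulrA.
  by rewrite truncC.
rewrite restE [exponents (_ :: _)]/= Fsum_tvals /=;
  last by rewrite -lez_nat gez0_abs.
by congr (_ + _); rewrite mulrA [_ * q ^+ _]mulrC.
Qed.

(** [p] belongs to the [n]-th power of the ideal generated by [z] and [q]. *)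
Definition jlow (n : nat) (p : {poly fps}) : Prop := forall i, low (n - i) p`_i.

(** All coefficients of [p] are divisible by [q ^+ n]. *)
Definition clow (n : nat) (p : {poly fps}) : Prop := forall i, low n p`_i.

Lemma low_0 f : low 0 f. Proof. exact/low_coefP. Qed.

Lemma jlow0 n : jlow n 0. Proof. by move=> i; rewrite coef0 low0. Qed.

Lemma jlow_all p : jlow 0 p. Proof. by move=> i; rewrite low_0. Qed.

Lemma jlowD n p p' : jlow n p -> jlow n p' -> jlow n (p + p').
Proof. by move=> pn pn' i; rewrite coefD lowD. Qed.

Lemma jlowN n p : jlow n p -> jlow n (- p).
Proof. by move=> pn i; rewrite coefN lowN. Qed.

Lemma jlowM m n p p' : jlow m p -> jlow n p' -> jlow (m + n) (p * p').
Proof.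
move=> pm pn i; rewrite coefM; apply: low_sum => j _.
apply: low_le (lowM (pm j) (pn (i - j)%N)).
by have := ltn_ord j; lia.
Qed.

Lemma jlow_le m n p : (m <= n)%N -> jlow n p -> jlow m p.
Proof. by move=> mn pn i; apply: low_le (pn i); apply: leq_sub2r. Qed.

Lemma jlowC n c p : jlow n p -> jlow n (c%:P * p).
Proof. by move=> pn i; rewrite coefCM lowMr. Qed.

Lemma clow0 n : clow n 0. Proof. by move=> i; rewrite coef0 low0. Qed.

Lemma clow_all p : clow 0 p. Proof. by move=> i; rewrite low_0. Qed.

Lemma clowD n p p' : clow n p -> clow n p' -> clow n (p + p').
Proof. by move=> pn pn' i; rewrite coefD lowD. Qed.

Lemma clowM m n p p' : clow m p -> clow n p' -> clow (m + n) (p * p').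
Proof.
by move=> pm pn i; rewrite coefM; apply: low_sum => j _; apply: lowM.
Qed.

Lemma clow_le m n p : (m <= n)%N -> clow n p -> clow m p.
Proof. by move=> mn pn i; apply: low_le (pn i). Qed.

Lemma PG_jlow r r' u a : (r <= r')%N -> all (fun p => tail_pos p.2) (tails u) ->
  jlow r.+1 (PG r' u a - PG r u a).
Proof.
move=> le_rr' /allP upos.
apply: (@G_stable _ _ jlow jlow0 jlow_all jlowD jlowM jlow_le) => //.
move=> _ /mapP[[k [h e]] /upos /= pos ->] i; rewrite coefCM coefXn.
case/orP: pos => /andP[/eqP/= -> /= e0].
  by case: i => [|i]; rewrite ?mulr0 ?low0 // low_0.
case: i => [|i]; last by rewrite low_0.
by rewrite mulr1; apply: low_le (low_q _); lia.
Qed.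

Lemma PG_clow r r' u a : (r <= r')%N -> all (fun p => 0 < p.2.2) (tails u) ->
  clow r.+1 (PG r' u a - PG r u a).
Proof.
move=> le_rr' /allP upos.
apply: (@G_stable _ _ clow clow0 clow_all clowD clowM clow_le) => //.
move=> _ /mapP[[k [h e]] /upos /= pos ->] i; rewrite coefCM.
by apply/lowMl/(low_le _ (low_q _)); lia.
Qed.

(** A compatible sequence of polynomials in [z] that tend to [0] at all points
    [z = q ^+ t] tends to [0] coefficientwise. *)
Lemma jlow_of_values (d : nat -> {poly fps}) :
  (forall B B', (B <= B')%N -> jlow B.+1 (d B' - d B)) ->
  (forall B t, (0 < t)%N -> low B.+1 (d B).[q ^+ t]) ->
  forall B, jlow B.+1 (d B).
Proof.
move=> compat values B i; elim/ltn_ind: i B => i IHi B.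
(* At [z = q ^+ t], the terms of degree larger than [i] in [z] vanish modulo [q
   ^+ (t * i.+1)], and so do those of smaller degree by induction, as [B'] is
   large. *)
pose t := B.+1; pose B' := (t * i.+1)%N.
have BB' : (B <= B')%N.
  by apply: leq_trans (leqnSn B) _; rewrite /B' leq_pmulr.
have di : low (B.+1 - i) (d B')`_i.
  have := values B' t isT; rewrite horner_coef.
  have [lt_i|le_i] := ltnP i (size (d B')); last by rewrite nth_default ?low0.
  rewrite (bigD1 (Ordinal lt_i)) //=; set s := \sum_(j < _ | _) _ => v.
  have low_s : low (t * i.+1) s.
    apply: low_sum => j ji; rewrite -exprM.
    have [lt_ji|lt_ij|eq_ji] := ltngtP j i.
    - apply: low_le (lowM (IHi _ lt_ji B') (low_q _)).
      rewrite -/B'; have : (j <= t * j)%N by rewrite leq_pmull.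
      by lia.
    - by apply/lowMr/(low_le _ (low_q _)); rewrite leq_mul2l lt_ij orbT.
    - by rewrite -val_eqE /= eq_ji eqxx in ji.
  have : low (t * i + t) (q ^+ (t * i) * (d B')`_i).
    rewrite -mulnSr mulrC exprM -[_ * _](addrK s).
    by apply: lowB low_s; apply: low_le v; rewrite /B'.
  by move/low_qXK; apply: low_le; rewrite leq_subr.
rewrite -[_`_i](subKr (d B')`_i); apply: lowB => //.
by have := compat _ _ BB' i; rewrite coefB.
Qed.

Lemma in_C_entries c : in_C c -> all cst_entry c.
Proof.
case/andP=> /asboolP[n Fc] /allP ci; apply/(all_nthP sym0) => i lt_ic.
case/in_FnP: Fc => /(_ i lt_ic) /and3P[_ _ +] _.
have /eqP h0 := ci _ (mem_nth sym0 lt_ic).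
by rewrite /cst_entry h0 mul0r subr0 eqxx.
Qed.

Lemma Cz_tail_pos w : in_Cz 0 w -> all (fun p => tail_pos p.2) (tails w).
Proof.
move=> wC; apply: sub_all (Cz_tails (lexx 0) wC) => p /=.
by rewrite /tail_pos => ->.
Qed.

Lemma tail_pos_qtails t s : (0 < t)%N -> all (fun p => tail_pos p.2) s ->
  forall n, low n.+1 (G qfrac n (qtails t s) 0 - Gsum (qtails t s)).
Proof. by move=> t0 pos n; apply/GsumP/low1_qtails. Qed.

(** Comparison of the sums of the coefficients of [z ^+ i] for [i <= N] in the
    two sides of the identity between [u] and [phi u]. *)
Lemma phi_trunc u n : in_Fn 0 u -> all (fun p => 0 < p.2.2) (tails u) ->
  exists N0, forall N, (N0 <= N)%N ->
    low n.+1 (ev_sym 0 u - linext (fun p : symbol * symbol => ev_sym 0 p.1 *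
      Zlin (tvals 0 N) (Fsum (exponents p.2))) (phi_rec (weight u) u)).
Proof.
move=> Fu upos; have upos' := tails_pos (lexx 0) Fu.
have [spX evX] := phi_rec_spec (lexx 0) Fu erefl.
set X := phi_rec _ _ in spX evX *.
pose d B := PG B u 0
  - \sum_(p <- msupp X) (X@_p *: ev_sym 0 p.1)%:P * PG B p.2 0.
have d_low : forall B, jlow B.+1 (d B).
  apply: jlow_of_values => [B B' BB'|B t t0].
    have -> : d B' - d B = PG B' u 0 - PG B u 0
        - \sum_(p <- msupp X) (X@_p *: ev_sym 0 p.1)%:P * (PG B' p.2 0 - PG B
          p.2 0).
      rewrite (eq_bigr (fun p => (X@_p *: ev_sym 0 p.1)%:P * PG B' p.2 0
        - (X@_p *: ev_sym 0 p.1)%:P * PG B p.2 0)); last by move=> p _;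
          rewrite mulrBr.
      rewrite sumrB /d; move: (\sum_(_ <- _) _) (\sum_(_ <- _) _) => x y.
      by ring.
    apply: jlowD; first exact: PG_jlow.
    apply: jlowN; rewrite big_seq; apply: (big_ind (jlow B.+1)) => [||p Xp].
    - exact: jlow0.
    - by move=> *; apply: jlowD.
    - have [_ pC] := spX p Xp.
      by apply/jlowC/PG_jlow => //; apply: Cz_tail_pos.
  rewrite /d hornerD hornerN horner_sum PG_ev //.
  have -> : \sum_(p <- msupp X) ((X@_p *: ev_sym 0 p.1)%:P * PG B p.2 0).[q ^+
    t]
    = linext (fun p : symbol * symbol =>
        ev_sym 0 p.1 * G qfrac B (qtails t (tails p.2)) 0) X.
    apply: eq_big_seq => p Xp; have [_ pC] := spX p Xp.
    rewrite hornerM hornerC PG_ev ?scalerAl //; exact: Cz_tail_pos.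
  have uE := tail_pos_qtails t0 upos' B; apply: (low_trans uE).
  rewrite -/(ev_sym t u) -evX // /ev2 -linextN -linextD.
  apply: (low_linext spX) => p [_ pC]; rewrite -mulrBr; apply/lowMr/lowC.
  by apply: tail_pos_qtails => //; apply: Cz_tail_pos.
exists (maxn n (size (PG n u 0))) => N; rewrite geq_max => /andP[nN sN].
pose B := (N + n)%N.
have trunc_low (p : {poly fps}) : jlow B.+1 p -> low n.+1 (trunc N p).
  move=> pB; apply: low_sum => i _; apply: low_le (pB i).
  by have := ltn_ord i; rewrite /B; lia.
have -> : linext (fun p : symbol * symbol => ev_sym 0 p.1 *
      Zlin (tvals 0 N) (Fsum (exponents p.2))) X
    = trunc N (\sum_(p <- msupp X) (X@_p *: ev_sym 0 p.1)%:P * PG B p.2 0).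
  rewrite trunc_sum; apply: eq_big_seq => p Xp; have [_ pC] := spX p Xp.
  rewrite truncC -scalerAl; congr (_ *: (_ * _)).
  have bounds : (0 <= N <= 0 + B)%N by exact: leq_addr.
  by have := trunc_Cz pC bounds; rewrite !mul0n subn0 !mul1r => ->.
have := trunc_low _ (d_low B); rewrite /d truncB => H2.
apply: (low_trans _ H2).
have H1 : low n.+1 (trunc N (PG B u 0) - trunc N (PG n u 0)).
  rewrite -truncB; apply: low_sum => i _; apply: PG_clow => //.
  by rewrite leq_addl.
apply: lowC; apply: (low_trans H1); rewrite trunc_horner // PG_1.
apply: GsumP => _ /mapP[[k [h e]] /(allP upos) /= e0 ->].
by apply: (low_le _ (low_q _)); rewrite /texp mulr0 add0r /=; lia.
Qed.

(** * Regularized values *)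

(** The sequence [f] behaves like a polynomial in [N] with constant term [l],
    for each power of [q]. *)
Definition regular (f : nat -> fps) (l : fps) : Prop :=
  exists2 p : {poly fps}, p.[0] = l & forall N, low N.+1 (f N - p.[N%:R]).

Lemma regular0 : regular (fun=> 0) 0.
Proof. by exists 0 => [|N]; rewrite horner0 ?subrr ?low0. Qed.

Lemma regularD f g l m : regular f l -> regular g m ->
  regular (fun N => f N + g N) (l + m).
Proof.
move=> [p <- fp] [p' <- gp]; exists (p + p') => [|N]; rewrite hornerD //.
by rewrite opprD addrACA lowD.
Qed.

Lemma regularM c f l : regular f l -> regular (fun N => c * f N) (c * l).
Proof.
move=> [p <- fp]; exists (c%:P * p) => [|N]; rewrite hornerM hornerC //.
by rewrite -mulrBr lowMr.
Qed.

Lemma regularZ a f l : regular f l -> regular (fun N => a *: f N) (a *: l).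
Proof.
move=> /(regularM a%:A); rewrite mulr_algl.
by congr regular; apply/funext => N; rewrite mulr_algl.
Qed.

Lemma regular_linext (K : choiceType) (P : K -> Prop) (f : nat -> K -> fps)
    (l : K -> fps) x :
  spanned P x -> (forall k, P k -> regular (f^~ k) (l k)) ->
  regular (fun N => linext (f N) x) (linext l x).
Proof.
rewrite /spanned /linext => Px fl.
have : forall k, k \in (msupp x : seq K) -> P k by [].
elim: (msupp x : seq K) => [|k s IHs] Ps.
  rewrite big_nil (_ : (fun N => _) = (fun=> 0)); first exact: regular0.
  by apply/funext => N; rewrite big_nil.
rewrite big_cons (_ : (fun N => _) =
    (fun N => x@_k *: f N k + \sum_(k <- s) x@_k *: f N k)); last first.
  by apply/funext => N; rewrite big_cons.
apply: regularD; first by apply/regularZ/fl/Ps; rewrite mem_head.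
by apply: IHs => k' sk'; apply: Ps; rewrite in_cons sk' orbT.
Qed.

Lemma fcoef_horner_nat (p : {poly fps}) n N :
  fcoef p.[N%:R] n = (\poly_(j < size p) fcoef p`_j n).[N%:R].
Proof.
rewrite horner_coef fcoef_sum horner_poly; apply: eq_bigr => j _.
rewrite -!natrX mulr_natr mulr_natr.
by elim: (N ^ j)%N => [|m IHm]; rewrite ?mulr0n // !mulrS -IHm.
Qed.

(** A polynomial that is eventually constant is constant. *)
Lemma regular_limit f l v : regular f l ->
  (forall n, exists N0, forall N, (N0 <= N)%N -> low n.+1 (v - f N)) -> v = l.
Proof.
move=> [p <- fp] lim; apply/fpsP => n; have [N0 limN] := lim n.
pose r := \poly_(j < size p) fcoef p`_j n - (fcoef v n)%:P.
have r_root N : (maxn N0 n <= N)%N -> root r N%:R.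
  rewrite geq_max => /andP[N0N nN].
  rewrite /root hornerD hornerN hornerC -fcoef_horner_nat subr_eq0; apply/eqP.
  by rewrite (low_eq_coef (limN _ N0N) (ltnSn n)) (low_eq_coef (fp N)).
have r0 : r = 0.
  apply/eqP; apply: contraT => nz_r.
  pose rs : seq rat := [seq N%:R | N <- iota (maxn N0 n) (size r)].
  have : (size rs < size r)%N.
    apply: max_poly_roots => //.
      by apply/allP => _ /mapP[N + ->]; rewrite mem_iota => /andP[/r_root].
    by rewrite map_inj_uniq ?iota_uniq //; apply: (mulrIn (oner_neq0 _)).
  by rewrite size_map size_iota ltnn.
have /eqP := congr1 (fun r' : {poly rat} => r'`_0) r0.
rewrite horner_coef0 coef0 coefB coefC coef_poly /= subr_eq0 => /eqP <-.
by case: (size p) (size_poly_eq0 p) => [/esym/eqP->|//]; rewrite coef0.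
Qed.

Lemma ZSZ_incl N (x : QB0) : low N.+1 (Zlin (tvals 0 N) (incl x) - ZSZ x).
Proof.
have -> : Zlin (tvals 0 N) (incl x) =
    linext (fun w : word0 => Zw (tvals 0 N) (val w)) x.
  apply: etrans (linext_comp _ _ x) _; apply: eq_linext => w; exact: linextU.
rewrite /ZSZ -linextN -linextD.
apply: (@low_linext _ (fun=> True)) => // w _; exact: ZSZ_word_low.
Qed.

Lemma regular_word (w : {fmonom nat}) :
  regular (fun N => Zw (tvals 0 N) w) (ZSZ (reg << w >>)).
Proof.
have [c [wE ->]] := reg_exists w.
exists (\sum_(j < size c) (ZSZ c`_j)%:P * 'X^j).
  rewrite horner_sum; case: c {wE} => [|c0 c].
    rewrite big_ord0; exact: (esym (linear0 (linext ZSZ_word))).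
  rewrite big_ord_recl big1 => [|j _]; rewrite hornerM hornerC hornerXn.
    by rewrite expr0 mulr1 addr0.
  by rewrite expr0n mulr0.
move=> N; rewrite -Zlin_word wE.
have -> : Zlin (tvals 0 N)
      (\sum_(j < size c) stuffle (incl c`_j) (stuffle_exp (b_ 0) j))
    = \sum_(j < size c) Zlin (tvals 0 N) (incl c`_j) * N%:R ^+ j.
  apply: etrans (linear_sum (linext _) _ _ _) _; apply: eq_bigr => j _.
  apply: etrans (Zlin_stuffle _ _ _) _; rewrite Zlin_exp_b0.
  by rewrite size_map size_iota.
rewrite horner_sum -sumrB; apply: low_sum => j _.
by rewrite hornerM hornerC hornerXn -mulrBl; apply/lowMl/ZSZ_incl.
Qed.

Lemma ZSZ_proj0 N x : spanned (fun w : {fmonom nat} => admissible w) x ->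
  low N.+1 (Zlin (tvals 0 N) x - ZSZ (proj0 x)).
Proof.
move=> xa; have -> : ZSZ (proj0 x) = linext (fun w : {fmonom nat} =>
    ZSZ (if insub w is Some w0 then << w0 >> else 0)) x by exact: linext_comp.
rewrite /Zlin -linextN -linextD; apply: (low_linext xa) => w wa.
rewrite insubT; have -> : ZSZ << Sub w wa >> = ZSZ_word (Sub w wa) by exact:
  linextU.
exact: (ZSZ_word_low (Sub w wa)).
Qed.

Lemma Fsum_cons p kn : Fsum (p :: kn) =
  \sum_(s < (p.1 - p.2).+1) 'C(p.1 - p.2, s)%:R *: (b_ (p.1 - s) * Fsum kn).
Proof.
rewrite /Fsum big_cons mulr_suml; apply: eq_bigr => s _.
exact: esym (scalerAl _ _ _).
Qed.

Lemma Fsum_spanned kn : kn <> [::] ->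
  (0 < (last (0, 0) kn).2 <= (last (0, 0) kn).1)%N ->
  spanned (fun w : {fmonom nat} => last 0%N w != 0%N) (Fsum kn).
Proof.
elim: kn => // p kn IHkn _ kn_ok; rewrite Fsum_cons.
apply: (big_ind (spanned _)) => [||s _]; [exact: spanned0|exact: spannedD|].
apply: spannedZ; rewrite b_linext.
case: kn IHkn kn_ok => [_ /andP[p0 pp]|p' kn IHkn kn_ok].
  rewrite /Fsum big_nil.
  apply: (@spanned_linext _ _ _ (fun w : {fmonom nat} => w = FMonom [::])).
    by rewrite (_ : 1 = << FMonom [::] >> :> QB) -?fmoneE //; apply: spannedU.
  move=> w ->; apply: spannedU => /=; have := ltn_ord s.
  by rewrite /= in p0 pp; lia.
apply: (spanned_linext (IHkn _ kn_ok)) => // w w0; apply: spannedU => /=.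
by case: w w0 => [[]].
Qed.

Lemma tails_gt0 u : all (fun p => 0 <= p.2.2) u ->
  u = [::] \/ 0 < (last sym0 u).2.2 -> all (fun p => 0 < p.2.2) (tails u).
Proof.
case=> // + [->//|]; case: u => // p u u0 last0.
suff : 0 < (tot (p :: u)).2 /\ all (fun p => 0 < p.2.2) (tails (p :: u)) by
  case.
elim: u p u0 last0 => [|p' u IHu] p /=; first by rewrite tot_cons tot_nil /=
  addr0 => _ ->.
move=> /andP[p0 u0] last0; have [t0 /= ->] := IHu p' u0 last0.
by rewrite tot_cons /=; have := ltr_wpDl p0 t0; rewrite /= andbT => ->.
Qed.

(** The series of a convergent [z]-independent symbol is the value of its image
    by [pi]. *)
Lemma ev_sym_cst (c : symbol) :
  all cst_entry c -> c = [::] \/ 0 < (last sym0 c).2.2 ->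
  ev_sym 0 c = ZSZ (Defs.pi << c >>).
Proof.
move=> cC c0; apply/eqP; rewrite -subr_eq0; apply/eqP/low_eq0 => n.
apply: (@low_le n n.+1) => //.
have pos : all (fun p => 0 < p.2.2) (tails c).
  by apply: tails_gt0 c0; apply: sub_all cC => p /andP[_ /andP[]].
have low1 : forall p, p \in qtails 0 (tails c) -> low 1 p.2.
  move=> _ /mapP[[k [h e]] /(allP pos) /= e0 ->].
  by apply: (low_le _ (low_q _)); rewrite /texp mulr0 add0r /=; lia.
apply: (low_trans (lowC (GsumP n low1))).
have := G_Fsum n 0 cC; rewrite mul0n mul1r => ->.
have -> : Defs.pi << c >> = proj0 (Fsum (exponents c)) by exact: linextU.
apply: ZSZ_proj0; case: c0 => [->|c0].
  rewrite /Fsum big_nil; apply: (@spanned_sub _ (fun w => w = mone));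
    last exact: spannedU.
  by move=> w ->; exact: admissible1.
apply: (@spanned_sub _ (fun w : {fmonom nat} => last 0%N w != 0%N)).
  by move=> [[]].
apply: Fsum_spanned; first by case: (c) c0.
case/lastP: c cC c0 {pos low1} => // c p; rewrite all_rcons last_rcons.
case/andP=> /andP[_ /andP[p0 pk]] _ p0'; rewrite /exponents map_rcons
  last_rcons /=.
by rewrite absz_gt0 gt_eqF //= -lez_nat gez0_abs.
Qed.

Lemma last_tail_ok u : all (fun p => tail_ok p.2) (tails u) -> u <> [::] ->
  tail_ok (last sym0 u).2.
Proof.
elim: u => // p [|p' u] IHu /=; first by rewrite tot_nil addr0 andbT.
by case/andP=> _ /IHu IH _; apply: IH.
Qed.

Lemma in_C_last c : in_C c -> c = [::] \/ 0 < (last sym0 c).2.2.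
Proof.
case/andP=> /asboolP[n]; rewrite in_FnE => /andP[_ /last_tail_ok ct] ci.
have [->|/eqP c0] := eqVneq c [::]; first by left.
right; have := ct c0; rewrite /tail_ok.
have /eqP -> : (last sym0 c).2.1 == 0.
  by apply: (allP ci); case: (c) c0 => // p s _; exact: (mem_last p s).
by rewrite orFb andTb.
Qed.

(** The symbol [u] at [z = 1]. *)
Definition at1 (u : symbol) : symbol := [seq (p.1, (0, p.2.2)) | p <- u].

Lemma in_G_spec u : in_G u ->
  [/\ in_Fn 0 u, all (fun p => 0 < p.2.2) (tails u), all cst_entry (at1 u)
    & at1 u = [::] \/ 0 < (last sym0 (at1 u)).2.2].
Proof.
case/andP=> Fu last_u; have uE p : p \in u -> 0 <= p.2.2 <= p.1%:Z.
  move=> /(nthP sym0)[i lt_iu <-]; case/in_FnP: Fu => /(_ i lt_iu) /and3P[_ _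
    +] _.
  by rewrite mulr0 subr0.
have last0 : u = [::] \/ 0 < (last sym0 u).2.2.
  have [->|/eqP u0] := eqVneq u [::]; first by left.
  right; move: Fu; rewrite in_FnE => /andP[_ /last_tail_ok /(_ u0)].
  case/orP: last_u => [/eqP//|]; have : last sym0 u \in u.
    by case: (u) u0 => // p s _; exact: (mem_last p s).
  move/uE; case: (last sym0 u) => k [h e] /= /andP[e0 _].
  rewrite /tail_ok /= xpair_eqE negb_and; case: eqP => [->|] //=; last first.
    by move=> _ _ /andP[].
  by move=> e1 _; rewrite lt_def e1.
split=> //.
- by apply: tails_gt0 last0; apply/allP => p /uE /andP[].
- by apply/allP => _ /mapP[p /uE pe ->]; rewrite /cst_entry eqxx.
case: last0 => [->|last0]; [by left|right].
by case: (u) last0 => //= p s; rewrite (last_map (fun p => (p.1, (0, p.2.2)))).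
Qed.

Lemma ev_sym_at1 u : ev_sym 0 (at1 u) = ev_sym 0 u.
Proof.
have totE v : (tot (at1 v)).2 = (tot v).2.
  by elim: v => [|p v IHv] //; rewrite /= !tot_cons /= IHv.
rewrite /ev_sym; congr Gsum; elim: u => //= p u ->.
by rewrite /texp !mulr0 /= totE.
Qed.

(** The confluence relation of a single symbol. *)
Lemma confluence u : in_G u ->
  linext (fun p : symbol * symbol => ZSZ (Defs.pi << p.1 >>) *
    linext (fun w : {fmonom nat} => ZSZ (reg << w >>)) (Fsum (exponents p.2)))
    (phi_rec (weight u) u)
  = ZSZ (Defs.pi << at1 u >>).
Proof.
move=> uG; have [Fu upos u1C u1_0] := in_G_spec uG.
have [spX _] := phi_rec_spec (lexx 0) Fu erefl.
apply: etrans _ (etrans (esym (ev_sym_at1 u)) (ev_sym_cst u1C u1_0));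
  apply: esym.
apply: (@regular_limit (fun N => linext (fun p : symbol * symbol => ev_sym 0
  p.1 *
  Zlin (tvals 0 N) (Fsum (exponents p.2))) (phi_rec (weight u) u))); last first.
  by move=> n; exact: phi_trunc.
apply: (regular_linext spX) => p [pC _].
rewrite (ev_sym_cst (in_C_entries pC) (in_C_last pC)); apply: regularM.
by apply: (@regular_linext _ (fun=> True)) => // w _; exact: regular_word.
Qed.

(** * Confluence relations *)

Lemma linext_linext (K K' : choiceType) (V : lmodType rat) (g : K' -> V)
    (f : K -> {malg rat[K']}) x :
  linext g (linext f x) = linext (fun k => linext g (f k)) x.
Proof. exact: linext_comp. Qed.

Lemma ZSZ_m_odot y :
  ZSZ_sym (m_odot y) = linext (fun p => ZSZ_word p.1 * ZSZ_word p.2) y.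
Proof.
apply: etrans (linext_comp ZSZ_sym _ y) _; apply: eq_linext => p.
have E w : ZSZ_sym (iota1 << w >>) = ZSZ_word w.
  by apply: etrans (ZSZ_symK _) _; exact: linextU.
by apply: etrans (rmorphM ZSZ_sym _ _) _; congr (_ * _); exact: E.
Qed.

Lemma ZSZ_m_odot_reg y : ZSZ_sym (m_odot (tmap id reg y))
  = linext (fun p => ZSZ_word p.1 * ZSZ (reg << p.2 >>)) y.
Proof.
apply: etrans (ZSZ_m_odot _) _; apply: etrans (linext_linext _ _ y) _.
apply: eq_linext => p; apply: etrans (linext_tens _ _ _ _) _.
by congr (_ * _); exact: linextU.
Qed.

Lemma ZSZ_phi_pi x : ZSZ_sym (m_odot (tmap id reg (phi_pi x))) =
  linext (fun u => linext (fun p : symbol * symbol => ZSZ (Defs.pi << p.1 >>) *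
    linext (fun w : {fmonom nat} => ZSZ (reg << w >>)) (Fsum (exponents p.2)))
    (phi_rec (weight u) u)) x.
Proof.
apply: etrans (ZSZ_m_odot_reg _) _; rewrite /phi_pi.
apply: etrans (linext_linext _ _ (phi x)) _;
  apply: etrans (linext_linext _ _ x) _.
apply: eq_linext => u; apply: eq_linext => p.
apply: etrans (linext_tens ZSZ_word (fun w => ZSZ (reg << w >>)) _ _) _.
by congr (_ * linext _ _); exact: linextU.
Qed.

Lemma ZSZ_CF_gens : CF_gens `<=` [set x : SymQB0 | ZSZ_sym x = 0].
Proof.
move=> _ [-> | [x xG <-]] /=.
  apply: etrans (linearB ZSZ_sym _ _) _; apply/eqP; rewrite subr_eq0; apply/eqP.
  apply: etrans (ZSZ_symK _) _; apply: etrans (esym (rmorph1 ZSZ_sym)).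
  apply: etrans (linextU _ _) _; apply/fpsP => n.
  by rewrite ZSZ_wordE ZSZ_partialE /= fm1 Zw_nil.
apply: etrans (linearB ZSZ_sym _ _) _; apply/eqP; rewrite subr_eq0; apply/eqP.
apply: etrans (ZSZ_phi_pi _) _; apply: etrans _ (esym (ZSZ_symK _)).
apply: etrans (esym (linext_linext ZSZ_word _ _)).
apply: etrans (esym (linext_linext _ _ x)).
apply: (eq_linext_spanned (P := fun u => in_G u)) => [|u uG]; first exact: xG.
apply: etrans (confluence uG) _; exact: (linext_linext _ _ << at1 u >>).
Qed.

Theorem theorem27 :
  (I_CF_alg `<=` [set x : SymQB0 | ZSZ_sym x = 0]) /\
  (I_CF `<=` [set x : QB0 | ZSZ x = 0]).
Proof.
have alg : I_CF_alg `<=` [set x : SymQB0 | ZSZ_sym x = 0].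
  move=> _ [s [sG ->]]; apply: etrans (raddf_sum ZSZ_sym _ _ _) _.
  rewrite big_seq big1 // => p /sG /ZSZ_CF_gens /= p0.
  apply: etrans (rmorphM ZSZ_sym _ _) _; apply: etrans (congr1 _ p0) (mulr0 _).
split=> // x /alg /= x0; exact: etrans (esym (ZSZ_symK x)) x0.
Qed.
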